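(* Let the balancing scheme be any of AVL trees, red-black trees, weight-balanced trees or treaps. For each recursive function call to $\mathrm{union}$, $\mathrm{intersect}$ or $\mathrm{difference}$ (algorithms in the context) on trees $T_d(v)$ (decomposed, first argument) and $T_p(v)$ (pivot, second argument), the work to do the final $\mathrm{join}$ (or $\mathrm{join2}$) in that call is asymptotically no more than the work to do the $\mathrm{split}$ in that call (in expectation for treaps).
   Context: A binary tree is either $\mathrm{Leaf}$ or $\mathrm{Node}(L,k,R)$; $\mathrm{expose}(\mathrm{Node}(L,k,R))=(L,k,R)$; size $|T|$, weight $w(T)=|T|+1$, height $h(T)$. A BST has keys from a total order with strictly increasing in-order sequence. Schemes and ranks: AVL (children heights differ by at most one; $r(T)=h(T)-1$); red-black (nodes red/black, leaves black, no red node has a red child, equal numbers of black nodes on all downward paths to leaves, root may be red; $\mathrm{bh}(T)$ = number of black nodes on a downward root-to-leaf path including the root; $r(T)=2(\mathrm{bh}(T)-1)$ if the root is black, $2\mathrm{bh}(T)-1$ if red); $\alpha$ weight-balanced with $\frac2{11}<\alpha\le1-\frac1{\sqrt2}$ (every $T=\mathrm{Node}(L,v,R)$ has $\alpha\le w(L)/w(T)\le1-\alpha$; $r(T)=\lceil\log_2 w(T)\rceil-1$); treaps (independent uniformly random priorities, heap-ordered, highest priority at the root; $r(T)=\lceil\log_2w(T)\rceil-1$). For each scheme $\mathrm{join}(T_l,k,T_r)$ is the scheme-specific join algorithm, returning a balanced BST on $T_l\cup\{k\}\cup T_r$, costing $O(|r(T_l)-r(T_r)|)$ work for AVL, RB,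 WB trees and $O(\log t)$ expected work for treaps when $k$ has the $t$-th highest priority, with result rank between $\max(r(T_l),r(T_r))$ and $1+\max(r(T_l),r(T_r))$. Generic algorithms. $\mathrm{split}(T,k)$: if Leaf return $(\mathrm{Leaf},\mathrm{false},\mathrm{Leaf})$; $(L,m,R)=\mathrm{expose}(T)$; if $k=m$ return $(L,\mathrm{true},R)$; if $k<m$: $(L_L,b,L_R)=\mathrm{split}(L,k)$, return $(L_L,b,\mathrm{join}(L_R,m,R))$; else $(R_L,b,R_R)=\mathrm{split}(R,k)$, return $(\mathrm{join}(L,m,R_L),b,R_R)$. $\mathrm{splitLast}(T)$: $(L,k,R)=\mathrm{expose}(T)$; if $R=\mathrm{Leaf}$ return $(L,k)$; else $(T',k')=\mathrm{splitLast}(R)$, return $(\mathrm{join}(L,k,T'),k')$. $\mathrm{join2}(T_l,T_r)$: if $T_l=\mathrm{Leaf}$ return $T_r$; else $(T_l',k)=\mathrm{splitLast}(T_l)$, return $\mathrm{join}(T_l',k,T_r)$. $\mathrm{union}(T_1,T_2)$: if $T_1=\mathrm{Leaf}$ return $T_2$; if $T_2=\mathrm{Leaf}$ return $T_1$; $(L_2,k_2,R_2)=\mathrm{expose}(T_2)$; $(L_1,b,R_1)=\mathrm{split}(T_1,k_2)$; in parallel $T_l=\mathrm{union}(L_1,L_2)$, $T_r=\mathrm{union}(R_1,R_2)$; return $\mathrm{join}(T_l,k_2,T_r)$. $\mathrm{intersect}$: if either argument is Leaf return Leaf; same split and parallel recursion; return $\mathrm{join}(T_l,k_2,T_r)$ if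 $b$ is true else $\mathrm{join2}(T_l,T_r)$. $\mathrm{difference}(T_1,T_2)$ (keys of $T_1$ not in $T_2$): if $T_1=\mathrm{Leaf}$ return Leaf; if $T_2=\mathrm{Leaf}$ return $T_1$; same split and parallel recursion; return $\mathrm{join2}(T_l,T_r)$. In every call the first argument is the decomposed tree and the second the pivot tree. For a node $v$ of the top-level pivot tree $T_p$, $T_p(v)$ is the subtree rooted at $v$ and $T_d(v)$ is the first argument of the recursive call whose second argument is $T_p(v)$ (so $\mathrm{split}(T_d(v),k(v))$ is performed there). Work counts all operations; expose and node creation cost $O(1)$.
   Formalization: The work to do the split is taken as the worst case of splitting T_d(v) over its keys (for treaps per outcome, then averaged); with the actual cost of split(T_d(v),k(v)) the claim fails, e.g. intersect when k(v) is the root of T_d(v). *)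

(* Defs.v *)
From HB Require Import structures.
From mathcomp Require Import all_boot all_order all_algebra.
From mathcomp Require Import all_classical all_reals all_analysis.

Set Implicit Arguments.
Unset Strict Implicit.
Unset Printing Implicit Defensive.

Import Order.TTheory GRing.Theory Num.Theory.

Local Open Scope nat_scope.

(* [A] is the balancing information that is stored in the nodes but is not
   part of the key: the colour for red-black trees, [unit] otherwise. *)
Inductive tree (A K : Type) : Type :=
| Leaf
| Node of tree A K & A & K & tree A K.
Arguments Leaf {A K}.

Section Trees.
Variables A K : Type.
Implicit Types T : tree A K.

Fixpoint size_tree T : nat :=
  if T is Node L _ _ R then (size_tree L + size_tree R).+1 else 0.

Definition weight T : nat := (size_tree T).+1.

Fixpoint height T : nat :=
  if T is Node L _ _ R then (maxn (height L) (height R)).+1 else 0.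

Fixpoint inorder T : seq K :=
  if T is Node L _ k R then inorder L ++ k :: inorder R else [::].

Definition rotateLeft T : tree A K :=
  match T with
  | Node a ax x (Node b ay y c) => Node (Node a ax x b) ay y c
  | _ => T
  end.

Definition rotateRight T : tree A K :=
  match T with
  | Node (Node a ax x b) ay y c => Node a ax x (Node b ay y c)
  | _ => T
  end.

End Trees.

Definition bst (A : Type) (d : Order.disp_t) (K : orderType d)
    (T : tree A K) : bool :=
  sorted (fun x y : K => (x < y)%O) (inorder T).

(* Every algorithm whose work matters returns its result paired with its work.
   The work charges one unit per function invocation; one invocation performs,
   besides the calls it makes, a bounded number of exposes, node creations,
   rotations, comparisons, and reads of the height, black height or size, which
   an implementation stores in the nodes. *)
Definition join_algo (A K : Type) := tree A K -> K -> tree A K -> tree A K * nat.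

Section AVL.
Variable K : Type.
Implicit Types T : tree unit K.

Fixpoint avl T : bool :=
  if T is Node L _ _ R then
    [&& height L <= (height R).+1, height R <= (height L).+1, avl L & avl R]
  else true.

Local Notation node L k R := (Node L tt k R).

(* The Leaf case is unreachable: it is entered only with
   height Tl > height Tr + 1. *)
Fixpoint avl_joinRight Tl (k : K) Tr : tree unit K * nat :=
  match Tl with
  | Leaf => (node Tl k Tr, 1)
  | Node l _ k' c =>
    if height c <= (height Tr).+1 then
      let T' := node c k Tr in
      if height T' <= (height l).+1 then (node l k' T', 1)
      else (rotateLeft (node l k' (rotateRight T')), 1)
    else
      let: (T', n) := avl_joinRight c k Tr in
      let T'' := node l k' T' in
      if height T' <= (height l).+1 then (T'', n.+1)
      else (rotateLeft T'', n.+1)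
  end.

Fixpoint avl_joinLeft Tl (k : K) Tr : tree unit K * nat :=
  match Tr with
  | Leaf => (node Tl k Tr, 1)
  | Node c _ k' r =>
    if height c <= (height Tl).+1 then
      let T' := node Tl k c in
      if height T' <= (height r).+1 then (node T' k' r, 1)
      else (rotateRight (node (rotateLeft T') k' r), 1)
    else
      let: (T', n) := avl_joinLeft Tl k c in
      let T'' := node T' k' r in
      if height T' <= (height r).+1 then (T'', n.+1)
      else (rotateRight T'', n.+1)
  end.

Definition avl_join : join_algo unit K := fun Tl k Tr =>
  if (height Tr).+1 < height Tl then
    let: (T, n) := avl_joinRight Tl k Tr in (T, n.+1)
  else if (height Tl).+1 < height Tr then
    let: (T, n) := avl_joinLeft Tl k Tr in (T, n.+1)
  else (node Tl k Tr, 1).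

End AVL.

Inductive color := Red | Black.

Section RedBlack.
Variable K : Type.
Implicit Types T : tree color K.

Definition is_red T : bool := if T is Node _ Red _ _ then true else false.

(* Leaves are black nodes, hence [bh Leaf = 1]; on trees satisfying [rb] all
   downward paths give the same count, so following the left spine suffices. *)
Fixpoint bh T : nat :=
  match T with
  | Leaf => 1
  | Node L Red _ _ => bh L
  | Node L Black _ _ => (bh L).+1
  end.

Fixpoint rb T : bool :=
  if T is Node L c _ R then
    [&& bh L == bh R, (if c is Red then ~~ is_red L && ~~ is_red R else true),
        rb L & rb R]
  else true.

Definition rb_rank T : nat :=
  if is_red T then (2 * bh T).-1 else 2 * (bh T).-1.

Definition blacken T : tree color K :=
  if T is Node L _ k R then Node L Black k R else T.

Definition left_of T := if T is Node L _ _ _ then L else T.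
Definition right_of T := if T is Node _ _ _ R then R else T.

(* The Leaf case of the recursion is unreachable: a Leaf has the smallest
   rank, so the test on ranks succeeds there. *)
Fixpoint rb_joinRight Tl (k : K) Tr : tree color K * nat :=
  if rb_rank Tl == (rb_rank Tr)./2.*2 then (Node Tl Red k Tr, 1) else
  match Tl with
  | Leaf => (Node Tl Red k Tr, 1)
  | Node L' c' k' R' =>
    let: (T', n) := rb_joinRight R' k Tr in
    match c' with
    | Black =>
      if is_red T' && is_red (right_of T') then
        (if T' is Node L1 c1 k1 R1 then
           rotateLeft (Node L' c' k' (Node L1 c1 k1 (blacken R1)))
         else Node L' c' k' T', n.+1)
      else (Node L' c' k' T', n.+1)
    | Red => (Node L' c' k' T', n.+1)
    end
  end.

Fixpoint rb_joinLeft Tl (k : K) Tr : tree color K * nat :=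
  if rb_rank Tr == (rb_rank Tl)./2.*2 then (Node Tl Red k Tr, 1) else
  match Tr with
  | Leaf => (Node Tl Red k Tr, 1)
  | Node L' c' k' R' =>
    let: (T', n) := rb_joinLeft Tl k L' in
    match c' with
    | Black =>
      if is_red T' && is_red (left_of T') then
        (if T' is Node L1 c1 k1 R1 then
           rotateRight (Node (Node (blacken L1) c1 k1 R1) c' k' R')
         else Node T' c' k' R', n.+1)
      else (Node T' c' k' R', n.+1)
    | Red => (Node T' c' k' R', n.+1)
    end
  end.

Definition rb_join : join_algo color K := fun Tl k Tr =>
  if (rb_rank Tr)./2 < (rb_rank Tl)./2 then
    let: (T', n) := rb_joinRight Tl k Tr in
    (if is_red T' && is_red (right_of T') then blacken T' else T', n.+1)
  else if (rb_rank Tl)./2 < (rb_rank Tr)./2 then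
    let: (T', n) := rb_joinLeft Tl k Tr in
    (if is_red T' && is_red (left_of T') then blacken T' else T', n.+1)
  else if ~~ is_red Tl && ~~ is_red Tr then (Node Tl Red k Tr, 1)
  else (Node Tl Black k Tr, 1).

End RedBlack.

Section WeightBalanced.
Variables (R : realFieldType) (alpha : R) (K : Type).
Implicit Types T : tree unit K.

Local Notation node L k R := (Node L tt k R).

(* Subtrees of weights a and b may be siblings; their parent then has weight
   a + b. *)
Definition wb_like (a b : nat) : bool :=
  (alpha <= a%:R / (a + b)%:R <= 1 - alpha)%R.

Definition wb_heavy (a b : nat) : bool := (1 - alpha < a%:R / (a + b)%:R)%R.

Fixpoint wb T : bool :=
  if T is Node L _ _ R then
    [&& wb_like (weight L) (weight R), wb L & wb R]
  else true.

(* The Leaf cases are unreachable on trees satisfying [wb]. *)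
Fixpoint wb_joinRight Tl (k : K) Tr : tree unit K * nat :=
  if wb_like (weight Tl) (weight Tr) then (node Tl k Tr, 1) else
  match Tl with
  | Leaf => (node Tl k Tr, 1)
  | Node l _ k' c =>
    let: (T', n) := wb_joinRight c k Tr in
    if wb_like (weight l) (weight T') then (node l k' T', n.+1) else
    match T' with
    | Leaf => (node l k' T', n.+1)
    | Node l1 _ _ r1 =>
      if wb_like (weight l) (weight l1)
         && wb_like (weight l + weight l1) (weight r1)
      then (rotateLeft (node l k' T'), n.+1)
      else (rotateLeft (node l k' (rotateRight T')), n.+1)
    end
  end.

Fixpoint wb_joinLeft Tl (k : K) Tr : tree unit K * nat :=
  if wb_like (weight Tl) (weight Tr) then (node Tl k Tr, 1) else
  match Tr with
  | Leaf => (node Tl k Tr, 1)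
  | Node c _ k' r =>
    let: (T', n) := wb_joinLeft Tl k c in
    if wb_like (weight T') (weight r) then (node T' k' r, n.+1) else
    match T' with
    | Leaf => (node T' k' r, n.+1)
    | Node l1 _ _ r1 =>
      if wb_like (weight r1) (weight r)
         && wb_like (weight l1) (weight r1 + weight r)
      then (rotateRight (node T' k' r), n.+1)
      else (rotateRight (node (rotateLeft T') k' r), n.+1)
    end
  end.

Definition wb_join : join_algo unit K := fun Tl k Tr =>
  if wb_heavy (weight Tl) (weight Tr) then
    let: (T, n) := wb_joinRight Tl k Tr in (T, n.+1)
  else if wb_heavy (weight Tr) (weight Tl) then
    let: (T, n) := wb_joinLeft Tl k Tr in (T, n.+1)
  else (node Tl k Tr, 1).

End WeightBalanced.

Section Treap.
(* The priority is a function of the key, so a key that occurs in both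
   arguments of a set operation has the same priority in both. *)
Variables (R : realFieldType) (K : Type) (prio : K -> R).
Implicit Types T : tree unit K.

Local Notation node L k R := (Node L tt k R).

Definition prio_above (k : K) T : bool :=
  if T is Node _ _ k' _ then (prio k' <= prio k)%R else true.

Fixpoint heap_ordered T : bool :=
  if T is Node L _ k R then
    [&& prio_above k L, prio_above k R, heap_ordered L & heap_ordered R]
  else true.

Definition treap_join : join_algo unit K := fun Tl0 k Tr0 =>
  (fix joinl Tl : tree unit K -> tree unit K * nat :=
     fix joinr Tr : tree unit K * nat :=
       if prio_above k Tl && prio_above k Tr then (node Tl k Tr, 1) else
       match Tl, Tr with
       | Leaf, Leaf => (node Tl k Tr, 1)
       | Node l1 _ k1 r1, Leaf =>
         let: (T, n) := joinl r1 Tr in (node l1 k1 T, n.+1)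
       | Leaf, Node l2 _ k2 r2 =>
         let: (T, n) := joinr l2 in (node T k2 r2, n.+1)
       | Node l1 _ k1 r1, Node l2 _ k2 r2 =>
         if (prio k2 < prio k1)%R then
           let: (T, n) := joinl r1 Tr in (node l1 k1 T, n.+1)
         else
           let: (T, n) := joinr l2 in (node T k2 r2, n.+1)
       end) Tl0 Tr0.

End Treap.

Inductive set_op := Union | Intersect | Difference.

Section Generic.
Variables (A : Type) (d : Order.disp_t) (K : orderType d).
Variable join : join_algo A K.
Implicit Types T : tree A K.

Fixpoint split_tree T (k : K) : (tree A K * bool * tree A K) * nat :=
  match T with
  | Leaf => ((Leaf, false, Leaf), 1)
  | Node L _ m R =>
    if k == m then ((L, true, R), 1)
    else if (k < m)%O then
      let: ((LL, b, LR), n) := split_tree L k in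
      let: (J, n') := join LR m R in
      ((LL, b, J), (n + n').+1)
    else
      let: ((RL, b, RR), n) := split_tree R k in
      let: (J, n') := join L m RL in
      ((J, b, RR), (n + n').+1)
  end.

(* splitLast of the nonempty tree Node(L, k, R). *)
Fixpoint splitLast (L : tree A K) (k : K) (R : tree A K) :
    (tree A K * K) * nat :=
  match R with
  | Leaf => ((L, k), 1)
  | Node L' _ k' R' =>
    let: ((T', k''), n) := splitLast L' k' R' in
    let: (J, n') := join L k T' in
    ((J, k''), (n + n').+1)
  end.

Definition join2 Tl Tr : tree A K * nat :=
  match Tl with
  | Leaf => (Tr, 1)
  | Node L _ k R =>
    let: ((Tl', k'), n) := splitLast L k R in
    let: (J, n') := join Tl' k' Tr in
    (J, (n + n').+1)
  end.

(* The last step of a call whose pivot has root k, where b tells whether the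
   split found k in the decomposed tree. *)
Definition final_join (o : set_op) (b : bool) Tl (k : K) Tr : tree A K * nat :=
  match o with
  | Union => join Tl k Tr
  | Intersect => if b then join Tl k Tr else join2 Tl Tr
  | Difference => join2 Tl Tr
  end.

(* union, intersect and difference, without their work; T1 is the decomposed
   tree and T2 the pivot tree. *)
Fixpoint setop (o : set_op) T1 T2 {struct T2} : tree A K :=
  match T1, T2 with
  | Leaf, _ => if o is Union then T2 else Leaf
  | _, Leaf => if o is Intersect then Leaf else T1
  | _, Node L2 _ k2 R2 =>
    let: (L1, b, R1) := (split_tree T1 k2).1 in
    (final_join o b (setop o L1 L2) k2 (setop o R1 R2)).1
  end.

(* A node v of the pivot tree T2 is designated by its key x, and
   [call_at T1 T2 x] is the pair (T_d(v), T_p(v)).  It is None if x is not in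
   T2, or if no split and no join happen at v because T_d(v) is a Leaf or the
   recursion stopped at an ancestor of v.  The arguments of the recursive calls
   do not depend on which of the three operations is performed. *)
Fixpoint call_at T1 T2 (x : K) {struct T2} : option (tree A K * tree A K) :=
  match T1, T2 with
  | Leaf, _ | _, Leaf => None
  | _, Node L2 _ k2 R2 =>
    if x == k2 then Some (T1, T2) else
    let: (L1, _, R1) := (split_tree T1 k2).1 in
    if (x < k2)%O then call_at L1 L2 x else call_at R1 R2 x
  end.

Definition call_join_work (o : set_op) (Td Tp : tree A K) : nat :=
  match Tp with
  | Leaf => 0
  | Node L2 _ k2 R2 =>
    let: (L1, b, R1) := (split_tree Td k2).1 in
    (final_join o b (setop o L1 L2) k2 (setop o R1 R2)).2
  end.

(* The work of splitting T is its worst case over the key to split at.  The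
   work at one particular key is not comparable with that of the join: if
   k(v) is the root of T_d(v), the split returns in constant time while the
   join in intersect or difference may take logarithmic time.  It is enough to
   consider the keys of T: splitting at an absent key follows the search path
   of one of its two neighbours, one step further. *)
Definition split_work T : nat := \max_(k <- inorder T) (split_tree T k).2.

Definition join_work_at (o : set_op) T1 T2 (x : K) : nat :=
  if call_at T1 T2 x is Some (Td, Tp) then call_join_work o Td Tp else 0.

Definition split_work_at T1 T2 (x : K) : nat :=
  if call_at T1 T2 x is Some (Td, _) then split_work Td else 0.

End Generic.

Local Open Scope classical_set_scope.
Local Open Scope ring_scope.

Section RandomTreaps.
Variables (R : realType) (dO : measure_display) (Omega : measurableType dO).
Variables (P : probability Omega R) (d : Order.disp_t) (K : orderType d).

Definition mutually_independent (X : K -> {RV P >-> R}) : Prop :=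
  forall (s : seq K) (B : K -> set R), uniq s ->
    (forall x, measurable (B x)) ->
    P (\bigcap_(x in [set` s]) (X x @^-1` B x)) =
    (\prod_(x <- s) P (X x @^-1` B x))%E.

Definition uniform01 (X : {RV P >-> R}) : Prop :=
  forall B : set R, measurable B ->
    distribution P X B = uniform_prob (@ltr01 R) B.

(* T is a treap on the keys s for the priorities prio.  With probability 1
   there are no ties and s and prio determine T; the measurability requirement
   controls how T is chosen when there are ties. *)
Definition random_treap (prio : K -> {RV P >-> R}) (s : seq K)
    (T : Omega -> tree unit K) : Prop :=
  (forall t : tree unit K, measurable (T @^-1` [set t])) /\
  (forall w, inorder (T w) = s /\ heap_ordered (fun x => prio x w) (T w)).

End RandomTreaps.

(* Main.v *)
Require Import Defs.
From HB Require Import structures.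
From mathcomp Require Import all_boot all_order all_algebra.
From mathcomp Require Import all_classical all_reals all_analysis.
From mathcomp Require Import measurable_realfun.
From mathcomp Require Import zify ring lra.

(** Splitting T at its deepest key takes at least [height T] steps, so it suffices
    to bound the final join by a multiple of the height of the decomposed tree Td,
    hence of the logarithm of its size.

    For intersect and difference the two joined trees have at most |Td| keys.  For
    union, the two halves of the pivot have comparable ranks (weights), and the
    union with a part of Td changes the rank of such a half by O(log |Td|) only:
    upwards because rank(union) <= rank + rank, downwards because at each level of
    the pivot the loss is governed by the half that loses less, and the smaller
    half of Td has at most half of its keys.

    For treaps the final join walks along two spines, and the keys it meets are
    records of the priority sequence of a set of keys M.  Given which pivot keys
    have a higher priority than x, the set M is determined and the priorities of
    its keys remain exchangeable, so the expected number of records is at most a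
    harmonic number H(|M|) = O(log |Td|). *)

Set Implicit Arguments.
Unset Strict Implicit.
Unset Printing Implicit Defensive.

Import Order.TTheory GRing.Theory Num.Theory.
Local Open Scope nat_scope.

(** * Search trees and the generic algorithms *)

(** Once only the height of Td counts, the pivot is the obstacle: in a union it may be arbitrarily
    larger than Td, so the joined trees may be large and only the difference of their ranks, or the
    ratio of their weights, can be controlled. Weight-balanced trees do not fit the argument by
    ranks, since a child may have the rank of its parent; there the ratio of weights takes its
    place. For treaps |Td| is itself random. Both expectations are therefore cut along the finitely
    many patterns telling which pivot keys beat x: within one pattern |Td| is constant, the split
    costs at least about log |Td| outside a null set, and the join costs O(log |Td|) on average.
    Exchangeability enters through transpositions of two priorities, which must preserve the
    pattern; this is why M never mixes pivot keys with other keys. For union this is possible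
    because the join is charged only for keys of higher priority than x, and no pivot key that
    reaches the call has one. *)

Section TreeFacts.
Variables (A : Type) (d : Order.disp_t) (K : orderType d).
Implicit Types T : tree A K.

Lemma size_inorder T : size (inorder T) = size_tree T.
Proof. by elim: T => //= L IHL a k R IHR; rewrite size_cat /= IHL IHR addnS. Qed.

Lemma weight_le_exp_height T : weight T <= 2 ^ height T.
Proof.
elim: T => //= L IHL a k R IHR; rewrite /weight /= in IHL IHR *.
have hl : 2 ^ height L <= 2 ^ maxn (height L) (height R).
  by rewrite leq_pexp2l // leq_maxl.
have hr : 2 ^ height R <= 2 ^ maxn (height L) (height R).
  by rewrite leq_pexp2l // leq_maxr.
rewrite expnS; lia.
Qed.

Lemma inorder_rotateLeft T : inorder (rotateLeft T) = inorder T.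
Proof. by case: T => // a ax x [] //= b ay y c; rewrite -catA. Qed.

Lemma inorder_rotateRight T : inorder (rotateRight T) = inorder T.
Proof. by case: T => // [[]] //= a ax x b ay y c; rewrite -catA. Qed.

Lemma bst_cat (s1 s2 : seq K) :
  sorted (fun x y : K => (x < y)%O) (s1 ++ s2) =
  [&& all (fun x => all (fun y => (x < y)%O) s2) s1,
      sorted (fun x y : K => (x < y)%O) s1 &
      sorted (fun x y : K => (x < y)%O) s2].
Proof.
rewrite !(sorted_pairwise lt_trans) pairwise_cat; congr (_ && _).
Qed.

Lemma bst_node L a (k : K) R : bst (Node L a k R : tree A K) =
  [&& all (fun y => (y < k)%O) (inorder L), all (fun y => (k < y)%O) (inorder R),
      bst L & bst R].
Proof.
rewrite /bst /= bst_cat /= (path_sortedE lt_trans).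
apply/and3P/and4P => [[h1 h2 /andP[h3 h4]]|[h1 h2 h3 h4]]; split=> //.
- by apply/allP => y yL; move/allP/(_ _ yL)/andP: h1 => [].
- apply/allP => y yL; apply/andP; split; first exact: (allP h1).
  by apply/allP => z zR; apply: (lt_trans ((allP h1) _ yL) ((allP h2) _ zR)).
- by rewrite h2.
Qed.

Variable join : join_algo A K.

Lemma setop_node o L1 a1 k1 R1 L2 a2 k2 R2 :
  setop join o (Node L1 a1 k1 R1) (Node L2 a2 k2 R2) =
  let: (L, b, R) := (split_tree join (Node L1 a1 k1 R1) k2).1 in
  (final_join join o b (setop join o L L2) k2 (setop join o R R2)).1.
Proof. by []. Qed.

Lemma call_at_node L1 a1 k1 R1 L2 a2 k2 R2 x :
  call_at join (Node L1 a1 k1 R1) (Node L2 a2 k2 R2) x =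
  if x == k2 then Some (Node L1 a1 k1 R1, Node L2 a2 k2 R2) else
  let: (L, _, R) := (split_tree join (Node L1 a1 k1 R1) k2).1 in
  if (x < k2)%O then call_at join L L2 x else call_at join R R2 x.
Proof. by []. Qed.

(** Follow a longest path to its last node: splitting at that key makes one invocation per node of
    the path, whatever the joins on the way back cost. *)
Lemma height_le_split_work T : bst T -> height T <= split_work join T.
Proof.
(* A leaf holds no key to split at, hence the separate alternative, in which the height is 0. *)
move=> bT; suff [->//|[k kT hk]] : T = Leaf \/
    exists2 k, k \in inorder T & height T <= (split_tree join T k).2.
  apply: leq_trans hk _; rewrite /split_work.
  by rewrite (big_rem k) //= leq_maxl.
elim: T bT => [|L IHL a m R IHR]; first by left.
rewrite bst_node => /and4P[aL aR bL bR]; right.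
have rootP : exists2 k, k \in inorder (Node L a m R) &
    1 <= (split_tree join (Node L a m R) k).2.
  exists m; first by rewrite /= mem_cat mem_head orbT.
  by rewrite /= eqxx.
case: (leqP (height R) (height L)) => h.
- case: (IHL bL) => [eL|[k kL hk]].
    move: h rootP; rewrite eL /= leqn0 => /eqP ->.
    by rewrite maxnn.
  have km : (k < m)%O by exact: (allP aL).
  exists k; first by rewrite /= mem_cat kL.
  rewrite /= lt_eqF // km; case: split_tree hk => [[[LL b] LR] n] /= hk.
  by case: join => J n' /=; lia.
- case: (IHR bR) => [eR|[k kR hk]]; first by move: h; rewrite eR.
  have mk : (m < k)%O by exact: (allP aR).
  exists k; first by rewrite /= mem_cat inE kR !orbT.
  rewrite /= gt_eqF // ltNge (ltW mk) /=.
  case: split_tree hk => [[[LL b] LR] n] /= hk.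
  by case: join => J n' /=; lia.
Qed.

Hypothesis inorder_join : forall Tl k Tr,
  inorder (join Tl k Tr).1 = inorder Tl ++ k :: inorder Tr.

Lemma size_join Tl k Tr :
  size_tree (join Tl k Tr).1 = (size_tree Tl + size_tree Tr).+1.
Proof. by rewrite -size_inorder inorder_join size_cat /= !size_inorder addnS. Qed.

(** [nseq b k] puts back the removed key exactly when the flag is true; the sizes of both halves and
    their order are read off this one equation. *)
Lemma inorder_split T k : let: (L, b, R) := (split_tree join T k).1 in
  inorder T = inorder L ++ nseq b k ++ inorder R.
Proof.
elim: T => //= L IHL a m R IHR; case: eqP => [->//|_]; case: ifP => _.
- case: split_tree IHL => [[[LL b] LR] n] /= ->.
  by case: join (inorder_join LR m R) => J n' /= ->; rewrite -!catA.
- case: split_tree IHR => [[[LL b] LR] n] /= ->.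
  by case: join (inorder_join L m LL) => J n' /= ->; rewrite -!catA.
Qed.

Lemma size_split T k : let: (L, b, R) := (split_tree join T k).1 in
  size_tree T = size_tree L + b + size_tree R.
Proof.
have := inorder_split T k; case: (split_tree join T k).1 => [[L b] R] e.
by rewrite -size_inorder e !size_cat size_nseq !size_inorder addnA.
Qed.

Lemma bst_split T k : bst T -> let: (L, b, R) := (split_tree join T k).1 in
  bst L /\ bst R.
Proof.
have := inorder_split T k; case: (split_tree join T k).1 => [[L b] R] e.
by rewrite /bst e bst_cat => /and3P[_ -> ]; rewrite bst_cat => /and3P[].
Qed.

Lemma inorder_splitLast L k R :
  let: (T', k') := (splitLast join L k R).1 in
  inorder L ++ k :: inorder R = rcons (inorder T') k'.
Proof.
elim: R L k => [|L' _ a k' R' IH] L k /=; first by rewrite cats1.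
have := IH L' k'; case: splitLast => [[T' k''] n] /= ->.
case: join (inorder_join L k T') => J n' /= ->.
by rewrite -rcons_cons -rcons_cat.
Qed.

Lemma inorder_join2 Tl Tr : inorder (join2 join Tl Tr).1 = inorder Tl ++ inorder Tr.
Proof.
case: Tl => //= L a k R; have := inorder_splitLast L k R.
case: splitLast => [[T' k'] n] /= ->.
by case: join (inorder_join T' k' Tr) => J n' /= ->; rewrite cat_rcons.
Qed.

Lemma inorder_final_join o b Tl k Tr :
  inorder (final_join join o b Tl k Tr).1 =
  inorder Tl ++ nseq (if o is Union then true else if o is Intersect then b
                      else false) k ++ inorder Tr.
Proof. by case: o; case: b; rewrite /= ?inorder_join ?inorder_join2. Qed.

Lemma size_final_join o b Tl k Tr :
  size_tree (final_join join o b Tl k Tr).1 =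
  size_tree Tl + (if o is Union then true else if o is Intersect then b
                      else false) + size_tree Tr.
Proof.
by rewrite -!size_inorder inorder_final_join !size_cat size_nseq addnA.
Qed.

Lemma size_setop_le o T1 T2 : o <> Union ->
  size_tree (setop join o T1 T2) <= size_tree T1.
Proof.
move=> oU; elim: T2 T1 => [|L2 IHL a k2 R2 IHR] [|L1 a1 k1 R1].
- by case: o oU.
- by case: o oU.
- by clear IHL IHR; case: o oU.
rewrite setop_node; set T1 := Node L1 _ _ _.
have := size_split T1 k2; case: (split_tree join T1 k2).1 => [[L b] R] ->.
rewrite size_final_join; have := IHL L; have := IHR R.
by clear IHL IHR; case: o oU => // _; case: b => /=; lia.
Qed.

Lemma size_union T1 T2 :
  size_tree T2 <= size_tree (setop join Union T1 T2) <= size_tree T1 + size_tree T2.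
Proof.
elim: T2 T1 => [|L2 IHL a k2 R2 IHR] [|L1 a1 k1 R1]; try by rewrite /= ?addn0 leqnn.
rewrite setop_node; set T1 := Node L1 _ _ _.
have := size_split T1 k2; case: (split_tree join T1 k2).1 => [[L b] R] ->.
rewrite size_final_join /=; have := IHL L; have := IHR R; lia.
Qed.

Lemma call_at_inv (bal : tree A K -> bool) T1 T2 x Td Tp :
  (forall T k, bal T -> let: (L, _, R) := (split_tree join T k).1 in bal L /\ bal R) ->
  (forall L a k R, bal (Node L a k R) -> bal L /\ bal R) ->
  bst T1 -> bal T1 -> bal T2 -> call_at join T1 T2 x = Some (Td, Tp) ->
  [/\ bst Td, bal Td, bal Tp & 0 < height Td].
Proof.
move=> hs hc; elim: T2 T1 => [|L2 IHL a k2 R2 IHR] [|L1 a1 k1 R1] //.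
set T1 := Node L1 _ _ _ => bT1 balT1 balT2; rewrite call_at_node -/T1.
have [balL2 balR2] := hc _ _ _ _ balT2; case: eqP => [_ [<- <-]//|_].
have := hs T1 k2 balT1; have := bst_split k2 bT1.
case: (split_tree join T1 k2).1 => [[L b] R] [bL bR] [bal_L balR].
by case: ifP => _; [exact: IHL | exact: IHR].
Qed.

(** The reduction shared by AVL, red-black and weight-balanced trees: a scheme has only to bound one
    final join by the height of Td. As [call_at] never returns an empty Td, additive constants can
    be absorbed into [C]. *)
Lemma join_le_split_work (bal : tree A K -> bool) C :
  (forall T k, bal T -> let: (L, _, R) := (split_tree join T k).1 in bal L /\ bal R) ->
  (forall L a k R, bal (Node L a k R) -> bal L /\ bal R) ->
  (forall o Td L2 a k2 R2, bal Td -> bal (Node L2 a k2 R2) -> 0 < height Td ->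
     call_join_work join o Td (Node L2 a k2 R2) <= C * height Td) ->
  forall T1 T2 o x, bst T1 -> bal T1 -> bal T2 ->
    join_work_at join o T1 T2 x <= C * split_work_at join T1 T2 x.
Proof.
move=> hs hc hw T1 T2 o x bT1 balT1 balT2; rewrite /join_work_at /split_work_at.
case e : call_at => [[Td Tp]|//].
have [bTd balTd balTp hTd] := call_at_inv hs hc bT1 balT1 balT2 e.
case: Tp {e} balTp => [|L2 a k2 R2] balTp; first by [].
apply: (leq_trans (hw _ _ _ _ _ _ balTd balTp hTd)).
by rewrite leq_mul2l height_le_split_work ?orbT.
Qed.

End TreeFacts.

(** * Invariants kept by join are kept by every algorithm *)

Section Balanced.
Variables (A : Type) (d : Order.disp_t) (K : orderType d) (join : join_algo A K).
Variable bal : tree A K -> bool.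
Hypothesis bal_node : forall L a k R, bal (Node L a k R) -> bal L /\ bal R.
Hypothesis bal_join : forall L k R, bal L -> bal R -> bal (join L k R).1.

Lemma bal_split T k : bal T -> let: (L, _, R) := (split_tree join T k).1 in
  bal L /\ bal R.
Proof.
elim: T => [|L IHL a m R IHR] // /bal_node[bL bR] /=.
case: eqP => // _; case: ifP => _.
- move: (IHL bL); case: split_tree => [[[LL b] LR] n] /= [b1 b2].
  by have := bal_join m b2 bR; case: join.
- move: (IHR bR); case: split_tree => [[[LL b] LR] n] /= [b1 b2].
  by have := bal_join m bL b1; case: join.
Qed.

Lemma bal_splitLast L k R : bal L -> bal R -> bal (splitLast join L k R).1.1.
Proof.
elim: R L k => [|L' _ a' k' R' IH] L k //= bL /bal_node[bL' bR'].
have := IH L' k' bL' bR'; case: splitLast => [[T' k''] n] /= bT'.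
by have := bal_join k bL bT'; case: join.
Qed.

Lemma bal_join2 Tl Tr : bal Tl -> bal Tr -> bal (join2 join Tl Tr).1.
Proof.
case: Tl => [|L a k R] //= /bal_node[bL bR] bTr.
have := bal_splitLast k bL bR; case: splitLast => [[T' k'] n] /= bT'.
by have := bal_join k' bT' bTr; case: join.
Qed.

Lemma bal_setop o T1 T2 : bal T1 -> bal T2 -> bal (setop join o T1 T2).
Proof.
elim: T2 T1 => [|L2 IHL a k2 R2 IHR] [|L1 a1 k1 R1] b1 b2.
- by case: o.
- by case: o.
- by clear IHL IHR; case: o => //=.
have [bL2 bR2] := bal_node b2.
rewrite setop_node; have := bal_split k2 b1.
case: (split_tree _ _ _).1 => [[L b] R] [bL bR].
have {}IHL := IHL _ bL bL2; have {}IHR := IHR _ bR bR2.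
case: o IHL IHR => /= IHL IHR; first exact: bal_join.
- by case: b; [exact: bal_join | exact: bal_join2].
- exact: bal_join2.
Qed.

End Balanced.

(** * Balancing schemes with ranks *)

(** The bit length of [n]. Unlike [trunc_log 2], it also drops when 1 is halved to 0, so that
    halving a positive number always lowers it, down to the empty tree. *)
Definition dlog n := if n is 0 then 0 else (trunc_log 2 n).+1.

Lemma dlog_leq m n : m <= n -> dlog m <= dlog n.
Proof. by case: m n => [|m] [|n] //= mn; rewrite ltnS leq_trunc_log. Qed.

Lemma dlog_half m n : 0 < n -> m + m <= n -> (dlog m).+1 <= dlog n.
Proof.
case: m => [|m]; first by case: n.
move=> n0 mn; apply: leq_trans (dlog_leq mn).
have e : dlog m.+1.*2 = (trunc_log 2 m.+1.*2).+1 by [].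
by rewrite addnn e trunc_log2_double.
Qed.

Lemma dlog_expn n h : n < 2 ^ h -> dlog n <= h.
Proof.
by case: n => [|n] //= nh; rewrite ltnNge -[_ <= _](@leq_exp2l 2) // -ltnNge
  (leq_ltn_trans _ nh) // trunc_logP.
Qed.

Section Ranked.
Variables (A : Type) (d : Order.disp_t) (K : orderType d) (join : join_algo A K).
Implicit Types T : tree A K.
Hypothesis inorder_join : forall Tl k Tr,
  inorder (join Tl k Tr).1 = inorder Tl ++ k :: inorder Tr.
Variables (bal : tree A K -> bool) (rank : tree A K -> nat) (c : nat).
Hypothesis bal_node : forall L a k R, bal (Node L a k R) -> bal L /\ bal R.
Hypothesis bal_join : forall L k R, bal L -> bal R -> bal (join L k R).1.
Hypothesis rank_leaf : rank Leaf = 0.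
(** A gap of two does occur: for the lower child of an AVL node, and for a black child of a black
    node, since [rb_rank] counts two per black node. *)
Hypothesis rank_left : forall L a k R, bal (Node L a k R) ->
  rank L < rank (Node L a k R) <= (rank L).+2.
Hypothesis rank_right : forall L a k R, bal (Node L a k R) ->
  rank R < rank (Node L a k R) <= (rank R).+2.
Hypothesis rank_join : forall L k R, bal L -> bal R ->
  maxn (rank L) (rank R) <= rank (join L k R).1 <= (maxn (rank L) (rank R)).+1.
Hypothesis work_join : forall L k R, bal L -> bal R ->
  (join L k R).2 <= c * (1 + (rank L - rank R) + (rank R - rank L)).
Hypothesis rank_weight : forall T, bal T -> 2 ^ (rank T)./2 <= weight T.

Let setop_bal := bal_setop bal_node bal_join.

(** A join adds at most one to the larger rank, and both trees joined at a node have rank below that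
    of the node: the strict descent pays for the join. *)
Lemma ranked_split T k : bal T -> let: (L, _, R) := (split_tree join T k).1 in
  [/\ bal L, bal R, rank L <= rank T & rank R <= rank T].
Proof.
elim: T => [|L IHL a m R IHR] balT; first by rewrite /= !rank_leaf.
have [bL bR] := bal_node balT.
have rL := rank_left balT; have rR := rank_right balT.
rewrite /=; case: eqP => [_|_]; first by split=> //; lia.
case: ifP => _.
- move: (IHL bL); case: split_tree => [[[LL b] LR] n] /= [b1 b2 r1 r2].
  have := rank_join m b2 bR; have := bal_join m b2 bR.
  by case: join => J n' /= bJ rJ; split=> //; lia.
- move: (IHR bR); case: split_tree => [[[LL b] LR] n] /= [b1 b2 r1 r2].
  have := rank_join m bL b1; have := bal_join m bL b1.
  by case: join => J n' /= bJ rJ; split=> //; lia.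
Qed.

Lemma ranked_splitLast L a k R : bal (Node L a k R) ->
  let: ((T', k'), n) := splitLast join L k R in
  [/\ bal T', rank T' <= rank (Node L a k R) <= (rank T').+2 &
      n <= (4 * c + 1) * rank (Node L a k R)].
Proof.
elim: R L a k => [|L' _ a' k' R' IH] L a k balT.
  have rL := rank_left balT; have [bL _] := bal_node balT.
  by rewrite /=; split=> //; nia.
have rL := rank_left balT; have rR := rank_right balT.
have [bL bR] := bal_node balT.
rewrite /=; have := IH _ _ _ bR; case: splitLast => [[T' k''] n] /= [bT' rT' hn].
have := work_join k bL bT'; have := rank_join k bL bT'; have := bal_join k bL bT'.
case: join => J n' /= bJ rJ wJ; split=> //; first by lia.
(* [L] and the right child have rank one or two below the root, and [T'] at most two below the right
   child, so the ranks of [L] and [T'] differ by at most three. A level thus costs at most 4c + 1,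
   and it lowers the rank by at least one. *)
have : n' <= c * 4 by apply: leq_trans wJ _; rewrite leq_mul2l; lia.
nia.
Qed.

Lemma ranked_join2 Tl Tr : bal Tl -> bal Tr ->
  (join2 join Tl Tr).2 <= (5 * c + 1) * (1 + rank Tl + rank Tr).
Proof.
case: Tl => [|L a k R] bTl bTr /=; first by nia.
have := ranked_splitLast bTl; case: splitLast => [[T' k'] n] /= [bT' rT' hn].
have := work_join k' bT' bTr; case: join => J n' /= wJ.
have : n' <= c * (1 + rank (Node L a k R) + rank Tr).
  by apply: leq_trans wJ _; rewrite leq_mul2l; lia.
nia.
Qed.

(** One level of the pivot lowers its rank by at least one, which pays for the one added by join;
    splitting does not raise the rank on the side of [T1]. *)
Lemma rank_union_le T1 T2 : bal T1 -> bal T2 ->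
  rank (setop join Union T1 T2) <= rank T1 + rank T2.
Proof.
elim: T2 T1 => [|L2 IHL a k2 R2 IHR] [|L1 a1 k1 R1] b1 b2;
  try by rewrite /= ?rank_leaf ?addn0.
have [bL2 bR2] := bal_node b2.
rewrite setop_node; have := ranked_split k2 b1.
case: (split_tree _ _ _).1 => [[L b] R] [bL bR rL rR] /=.
have {}IHL := IHL _ bL bL2; have {}IHR := IHR _ bR bR2.
have := rank_join k2 (setop_bal Union bL bL2) (setop_bal Union bR bR2).
have := rank_left b2; have := rank_right b2; lia.
Qed.

(* The rank may drop by two at each level of the pivot, but the drop at a level
   is governed by whichever half of the decomposed tree loses less rank, and
   the smaller half has at most half of its keys. *)
Lemma rank_union_ge T1 T2 : bal T1 -> bal T2 ->
  rank T2 <= rank (setop join Union T1 T2) + 2 * dlog (size_tree T1).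
Proof.
elim: T2 T1 => [|L2 IHL a k2 R2 IHR] [|L1 a1 k1 R1] b1 b2;
  try by rewrite /= ?rank_leaf ?addn0 ?leqnn.
have [bL2 bR2] := bal_node b2.
rewrite setop_node; have := ranked_split k2 b1.
have := size_split inorder_join (Node L1 a1 k1 R1) k2.
case: (split_tree _ _ _).1 => [[L b] R] sz [bL bR rL rR].
have {}IHL := IHL _ bL bL2; have {}IHR := IHR _ bR bR2.
have hj := rank_join k2 (setop_bal Union bL bL2) (setop_bal Union bR bR2).
have hl := rank_left b2; have hr := rank_right b2.
have sz0 : 0 < size_tree (Node L1 a1 k1 R1) by [].
rewrite [(final_join _ _ _ _ _ _).1]/=.
case: (leqP (size_tree L) (size_tree R)) => hLR.
- have := @dlog_half (size_tree L) _ sz0; lia.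
- have := @dlog_half (size_tree R) _ sz0; lia.
Qed.

Lemma rank_le_log T h : bal T -> weight T <= 2 ^ h -> rank T <= (2 * h).+1.
Proof.
move=> bT wT; have := leq_trans (rank_weight bT) wT.
by rewrite leq_exp2l //; lia.
Qed.

Lemma ranked_call_join_work o Td L2 a k2 R2 :
  bal Td -> bal (Node L2 a k2 R2) -> 0 < height Td ->
  call_join_work join o Td (Node L2 a k2 R2) <= (50 * c + 7) * height Td.
Proof.
move=> bTd b2 hTd; have [bL2 bR2] := bal_node b2; rewrite /call_join_work.
have := ranked_split k2 bTd; have := size_split inorder_join Td k2.
case: (split_tree _ _ _).1 => [[L b] R] sz [bL bR rL rR].
have wTd := weight_le_exp_height Td.
have rTd := rank_le_log bTd wTd.
have bl := setop_bal o bL bL2; have br := setop_bal o bR bR2.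
have wL : weight L <= 2 ^ height Td by move: wTd; rewrite /weight; lia.
have wR : weight R <= 2 ^ height Td by move: wTd; rewrite /weight; lia.
have [eU|oU] : o = Union \/ o <> Union by case: (o); [left|right|right].
  rewrite eU in bl br *; rewrite /=.
  have := work_join k2 bl br.
  have dL := dlog_expn wL; have dR := dlog_expn wR.
  have := rank_union_le bL bL2; have := rank_union_le bR bR2.
  have := rank_union_ge bL bL2; have := rank_union_ge bR bR2.
  have := rank_left b2; have := rank_right b2.
  move: (setop _ _ _ _) bl br => U bl br.
  move: (setop _ _ _ _) br => V br h1 h2 h3 h4 h5 h6 hw.
  (* With h = [height Td], one union gains at most 2h + 1 over its pivot child, the other loses at
     most 2h, and the two pivot children differ by at most one; 20h leaves ample room. *)
  apply: leq_trans hw _; apply: (@leq_trans (c * (20 * height Td))).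
    by rewrite leq_mul2l; lia.
  nia.
have sl := size_setop_le inorder_join L L2 oU.
have sr := size_setop_le inorder_join R R2 oU.
have rl : rank (setop join o L L2) <= (2 * height Td).+1.
  by apply: rank_le_log => //; apply: leq_trans wL.
have rr : rank (setop join o R R2) <= (2 * height Td).+1.
  by apply: rank_le_log => //; apply: leq_trans wR.
have hj2 := ranked_join2 bl br.
have hj := work_join k2 bl br.
have {}hj : (join (setop join o L L2) k2 (setop join o R R2)).2
    <= (50 * c + 7) * height Td.
  apply: leq_trans hj _; apply: (@leq_trans (c * (7 * height Td))); last by nia.
  by rewrite leq_mul2l; lia.
have {}hj2 : (join2 join (setop join o L L2) (setop join o R R2)).2
    <= (50 * c + 7) * height Td.
  apply: leq_trans hj2 _.
  (* Both ranks are at most 2h + 1, and 1 + 2(2h + 1) = 4h + 3 is at most 7h because h is positive.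
     The product 7(5c + 1) = 35c + 7 is the source of the 7 in the final constant. *)
  apply: (@leq_trans ((5 * c + 1) * (7 * height Td))); last by nia.
  by rewrite leq_mul2l; lia.
by clear sl sr rl rr bl br; case: o oU hj hj2 => //= _; case: b sz.
Qed.

Lemma ranked_join_le_split_work T1 T2 o x : bst T1 -> bal T1 -> bal T2 ->
  join_work_at join o T1 T2 x <= (50 * c + 7) * split_work_at join T1 T2 x.
Proof.
apply: join_le_split_work => //.
- move=> T k bT; have := ranked_split k bT.
  by case: (split_tree _ _ _).1 => [[L b] R] [].
- exact: ranked_call_join_work.
Qed.

End Ranked.

(** * AVL and red-black trees *)

Section InorderJoin.
Variables (d : Order.disp_t) (K : orderType d).
Arguments rotateLeft {A K} T : simpl never.
Arguments rotateRight {A K} T : simpl never.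

Lemma inorder_avl_join Tl (k : K) Tr :
  inorder (avl_join Tl k Tr).1 = inorder Tl ++ k :: inorder Tr.
Proof.
have hR T : inorder (avl_joinRight T k Tr).1 = inorder T ++ k :: inorder Tr.
  elim: T => //= l _ u k' c; case: avl_joinRight => T' n /= IH.
  do 2 case: ifP => _; rewrite ?inorder_rotateLeft /= ?inorder_rotateRight ?IH //=;
    by rewrite -?catA.
have hL T : inorder (avl_joinLeft Tl k T).1 = inorder Tl ++ k :: inorder T.
  elim: T => //= c + u k' r _; case: avl_joinLeft => T' n /= IH.
  do 2 case: ifP => _; rewrite ?inorder_rotateRight /= ?inorder_rotateLeft ?IH //=;
    by rewrite -?catA.
rewrite /avl_join; case: ifP => _; first by case: avl_joinRight (hR Tl).
by case: ifP => // _; case: avl_joinLeft (hL Tr).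
Qed.

Lemma inorder_blacken (T : tree color K) : inorder (blacken T) = inorder T.
Proof. by case: T. Qed.

Lemma inorder_rb_join Tl (k : K) Tr :
  inorder (rb_join Tl k Tr).1 = inorder Tl ++ k :: inorder Tr.
Proof.
have hR T : inorder (rb_joinRight T k Tr).1 = inorder T ++ k :: inorder Tr.
  elim: T => /= [|L _ c k' R IH]; first by case: ifP.
  case: ifP => // _; case: rb_joinRight IH => T' n /= IH; case: c; last case: ifP => _.
  - by rewrite /= IH -catA.
  - rewrite -catA cat_cons -IH; case: T' {IH} => [|L1 c1 k1 R1] //=.
    by rewrite inorder_blacken -catA.
  - by rewrite /= IH -catA.
have hL T : inorder (rb_joinLeft Tl k T).1 = inorder Tl ++ k :: inorder T.
  elim: T => /= [|L IH c k' R _]; first by case: ifP.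
  case: ifP => // _; case: rb_joinLeft IH => T' n /= IH; case: c; last case: ifP => _.
  - by rewrite /= IH -catA.
  - rewrite -cat_cons catA -IH; case: T' {IH} => [|L1 c1 k1 R1] //=.
    by rewrite inorder_blacken -catA.
  - by rewrite /= IH -catA.
rewrite /rb_join; case: ifP => _.
  by case: rb_joinRight (hR Tl) => T n /= <-; case: ifP; rewrite ?inorder_blacken.
case: ifP => _; last by case: ifP.
by case: rb_joinLeft (hL Tr) => T n /= <-; case: ifP; rewrite ?inorder_blacken.
Qed.

End InorderJoin.

Section AVLFacts.
Variables (d : Order.disp_t) (K : orderType d).
Implicit Types T : tree unit K.

(** If the height grows, the surplus sits in the right child and the left child is one lower:
    exactly the shape that a single left rotation at the parent repairs, without raising the height
    there. A tree of arbitrary shape would not be repaired by it, so the shape belongs to the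
    induction. *)
Lemma avl_joinRight_spec Tl (k : K) Tr : avl Tl -> avl Tr ->
  (height Tr).+1 < height Tl ->
  let: (T, n) := avl_joinRight Tl k Tr in
  [/\ avl T, n <= height Tl - height Tr &
      height T = height Tl \/ exists a u x b, [/\ T = Node a u x b,
        height a = (height Tl).-1 & height b = height Tl]].
Proof.
elim: Tl => //= l _ u k' c IH /and4P[h1 h2 al ac] aTr hTr.
case: ifP => hc.
  case: ifP => hl.
    split; [by rewrite /= al ac aTr; lia | by lia|].
    have [e|e] : height c < height l \/ height l <= height c by lia.
      by left => /=; lia.
    by right; exists l, tt, k', (Node c tt k Tr); split=> //=; lia.
  (* The double rotation is reached only when [c] is one higher than both [l] and [Tr]; in
     particular [c] is a node, whose two subtrees are shared between the new children. *)
  case: c h1 h2 ac hTr hc hl {IH} => [|c1 u1 x1 c2] /=; first by lia.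
  move=> h1 h2 /and4P[h3 h4 ac1 ac2] hTr hc hl.
  by split; [rewrite /= al ac1 ac2 aTr; lia|lia|left => /=; lia].
have {}hc : (height Tr).+1 < height c by lia.
have := IH ac aTr hc; case: avl_joinRight => T n [aT hn hT].
case: ifP => hl; last first.
  case: hT => [hT|[a [v [x [b [eT ha hb]]]]]]; first by lia.
  move: aT hl; rewrite eT /= => /and4P[_ _ -> ->] hl.
  by split; [rewrite /= ?al; lia|lia|left => /=; lia].
case: hT => [hT|[a [v [x [b [eT ha hb]]]]]].
  by split; [rewrite /= al aT; lia| lia|left => /=; lia].
split; [by rewrite /= al aT; move: hl; rewrite eT /=; lia|by lia|].
have hTc : height T = (height c).+1 by rewrite eT /=; lia.
have [e|e] : height c < height l \/ height l <= height c by lia.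
  by left => /=; lia.
by right; exists l, tt, k', T; split=> //=; lia.
Qed.

Lemma avl_joinLeft_spec Tl (k : K) Tr : avl Tl -> avl Tr ->
  (height Tl).+1 < height Tr ->
  let: (T, n) := avl_joinLeft Tl k Tr in
  [/\ avl T, n <= height Tr - height Tl &
      height T = height Tr \/ exists a u x b, [/\ T = Node a u x b,
        height b = (height Tr).-1 & height a = height Tr]].
Proof.
move=> aTl; elim: Tr => //= c IH u k' r _ /and4P[h1 h2 ac ar] hTl.
case: ifP => hc.
  case: ifP => hl.
    split; [by rewrite /= ar ac aTl; lia | by lia|].
    have [e|e] : height c < height r \/ height r <= height c by lia.
      by left => /=; lia.
    by right; exists (Node Tl tt k c), tt, k', r; split=> //=; lia.
  case: c h1 h2 ac hTl hc hl {IH} => [|c1 u1 x1 c2] /=; first by lia.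
  move=> h1 h2 /and4P[h3 h4 ac1 ac2] hTr hc hl.
  by split; [rewrite /= ar ac1 ac2 aTl; lia|lia|left => /=; lia].
have {}hc : (height Tl).+1 < height c by lia.
have := IH ac hc; case: avl_joinLeft => T n [aT hn hT].
case: ifP => hl; last first.
  case: hT => [hT|[a [v [x [b [eT ha hb]]]]]]; first by lia.
  move: aT hl; rewrite eT /= => /and4P[_ _ -> ->] hl.
  by split; [rewrite /= ?ar; lia|lia|left => /=; lia].
case: hT => [hT|[a [v [x [b [eT ha hb]]]]]].
  by split; [rewrite /= ar aT; lia| lia|left => /=; lia].
split; [by rewrite /= ar aT; move: hl; rewrite eT /=; lia|by lia|].
have hTc : height T = (height c).+1 by rewrite eT /=; lia.
have [e|e] : height c < height r \/ height r <= height c by lia.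
  by left => /=; lia.
by right; exists T, tt, k', r; split=> //=; lia.
Qed.

Lemma avl_join_spec Tl (k : K) Tr : avl Tl -> avl Tr ->
  [/\ avl (avl_join Tl k Tr).1,
      maxn (height Tl) (height Tr) <= height (avl_join Tl k Tr).1
        <= (maxn (height Tl) (height Tr)).+1 &
      (avl_join Tl k Tr).2
        <= 1 * (1 + (height Tl - height Tr) + (height Tr - height Tl))].
Proof.
move=> al ar; rewrite /avl_join; case: ifP => h1.
  have := avl_joinRight_spec k al ar h1; case: avl_joinRight => T n /= [aT hn].
  have hhT : height T = height Tl \/ height T = (height Tl).+1 ->
    [/\ avl T, maxn (height Tl) (height Tr) <= height T
      <= (maxn (height Tl) (height Tr)).+1
      & n.+1 <= 1 * (1 + (height Tl - height Tr) + (height Tr - height Tl))].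
    by move=> hT; split=> //; lia.
  case=> [hT|[a [u [x [b [eT ha hb]]]]]]; apply: hhT; first by left.
  by right; rewrite eT /=; lia.
case: ifP => h2.
  have := avl_joinLeft_spec k al ar h2; case: avl_joinLeft => T n /= [aT hn].
  have hhT : height T = height Tr \/ height T = (height Tr).+1 ->
    [/\ avl T, maxn (height Tl) (height Tr) <= height T
      <= (maxn (height Tl) (height Tr)).+1
      & n.+1 <= 1 * (1 + (height Tl - height Tr) + (height Tr - height Tl))].
    by move=> hT; split=> //; lia.
  case=> [hT|[a [u [x [b [eT ha hb]]]]]]; apply: hhT; first by left.
  by right; rewrite eT /=; lia.
by split=> /=; [rewrite al ar; lia|lia|lia].
Qed.

(** Both children are at most two lower than the root, so the weight at least doubles each time the
    height grows by two. *)
Lemma avl_weight T : avl T -> 2 ^ (height T)./2 <= weight T.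
Proof.
elim: T => // L IHL u k R IHR /and4P[h1 h2 aL aR].
move: (IHL aL) (IHR aR); rewrite /weight => hL hR.
have e : height (Node L u k R) = (maxn (height L) (height R)).+1 by [].
case E : (height (Node L u k R))./2 => [|m] //.
have eL : 2 ^ m <= 2 ^ (height L)./2 by rewrite leq_exp2l //; lia.
have eR : 2 ^ m <= 2 ^ (height R)./2 by rewrite leq_exp2l //; lia.
rewrite expnS /=; lia.
Qed.

Lemma avl_join_le_split_work T1 T2 o (x : K) : bst T1 -> avl T1 -> avl T2 ->
  join_work_at (@avl_join K) o T1 T2 x
    <= (50 * 1 + 7) * split_work_at (@avl_join K) T1 T2 x.
Proof.
apply: (@ranked_join_le_split_work _ _ _ _ _ (@avl K) (@height unit K)) => //.
- exact: inorder_avl_join.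
- by move=> L a k R /= /and4P[].
- by move=> L k R aL aR; have [] := avl_join_spec k aL aR.
- by move=> L a k R /= /and4P[]; lia.
- by move=> L a k R /= /and4P[]; lia.
- by move=> L k R aL aR; have [] := avl_join_spec k aL aR.
- by move=> L k R aL aR; have [] := avl_join_spec k aL aR.
- exact: avl_weight.
Qed.

End AVLFacts.

(** * Red-black trees *)

Section RedBlackFacts.
Variables (d : Order.disp_t) (K : orderType d).
Implicit Types T : tree color K.

Lemma bh_gt0 T : 0 < bh T.
Proof. by elim: T => //= L IH [] k R _. Qed.

(** Hence the tests of [rb_join] on halved ranks compare black heights. *)
Lemma rb_rank_half T : (rb_rank T)./2 = (bh T).-1.
Proof. by rewrite /rb_rank; have := bh_gt0 T; case: ifP => _; lia. Qed.

Lemma rb_rankE T : rb_rank T = 2 * (bh T).-1 + is_red T.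
Proof. by rewrite /rb_rank; have := bh_gt0 T; case: ifP => _; lia. Qed.

(* The shapes [rb_joinRight] may return before a black ancestor repairs them. *)
Definition rb_redr T : bool :=
  if T is Node L Red _ R then [&& ~~ is_red L, rb L, rb R & bh L == bh R] else false.

Definition rb_redrr T : bool :=
  if T is Node L Red _ R then
    [&& ~~ is_red L, rb L, bh L == bh R & rb R || rb_redr R] else false.

(** The outcome depends on the root colour and on whether the black height of [Tr] has been reached.
    At that level the new red node may lie under a red node and above a red root of [Tr]: up to
    three reds in a row. The next black node on the way up rotates and blackens the middle one,
    which restores [rb]; a red root above that can at worst have one red right child. *)
Lemma rb_joinRight_spec Tl (k : K) Tr : rb Tl -> rb Tr -> bh Tr <= bh Tl ->
  let: (T, n) := rb_joinRight Tl k Tr in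
  [/\ bh T = bh Tl, n <= (rb_rank Tl - 2 * (bh Tr).-1).+1 &
      if bh Tr < bh Tl then if is_red Tl then rb_redr T else rb T
      else if is_red Tl then rb_redrr T else rb_redr T].
Proof.
move=> + rTr; elim: Tl => [_|L _ c k' R IH rTl] hTr.
  have e : bh Tr = 1 by have := bh_gt0 Tr; move: hTr => /=; lia.
  by rewrite /= rb_rank_half e /= rTr e.
rewrite [rb_joinRight _ _ _]/= rb_rank_half.
case: eqP => [e|/eqP ne].
  have er : is_red (Node L c k' R) = false.
    by move: e; rewrite rb_rankE; case: is_red => //; lia.
  have eb : bh (Node L c k' R) = bh Tr.
    by move: e; rewrite rb_rankE er; have := bh_gt0 Tr; have := bh_gt0 (Node L c k' R); lia.
  rewrite eb ltnn er; split=> //; rewrite /rb_redr er rTl rTr eb eqxx //.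
move: (rTl) => /= /and4P[/eqP ebh hc rL rR].
case: c hc ne hTr rTl => /= hc ne hTr rTl.
  move/andP: hc => [blkL blkR].
  have hTrR : bh Tr <= bh R by rewrite -ebh.
  have := IH rR hTrR; case: rb_joinRight => T n; rewrite (negbTE blkR) => -[hb hn hT].
  split=> //.
    by move: hn; rewrite !rb_rankE /= (negbTE blkR) ebh; move: hTrR; lia.
  by rewrite ebh; case: ifP hT => h hT; rewrite /= blkL rL ebh hb eqxx hT ?orbT.
have hTrR : bh Tr <= bh R.
  by move: ne hTr; rewrite rb_rankE /= -ebh; have := bh_gt0 Tr; have := bh_gt0 L; lia.
rewrite ebh ltnS hTrR.
have := IH rR hTrR; case: rb_joinRight => T n [hb hn hT].
have hn' : n.+1 <= (rb_rank (Node L Black k' R) - 2 * (bh Tr).-1).+1.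
  move: hn; rewrite !rb_rankE /= ebh.
  by case: is_red; have := bh_gt0 Tr; have := bh_gt0 R; lia.
have {}hT : rb_redrr T || rb T.
  move: hT; case: ifP => _; case: ifP => _.
  - by case: T {hb} => //= ? [] // ? ? /and4P[-> -> -> ->].
  - by move=> ->; rewrite orbT.
  - by move=> ->.
  - by case: T {hb} => //= ? [] // ? ? /and4P[-> -> -> ->].
case: ifP => [|nrr].
  case: T hb hT => //= L1 [] // k1 R1 hb hT /= rR1.
  have {hT} /and4P[b1 r1 /eqP e1 h1] : [&& ~~ is_red L1, rb L1, bh L1 == bh R1 & rb R1 || rb_redr R1].
    by move: hT; case/orP => // /and4P[_]; rewrite rR1 andbF.
  split=> //=; first by rewrite ebh.
  rewrite rL r1 /= ebh hb eqxx /=.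
  case: R1 rR1 e1 h1 => //= L2 [] // k2 R2 _ e1 h1.
  rewrite -hb e1 eqxx /=.
  by case/orP: h1 => /and4P[]; [move=> -> _ -> -> | move=> _ -> -> ->].
split=> //=; first by rewrite ebh.
rewrite rL ebh hb eqxx /=; case/orP: hT => //.
case: T hb nrr => //= L1 [] // k1 R1 hb /= nrr /and4P[-> -> ->].
by rewrite nrr /= => /orP[//|]; case: R1 nrr {hb} => //= ? [].
Qed.

Definition rb_redl T : bool :=
  if T is Node L Red _ R then [&& ~~ is_red R, rb R, rb L & bh L == bh R] else false.

Definition rb_redll T : bool :=
  if T is Node L Red _ R then
    [&& ~~ is_red R, rb R, bh L == bh R & rb L || rb_redl L] else false.

Lemma rb_joinLeft_spec Tl (k : K) Tr : rb Tl -> rb Tr -> bh Tl <= bh Tr ->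
  let: (T, n) := rb_joinLeft Tl k Tr in
  [/\ bh T = bh Tr, n <= (rb_rank Tr - 2 * (bh Tl).-1).+1 &
      if bh Tl < bh Tr then if is_red Tr then rb_redl T else rb T
      else if is_red Tr then rb_redll T else rb_redl T].
Proof.
move=> rTl; elim: Tr => [_|L IH c k' R _ rTr] hTl.
  have e : bh Tl = 1 by have := bh_gt0 Tl; move: hTl => /=; lia.
  by rewrite /= rb_rank_half e /= rTl e.
rewrite [rb_joinLeft _ _ _]/= rb_rank_half.
case: eqP => [e|/eqP ne].
  have er : is_red (Node L c k' R) = false.
    by move: e; rewrite rb_rankE; case: is_red => //; lia.
  have eb : bh (Node L c k' R) = bh Tl.
    by move: e; rewrite rb_rankE er; have := bh_gt0 Tl; have := bh_gt0 (Node L c k' R); lia.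
  by rewrite eb ltnn er; split=> //; rewrite /rb_redl er rTl rTr eb eqxx.
move: (rTr) => /= /and4P[/eqP ebh hc rL rR].
case: c hc ne hTl rTr => /= hc ne hTl rTr.
  move/andP: hc => [blkL blkR].
  have := IH rL hTl; case: rb_joinLeft => T n; rewrite (negbTE blkL) => -[hb hn hT].
  split=> //.
    by move: hn; rewrite !rb_rankE /= (negbTE blkL); move: hTl; lia.
  by case: ifP hT => h hT; rewrite /= blkR rR hb ebh eqxx hT ?orbT.
have hTlL : bh Tl <= bh L.
  by move: ne hTl; rewrite rb_rankE /=; have := bh_gt0 Tl; have := bh_gt0 L; lia.
rewrite ltnS hTlL.
have := IH rL hTlL; case: rb_joinLeft => T n [hb hn hT].
have hn' : n.+1 <= (rb_rank (Node L Black k' R) - 2 * (bh Tl).-1).+1.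
  move: hn; rewrite !rb_rankE /=.
  by case: is_red; have := bh_gt0 Tl; have := bh_gt0 L; lia.
have {}hT : rb_redll T || rb T.
  move: hT; case: ifP => _; case: ifP => _.
  - by case: T {hb} => //= ? [] // ? ? /and4P[-> -> -> ->].
  - by move=> ->; rewrite orbT.
  - by move=> ->.
  - by case: T {hb} => //= ? [] // ? ? /and4P[-> -> -> ->].
case: ifP => [|nrr].
  case: T hb hT => //= L1 [] // k1 R1 hb hT /= rL1.
  have {hT} /and4P[b1 r1 /eqP e1 h1] : [&& ~~ is_red R1, rb R1, bh L1 == bh R1 & rb L1 || rb_redl L1].
    by move: hT; case/orP => // /and4P[_]; rewrite rL1.
  case: L1 rL1 hb e1 h1 => //= L2 [] // k2 R2 _ hb e1 h1.
  split=> //=; first by rewrite hb.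
  rewrite rR r1 /= -e1 hb ebh eqxx /= ?eqxx ?andbT -ebh -hb.
  by case/orP: h1 => /and4P[]; [move=> -> _ -> -> | move=> _ -> -> ->].
split=> //=; first by rewrite hb.
rewrite rR hb ebh eqxx andbT /=; case/orP: hT => //.
case: T hb nrr => //= L1 [] // k1 R1 hb /= nrr /and4P[-> -> ->].
by rewrite nrr /= andbT => /orP[//|]; case: L1 nrr {hb} => //= ? [].
Qed.

Lemma rb_join_spec Tl (k : K) Tr : rb Tl -> rb Tr ->
  [/\ rb (rb_join Tl k Tr).1,
      maxn (rb_rank Tl) (rb_rank Tr) <= rb_rank (rb_join Tl k Tr).1
        <= (maxn (rb_rank Tl) (rb_rank Tr)).+1 &
      (rb_join Tl k Tr).2
        <= 3 * (1 + (rb_rank Tl - rb_rank Tr) + (rb_rank Tr - rb_rank Tl))].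
Proof.
move=> rl rr; have pl := bh_gt0 Tl; have pr := bh_gt0 Tr.
have redE (b : bool) : (b : nat) <= 1 by case: b.
rewrite /rb_join !rb_rank_half; case: ifP => h1.
  have hb : bh Tr <= bh Tl by lia.
  have hb' : bh Tr < bh Tl by lia.
  have := rb_joinRight_spec k rl rr hb; rewrite hb'.
  case: rb_joinRight => T n [eb hn] /=.
  (* [n] is measured from twice [(bh Tr).-1], which misses the rank of [Tr] by at most one; with the
     outer invocation the work is at most 3 plus the difference of ranks. *)
  have hn' : n.+1 <= 3 * (1 + (rb_rank Tl - rb_rank Tr) + (rb_rank Tr - rb_rank Tl)).
    move: hn; rewrite !rb_rankE; have := redE (is_red Tl); have := redE (is_red Tr); lia.
  case redTl : (is_red Tl).
    case: T eb => //= L [] // k' R eb /and4P[b1 r1 r2 /eqP e1].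
    case: ifP => /= r3; split=> //; rewrite ?rb_rankE ?redTl /=.
    - by rewrite r1 r2 e1 eqxx.
    - by have := redE (is_red Tr); lia.
    - by rewrite r1 r2 e1 b1 r3 eqxx.
    - by have := redE (is_red Tr); lia.
  move=> rT; rewrite ifF; last first.
    by case: T rT {eb} => //= L [] // k' R /and4P[_ /andP[_ /negbTE ->]].
  split=> //; rewrite !rb_rankE redTl /= eb.
  by have := redE (is_red Tr); have := redE (is_red T); lia.
case: ifP => h2.
  have hb : bh Tl <= bh Tr by lia.
  have hb' : bh Tl < bh Tr by lia.
  have := rb_joinLeft_spec k rl rr hb; rewrite hb'.
  case: rb_joinLeft => T n [eb hn] /=.
  have hn' : n.+1 <= 3 * (1 + (rb_rank Tl - rb_rank Tr) + (rb_rank Tr - rb_rank Tl)).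
    move: hn; rewrite !rb_rankE; have := redE (is_red Tl); have := redE (is_red Tr); lia.
  case redTr : (is_red Tr).
    case: T eb => //= L [] // k' R eb /and4P[b1 r1 r2 /eqP e1].
    case: ifP => /= r3; split=> //; rewrite ?rb_rankE ?redTr /=.
    - by rewrite r1 r2 e1 eqxx.
    - by have := redE (is_red Tl); lia.
    - by rewrite r1 r2 e1 b1 r3 eqxx.
    - by have := redE (is_red Tl); lia.
  move=> rT; rewrite ifF; last first.
    by case: T rT {eb} => //= L [] // k' R /and4P[_ /andP[/negbTE -> _]].
  split=> //; rewrite !rb_rankE redTr /= eb.
  by have := redE (is_red Tl); have := redE (is_red T); lia.
have eb : bh Tl = bh Tr by lia.
case: ifP => [/andP[b1 b2]|nb].
  split=> /=; first by rewrite eb eqxx b1 b2 rl rr.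
    by rewrite !rb_rankE /= (negbTE b1) (negbTE b2) /=; lia.
  by lia.
split=> /=; first by rewrite eb eqxx rl rr.
  by rewrite !rb_rankE /=; move: nb; case: is_red => /=; case: is_red => //= _; lia.
by lia.
Qed.

Lemma rb_weight T : rb T -> 2 ^ (rb_rank T)./2 <= weight T.
Proof.
rewrite rb_rank_half; elim: T => //= L IHL c k R IHR /and4P[/eqP e _ rL rR].
move: (IHL rL) (IHR rR); rewrite /weight /= -e => hL hR.
case: c => /=; first by lia.
by have := bh_gt0 L; case: (bh L) hL hR => //= n hL hR _; rewrite expnS; lia.
Qed.

Lemma rb_rank_child L c (k : K) R : rb (Node L c k R) ->
  rb_rank L < rb_rank (Node L c k R) <= (rb_rank L).+2 /\
  rb_rank R < rb_rank (Node L c k R) <= (rb_rank R).+2.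
Proof.
move=> /= /and4P[/eqP e hc _ _]; rewrite !rb_rankE /= -e; have := bh_gt0 L.
case: c hc => /=; first by move=> /andP[/negbTE -> /negbTE ->]; lia.
by case: (is_red L); case: (is_red R) => /= _; lia.
Qed.

Lemma rb_join_le_split_work T1 T2 o (x : K) : bst T1 -> rb T1 -> rb T2 ->
  join_work_at (@rb_join K) o T1 T2 x
    <= (50 * 3 + 7) * split_work_at (@rb_join K) T1 T2 x.
Proof.
apply: (@ranked_join_le_split_work _ _ _ _ _ (@rb K) (@rb_rank K)) => //.
- exact: inorder_rb_join.
- by move=> L a k R /= /and4P[].
- by move=> L k R aL aR; have [] := rb_join_spec k aL aR.
- by move=> L a k R /rb_rank_child[].
- by move=> L a k R /rb_rank_child[].
- by move=> L k R aL aR; have [] := rb_join_spec k aL aR.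
- by move=> L k R aL aR; have [] := rb_join_spec k aL aR.
- exact: rb_weight.
Qed.

End RedBlackFacts.

(** * Weight-balanced trees *)

Section WeightInequalities.
Variables (R : realFieldType) (alpha : R).
Hypothesis alpha_gt : (2 / 11 < alpha)%R.
(** For alpha below 1 this is alpha <= 1 - 1/sqrt 2, written as a polynomial inequality. *)
Hypothesis alpha_le : (1 <= 2 * (1 - alpha) ^+ 2)%R.
Hypothesis alpha_lt1 : (alpha < 1)%R.
Local Notation like := (wb_like alpha).
Local Notation heavy := (wb_heavy alpha).

(** 1 - 1/sqrt 2 is about 0.293; a rational bound suffices wherever the exact one is not sharp. *)
Lemma alpha_le03 : (alpha <= 3 / 10)%R.
Proof. by move: alpha_le alpha_lt1; rewrite expr2; nra. Qed.

Lemma wb_likeE (a b : nat) : 0 < a ->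
  like a b = ((alpha * (a%:R + b%:R) <= a%:R) && (alpha * (a%:R + b%:R) <= b%:R))%R.
Proof.
move=> a0; have ab : (0 < (a + b)%:R :> R)%R by rewrite ltr0n addn_gt0 a0.
rewrite /wb_like ler_pdivlMr // ler_pdivrMr // natrD; congr (_ && _).
by apply/idP/idP; lra.
Qed.

Lemma wb_heavyE (a b : nat) : 0 < a ->
  heavy a b = (b%:R < alpha * (a%:R + b%:R))%R.
Proof.
move=> a0; have ab : (0 < (a + b)%:R :> R)%R by rewrite ltr0n addn_gt0 a0.
by rewrite /wb_heavy ltr_pdivlMr // natrD; apply/idP/idP; lra.
Qed.

Lemma wb_likeC (a b : nat) : 0 < a -> 0 < b -> like a b = like b a.
Proof. by move=> a0 b0; rewrite !wb_likeE // andbC addrC. Qed.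

(* With W = l + l1 + r1: heaviness gives l > alpha (1 - alpha) W, so a failing
   single rotation forces r1 < alpha W and hence l1 > (1 - 2 alpha) W. *)
Lemma wb_rotation_real (l c t l1 r1 : R) :
  (0 < l -> 0 < c -> 0 < t -> 0 < l1 -> 0 < r1 ->
   alpha * (l + c) <= l -> alpha * (l + c) <= c ->
   t < alpha * (l + c + t) -> l1 + r1 = c + t ->
   alpha * (l1 + r1) <= l1 -> alpha * (l1 + r1) <= r1 ->
   l < alpha * (l + (l1 + r1)) ->
   ~~ ((alpha * (l + l1) <= l) && (alpha * (l + l1) <= l1) &&
       ((alpha * (l + l1 + r1) <= l + l1) && (alpha * (l + l1 + r1) <= r1))) ->
   (1 - 2 * alpha) * (l + l1 + r1) < l1 /\
   forall l2 r2, 0 < l2 -> 0 < r2 -> l2 + r2 = l1 ->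
     alpha * (l2 + r2) <= l2 -> alpha * (l2 + r2) <= r2 ->
     [/\ alpha * (l + l2) <= l, alpha * (l + l2) <= l2,
         alpha * (r2 + r1) <= r2, alpha * (r2 + r1) <= r1 &
         (alpha * (l + l2 + (r2 + r1)) <= l + l2) &&
         (alpha * (l + l2 + (r2 + r1)) <= r2 + r1)])%R.
Proof.
move=> l0 c0 t0 l10 r10 h1 h2 ht e h3 h4 hl hn.
have a3 := alpha_le03; have a2 := alpha_gt.
have a22 : (0 <= 1 - 4 * alpha + 2 * alpha ^+ 2)%R by move: alpha_le; nra.
have a0 : (0 < alpha)%R by lra.
set W := (l + l1 + r1)%R in hn *.
have eW : (l + c = W - t)%R by rewrite /W; lra.
have W0 : (0 < W)%R by rewrite /W; lra.
have {}ht : (t < alpha * W)%R by move: ht; rewrite eW subrK.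
have {}hl : (l < alpha * W)%R by rewrite /W -addrA.
have aW0 : (0 < alpha * W)%R by rewrite mulr_gt0.
set u := (alpha * W)%R in ht hl aW0.
have hl' : ((1 - alpha) * u < l)%R.
  apply: lt_le_trans h1; rewrite eW mulrBr -/u.
  by rewrite mulrBl mul1r ltrD2l ltrN2 ltr_pM2l.
have hlr : (l1 + r1 = W - l)%R by rewrite /W; lra.
have hl1 : ((1 - alpha) * u <= l1)%R.
  apply: le_trans h3; rewrite hlr mulrBr -/u mulrBl mul1r.
  by rewrite lerD2l lerN2 ler_pM2l // ltW.
have hr1 : ((1 - alpha) * u <= r1)%R.
  apply: le_trans h4; rewrite hlr mulrBr -/u mulrBl mul1r.
  by rewrite lerD2l lerN2 ler_pM2l // ltW.
have a2u : (alpha * u <= 3 / 10 * u)%R by rewrite ler_pM2r.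
have au0 : (0 < alpha * u)%R by rewrite mulr_gt0.
have all0 : (0 < alpha * l)%R by rewrite mulr_gt0.
have al : (alpha * l <= alpha * u)%R by rewrite ler_pM2l // ltW.
have aW : (u <= 3 / 10 * W)%R by rewrite /u ler_pM2r.
have r1u : (r1 < u)%R.
  rewrite ltNge; apply: contra hn => r1u.
  have b1 : (alpha * (l + l1) <= alpha * (W - u))%R by rewrite ler_pM2l //; lra.
  have b2 : (alpha * (W - u) = (1 - alpha) * u)%R by rewrite /u; ring.
  rewrite -/u r1u andbT; apply/andP; split; first (apply/andP; split).
  - by lra.
  - have : ((1 - alpha) * ((1 - alpha) * u) <= (1 - alpha) * l1)%R.
      by rewrite ler_pM2l //; lra.
    have : (0 <= alpha * (alpha * u))%R by rewrite mulr_ge0 // ltW.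
    lra.
  - by lra.
have l1u : ((1 - 2 * alpha) * W < l1)%R by rewrite /u in r1u hl; rewrite /W in r1u hl *; lra.
split=> // l2 r2 l20 r20 e2 hl2 hr2.
have e3 : (l + l2 + (r2 + r1) = W)%R by rewrite /W -e2; ring.
rewrite e2 in hl2 hr2; rewrite e3 -/u.
have al1 : (alpha * ((1 - 2 * alpha) * W) <= alpha * l1)%R by rewrite ler_pM2l // ltW.
have ea : (alpha * ((1 - 2 * alpha) * W) = (1 - 2 * alpha) * u)%R by rewrite /u; ring.
(* The gap between the coefficients is (1 - alpha)(1 - 2 alpha) - alpha = 1 - 4 alpha + 2 alpha^2,
   which vanishes at alpha = 1 - 1/sqrt 2: here that bound is used sharply. *)
have key : (alpha * u <= (1 - alpha) * ((1 - 2 * alpha) * u))%R.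
  have : (0 <= (1 - 4 * alpha + 2 * alpha ^+ 2) * u)%R by rewrite mulr_ge0 // ltW.
  lra.
have big x : (alpha * l1 <= x -> alpha * u <= (1 - alpha) * x)%R.
  move=> hx; apply: (le_trans key); rewrite ler_pM2l; lra.
have l1W : (l1 <= (1 - alpha) * (W - l))%R by move: h4; rewrite hlr; lra.
split.
- have : (alpha * l2 <= alpha * ((1 - alpha) * l1))%R by rewrite ler_pM2l //; lra.
  have : (alpha * ((1 - alpha) * l1) <= alpha * ((1 - alpha) * W))%R.
    rewrite ler_pM2l // ler_pM2l; last by lra.
    by move: all0 l1W; rewrite mulrBr mulrBl mul1r; lra.
  have -> : (alpha * ((1 - alpha) * W) = (1 - alpha) * u)%R by rewrite /u; ring.
  have : (alpha * l1 <= alpha * ((1 - alpha) * (W - l)))%R by rewrite ler_pM2l.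
  have -> : (alpha * ((1 - alpha) * (W - l)) = (1 - alpha) * u - (1 - alpha) * (alpha * l))%R.
    by rewrite /u; ring.
  move=> q1 _ q2; have q3 : (0 <= (1 - alpha) * (alpha * l))%R by rewrite mulr_ge0 //; lra.
  have : ((1 - alpha) * (alpha * l1) <= (1 - alpha) * l)%R by rewrite ler_pM2l; lra.
  lra.
- by have := big _ hl2; lra.
- have := big _ hr2; have : (alpha * r1 <= alpha * u)%R by rewrite ler_pM2l // ltW.
  lra.
- have q1 : (alpha * l1 <= (1 - alpha) * r1)%R by lra.
  have : (alpha * r2 <= alpha * ((1 - alpha) * l1))%R by rewrite ler_pM2l //; lra.
  have : (0 < alpha * (alpha * l1))%R by rewrite !mulr_gt0.
  lra.
- have q : (alpha * u <= alpha * l1)%R by rewrite ler_pM2l //; lra.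
  by apply/andP; split; lra.
Qed.

Lemma wb_rotation (l c t l1 r1 : nat) :
  0 < l -> 0 < c -> 0 < t -> 0 < l1 -> 0 < r1 ->
  like l c -> heavy (l + c) t -> l1 + r1 = c + t -> like l1 r1 ->
  ~~ like l (l1 + r1) -> ~~ (like l l1 && like (l + l1) r1) ->
  1 < l1 /\ forall l2 r2, 0 < l2 -> 0 < r2 -> l2 + r2 = l1 -> like l2 r2 ->
    [/\ like l l2, like r2 r1 & like (l + l2) (r2 + r1)].
Proof.
move=> l0 c0 t0 l10 r10; rewrite wb_heavyE ?addn_gt0 ?l0 //.
rewrite !wb_likeE ?addn_gt0 ?l0 // => /andP[h1 h2] ht e /andP[h3 h4] hn hs.
have pos (n : nat) : 0 < n -> (0 < n%:R :> R)%R by rewrite ltr0n.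
have a3 := alpha_le03; have a2 := alpha_gt.
have e' : (l1%:R + r1%:R = c%:R + t%:R :> R)%R by rewrite -!natrD e.
have p0 := pos _ l0; have p1 := pos _ t0; have p2 := pos _ c0.
(* Balance can only fail because [l] is too light: the other side weighs c + t, and [c] alone was
   already heavy enough against [l]. *)
have hl : (l%:R < alpha * (l%:R + (l1%:R + r1%:R)) :> R)%R.
  move: hn; rewrite natrD negb_and -!ltNge => /orP[//|].
  have : (alpha * t%:R <= t%:R :> R)%R by nra.
  by rewrite e'; lra.
rewrite natrD in ht; rewrite natrD in hs.
have [h5 h6] := wb_rotation_real p0 p2 p1 (pos _ l10) (pos _ r10)
  h1 h2 ht e' h3 h4 hl hs.
split.
  have : (1 <= l%:R :> R)%R by rewrite ler1n.
  have : (1 <= r1%:R :> R)%R by rewrite ler1n.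
  have : (1 <= l1%:R :> R)%R by rewrite ler1n.
  by rewrite -(ltr1n R); nra.
move=> l2 r2 l20 r20 e2; rewrite !wb_likeE ?addn_gt0 ?l0 // => /andP[h7 h8].
have e2' : (l2%:R + r2%:R = l1%:R :> R)%R by rewrite -natrD e2.
have [-> -> -> ->] := h6 _ _ (pos _ l20) (pos _ r20) e2' h7 h8.
by rewrite !natrD.
Qed.

Lemma heavy_nat (a b : nat) : 0 < a -> heavy a b -> 7 * b < 3 * a.
Proof.
move=> a0; rewrite wb_heavyE // => h; have a3 := alpha_le03.
rewrite -(ltr_nat R) !natrM.
have : (alpha * (a%:R + b%:R) <= 3 / 10 * (a%:R + b%:R) :> R)%R.
  by apply: ler_wpM2r => //; rewrite addr_ge0.
lra.
Qed.

(** From alpha > 2/11: sibling weights have ratio at most 9/2, so a child has at most 9/11 of the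
    weight of its parent. This is the origin of the powers of 9 and 11 below. *)
Lemma like_nat (a b : nat) : 0 < a -> like a b -> 2 * b <= 9 * a /\ 2 * a <= 9 * b.
Proof.
move=> a0; rewrite wb_likeE // => /andP[h1 h2]; have a2 := alpha_gt.
have : (2 / 11 * (a%:R + b%:R) <= alpha * (a%:R + b%:R) :> R)%R.
  by apply: ler_wpM2r; rewrite ?addr_ge0 // ltW.
by split; rewrite -(ler_nat R) !natrM; lra.
Qed.

(** Keeps the descent of join in its two legitimate states, balanced or still too heavy: one step
    down cannot overshoot and make [c] too light against [t]. *)
Lemma heavy_child (l c t : nat) : 0 < l -> 0 < c -> 0 < t ->
  like l c -> heavy (l + c) t -> like c t || heavy c t.
Proof.
move=> l0 c0 t0; rewrite wb_heavyE ?addn_gt0 ?l0 // !wb_likeE // wb_heavyE //.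
move=> /andP[_ h2] ht; rewrite natrD in ht; have a3 := alpha_le03; have a2 := alpha_gt.
have pt : (0 < t%:R :> R)%R by rewrite ltr0n.
have -> /= : (alpha * (c%:R + t%:R) <= c%:R :> R)%R by nra.
by case: leP.
Qed.

Lemma not_heavy_like (a b : nat) : 0 < a -> 0 < b ->
  ~~ heavy a b -> ~~ heavy b a -> like a b.
Proof.
move=> a0 b0; rewrite !wb_heavyE // wb_likeE // -!leNgt [(b%:R + _)%R]addrC.
by move=> -> ->.
Qed.

End WeightInequalities.

(** The invariant of the work counter [n]: the last of the n invocations meets a weight ratio of at
    most 9/2, and each of the n - 1 levels above it contributes a factor of at least 11/9. *)
Lemma pow_step n a b c : 2 * 11 ^ n.-1 * a <= 9 ^ n * b -> 2 * b <= 9 * c ->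
  2 * 11 ^ n * a <= 9 ^ n.+1 * (c + b).
Proof.
move=> h1 h2; case: n h1 => [|n] h1; first by rewrite /= in h1 *; lia.
have : 9 ^ n.+1 * (11 * b) <= 9 ^ n.+1 * (9 * (c + b)).
  by rewrite leq_mul2l; apply/orP; right; lia.
by move: h1; rewrite [9 ^ n.+2]expnS [11 ^ n.+1]expnS /=; lia.
Qed.

(** Here [l1] and [l2] are the weights of the two pivot children, [a] and [b] those of the two
    unions, and [p] that of the part of Td entering the first. Only the ratio of the unions is
    bounded; the 4 in the exponent absorbs 1 + 9/2. *)
Lemma union_ratio h a p b l1 l2 : p <= 2 ^ h -> a <= p + l2 -> 0 < p -> 0 < l2 ->
  2 * l2 <= 9 * l1 -> l1 <= b -> a <= 2 ^ (h + 4) * b.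
Proof.
move=> h1 h2 p0 l20 h3 h4; rewrite expnD.
have l10 : 0 < l1 by lia.
have h5 : p * l1 <= 2 ^ h * l1 by rewrite leq_mul2r h1 orbT.
have h6 : 2 ^ h * l1 <= 2 ^ h * b by rewrite leq_mul2l h4 orbT.
have h7 : l1 <= p * l1 by rewrite leq_pmull.
have h8 : p <= p * l1 by rewrite leq_pmulr.
by rewrite mulnAC; lia.
Qed.

(** * Weight-balanced trees: work measured by weight ratios *)

Section WeightBalancedFacts.
Variables (R : realFieldType) (alpha : R).
Hypothesis alpha_gt : (2 / 11 < alpha)%R.
Hypothesis alpha_le : (1 <= 2 * (1 - alpha) ^+ 2)%R.
Hypothesis alpha_lt1 : (alpha < 1)%R.
Local Notation like := (wb_like alpha).
Local Notation heavy := (wb_heavy alpha).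
Let heavy_nat := heavy_nat alpha_le alpha_lt1.
Let like_nat := like_nat alpha_gt.
Let heavy_child := heavy_child alpha_gt alpha_le alpha_lt1.
Let wb_rotation := wb_rotation alpha_gt alpha_le alpha_lt1.
Variables (d : Order.disp_t) (K : orderType d).
Implicit Types T : tree unit K.

Lemma weight_node L u (k : K) T : weight (Node L u k T) = weight L + weight T.
Proof. by rewrite /weight /=; lia. Qed.

Lemma weight_inorder T : weight T = (size (inorder T)).+1.
Proof. by rewrite size_inorder. Qed.

Lemma inorder_wb_joinRight T (k : K) Tr :
  inorder (wb_joinRight alpha T k Tr).1 = inorder T ++ k :: inorder Tr.
Proof.
elim: T => /= [|l _ u k' c IH]; first by case: ifP.
case: ifP => // _; case: wb_joinRight IH => T' n /= IH.
rewrite -catA cat_cons -IH; case: ifP => // _; case: T' {IH} => // l1 v x r1.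
by case: ifP => _; [|case: l1 => [|? ? ? ?]]; rewrite /= -?catA //= -?catA.
Qed.

Lemma inorder_wb_joinLeft Tl (k : K) T :
  inorder (wb_joinLeft alpha Tl k T).1 = inorder Tl ++ k :: inorder T.
Proof.
elim: T => /= [|c IH u k' r _]; first by case: ifP.
case: ifP => // _; case: wb_joinLeft IH => T' n /= IH.
rewrite -cat_cons catA -IH; case: ifP => // _; case: T' {IH} => // l1 v x r1.
by case: ifP => _; [|case: r1 => [|? ? ? ?]]; rewrite /= -?catA //= -?catA.
Qed.

Lemma inorder_wb_join Tl (k : K) Tr :
  inorder (wb_join alpha Tl k Tr).1 = inorder Tl ++ k :: inorder Tr.
Proof.
rewrite /wb_join; case: ifP => _.
  by have := inorder_wb_joinRight Tl k Tr; case: wb_joinRight.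
by case: ifP => // _; have := inorder_wb_joinLeft Tl k Tr; case: wb_joinLeft.
Qed.

Lemma wb_joinRight_spec Tl (k : K) Tr : wb alpha Tl -> wb alpha Tr ->
  like (weight Tl) (weight Tr) || heavy (weight Tl) (weight Tr) ->
  let: (T, n) := wb_joinRight alpha Tl k Tr in
  wb alpha T /\ 2 * 11 ^ n.-1 * weight Tr <= 9 ^ n * weight Tl.
Proof.
move=> + rTr; elim: Tl => [_|l _ u k' c IH rTl] hTr.
  rewrite /=; case: ifP hTr => /= [h _|_ h]; last first.
    by have := heavy_nat (ltn0Sn _) h; rewrite /weight /=; lia.
  by rewrite h rTr /=; have [] := like_nat (ltn0Sn _) h; rewrite /weight /=; lia.
rewrite [wb_joinRight _ _ _ _]/=; case: ifP hTr => [h _|_ /= h].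
  split; first by rewrite /= h rTr andbT; exact: rTl.
  by have [] := like_nat (ltn0Sn _) h => //; rewrite /weight /=; lia.
move: rTl => /= /and3P[hlc rl rc]; rewrite weight_node in h *.
have := IH rc (heavy_child (ltn0Sn _) (ltn0Sn _) (ltn0Sn _) hlc h).
have := inorder_wb_joinRight c k Tr.
case: wb_joinRight => T n /= eT [] // wT hn.
have {}hn : 2 * 11 ^ n * weight Tr <= 9 ^ n.+1 * (weight l + weight c).
  have [q _] := like_nat (ltn0Sn _) hlc.
  exact: pow_step.
have {}eT : weight T = weight c + weight Tr.
  by rewrite !weight_inorder eT size_cat /= ?addSn ?addnS ?addSn // addnC.
case: ifP => h1; first by rewrite /= h1 rl wT.
case: T wT eT h1 => [|l1 v x r1] wT eT h1; first by move: eT; rewrite /weight addSn addnS.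
move: wT => /= /and3P[h2 w1 w2]; rewrite weight_node in eT h1.
case: ifP => h3.
  by move/andP: h3 => [h3 h4]; split=> //=; rewrite weight_node h3 h4 rl w1.
have [] := @wb_rotation (weight l) (weight c) (weight Tr) (weight l1) (weight r1)
  isT isT isT isT isT hlc h eT h2 (negbT h1) (negbT h3) => //.
case: l1 {h1 h2 h3 eT} w1 => [//|l2 v2 x2 r2] /= /and3P[q1 q2 q3] _ q.
have [q4 q5 q6] := q _ _ (ltn0Sn _) (ltn0Sn _) (esym (weight_node l2 v2 x2 r2)) q1.
by rewrite q4 !weight_node q5 q6 rl q2 q3 w2.
Qed.

Lemma wb_joinLeft_spec Tl (k : K) Tr : wb alpha Tl -> wb alpha Tr ->
  like (weight Tr) (weight Tl) || heavy (weight Tr) (weight Tl) ->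
  let: (T, n) := wb_joinLeft alpha Tl k Tr in
  wb alpha T /\ 2 * 11 ^ n.-1 * weight Tl <= 9 ^ n * weight Tr.
Proof.
have wC (T1 T2 : tree unit K) : like (weight T1) (weight T2) = like (weight T2) (weight T1).
  by rewrite wb_likeC.
move=> rTl; elim: Tr => [_|c IH u k' r _ rTr] hTr.
  rewrite /= wC; case: ifP hTr => /= [h _|_ h]; last first.
    by have := heavy_nat (ltn0Sn _) h; rewrite /weight /=; lia.
  by rewrite wC h rTl /=; have [] := like_nat (ltn0Sn _) h; rewrite /weight /=; lia.
rewrite [wb_joinLeft _ _ _ _]/= wC; case: ifP hTr => [h _|_ /= h].
  split; first by rewrite /= wC h rTl /=; exact: rTr.
  by have [] := like_nat (ltn0Sn _) h => //; rewrite /weight /=; lia.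
move: rTr => /= /and3P[]; rewrite wC => hlc rc rr.
rewrite weight_node addnC in h; rewrite weight_node.
have := IH rc (heavy_child (ltn0Sn _) (ltn0Sn _) (ltn0Sn _) hlc h).
have := inorder_wb_joinLeft Tl k c.
case: wb_joinLeft => T n /= eT [] // wT hn.
have {}hn : 2 * 11 ^ n * weight Tl <= 9 ^ n.+1 * (weight c + weight r).
  have [q _] := like_nat (ltn0Sn _) hlc.
  by rewrite addnC; exact: pow_step.
have {}eT : weight T = weight c + weight Tl.
  by rewrite !weight_inorder eT size_cat /= ?addSn ?addnS ?addSn // addnC.
rewrite wC; case: ifP => h1; first by rewrite /= wC h1 rr wT.
case: T wT eT h1 => [|l1 v x r1] wT eT h1; first by move: eT; rewrite /weight addSn addnS.
move: wT => /= /and3P[]; rewrite wC => h2 w1 w2.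
rewrite weight_node addnC in eT h1.
have wsC : like (weight l1) (weight r1 + weight r) = like (weight r + weight r1) (weight l1).
  by rewrite [weight r + _]addnC wb_likeC.
rewrite wC wsC; case: ifP => h3.
  by move/andP: h3 => [h3 h4]; split=> //=; rewrite weight_node wsC h4 [like (weight r1) _]wC h3 rr w1 w2.
have [] := @wb_rotation (weight r) (weight c) (weight Tl) (weight r1) (weight l1)
  isT isT isT isT isT hlc h eT h2 (negbT h1) (negbT h3) => //.
case: r1 {h1 h2 h3 eT wsC} w2 => [//|l2 v2 x2 r2] /= /and3P[]; rewrite wC => q1 q2 q3 _ q.
have [q4 q5 q6] := q _ _ (ltn0Sn _) (ltn0Sn _)
  (etrans (addnC _ _) (esym (weight_node l2 v2 x2 r2))) q1.
have e1 : like (weight l1 + weight l2) (weight r2 + weight r).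
  by rewrite wb_likeC // [weight r2 + _]addnC [weight l1 + _]addnC.
have e2 : like (weight l1) (weight l2) by rewrite wC.
have e3 : like (weight r2) (weight r) by rewrite wC.
by rewrite !weight_node e1 e2 e3 rr q2 q3 w1.
Qed.

(** (11/9)^4 exceeds 2, so four levels account for at least one binary order of magnitude. *)
Lemma pow_bound m e x : 11 ^ m <= 9 ^ m * 2 ^ e * 2 ^ x -> m <= 4 * (e + x) + 3.
Proof.
rewrite -mulnA -expnD; move: (e + x) => {e x} e h.
suff : m %/ 4 <= e by have := divn_eq m 4; have := @ltn_pmod m 4 isT; lia.
have q : 2 ^ (m %/ 4) * 9 ^ m <= 11 ^ m.
  rewrite {2 3}(divn_eq m 4) !expnD mulnA.
  apply: leq_mul; last by case: (m %% 4) => // n; rewrite leq_exp2r.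
  have e4 : 2 * 9 ^ 4 <= 11 ^ 4 by vm_compute.
  rewrite ![_ %/ 4 * 4]mulnC !expnM -expnMn.
  move: (2 * 9 ^ 4) (11 ^ 4) e4 => a b ab.
  by case: (m %/ 4) => // n; rewrite leq_exp2r.
have := leq_trans q h; rewrite mulnC leq_pmul2l ?expn_gt0 //.
by rewrite leq_exp2l.
Qed.

(** [e] bounds the binary logarithm of the weight ratio in both directions and replaces the
    difference of ranks. *)
Lemma wb_join_spec Tl (k : K) Tr e : wb alpha Tl -> wb alpha Tr ->
  wb alpha (wb_join alpha Tl k Tr).1 /\
  (weight Tl <= 2 ^ e * weight Tr -> weight Tr <= 2 ^ e * weight Tl ->
   (wb_join alpha Tl k Tr).2 <= 4 * e + 20).
Proof.
move=> rl rr; rewrite /wb_join.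
have bound a b n : 0 < a -> b <= 2 ^ e * a -> 2 * 11 ^ n.-1 * a <= 9 ^ n * b ->
    n.+1 <= 4 * e + 20.
  case: n => [|n] a0 hab /=; first by lia.
  move=> h; have {}h : 2 * 11 ^ n <= 9 ^ n.+1 * 2 ^ e.
    rewrite -(leq_pmul2r a0) (leq_trans h) // -mulnA leq_mul2l hab orbT.
    by [].
  (* The factor 9/2 left over from the stopping level is at most 2^3, which adds 3 to the
     exponent. *)
  have : n <= 4 * (e + 3) + 3; last by lia.
  apply: pow_bound; move: h; rewrite expnS => h.
  have : 9 ^ n * 2 ^ e * 2 ^ 3 = 8 * (9 ^ n * 2 ^ e) by lia.
  by lia.
case: ifP => h1.
  have := @wb_joinRight_spec Tl k Tr rl rr; rewrite h1 orbT => /(_ isT).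
  case: wb_joinRight => T n /= [wT hn]; split=> // b1 _.
  exact: (bound _ _ _ (ltn0Sn _) b1 hn).
case: ifP => h2.
  have := @wb_joinLeft_spec Tl k Tr rl rr; rewrite h2 orbT => /(_ isT).
  case: wb_joinLeft => T n /= [wT hn]; split=> // _ b1.
  exact: (bound _ _ _ (ltn0Sn _) b1 hn).
by split=> /=; [rewrite rl rr not_heavy_like ?h1 ?h2 | lia].
Qed.

Lemma wb_join_wb L (k : K) T :
  wb alpha L -> wb alpha T -> wb alpha (wb_join alpha L k T).1.
Proof. by move=> wL wT; have [] := wb_join_spec k 0 wL wT. Qed.

Lemma wb_children L u (k : K) T : wb alpha (Node L u k T) -> wb alpha L /\ wb alpha T.
Proof. by case/and3P. Qed.

Let split_wb := bal_split wb_children wb_join_wb.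
Let setop_wb := bal_setop wb_children wb_join_wb.

(** [m] counts levels, each entering a child with at most 9/11 of the weight. Removing the last key
    worsens the sibling ratio from 9/2 to at most 9, below 2^4, so the join of a level costs at most
    36 and the level at most 40. *)
Lemma wb_splitLast L u (k : K) T : wb alpha (Node L u k T) ->
  let: ((T', k'), n) := splitLast (@wb_join R alpha K) L k T in
  [/\ wb alpha T', weight (Node L u k T) = (weight T').+1 &
      exists2 m, n <= 40 * m & 11 ^ m <= 9 ^ m * weight (Node L u k T)].
Proof.
elim: T L u k => [|L' _ u' k' T' IH] L u k wT.
  have [wL _] := wb_children wT.
  by rewrite /=; split=> //; [rewrite /weight /=; lia|exists 1; rewrite /weight /=; lia].
have [wL wR] := wb_children wT; rewrite /=.
have := IH _ _ _ wR; case: splitLast => [[T1 k1] n] [wT1 eT1 [m hn hm]].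
have := wb_join_spec k 4 wL wT1; have := size_join inorder_wb_join L k T1.
case: wb_join => J n' /= sJ [wJ hn'].
move: wT => /and3P[hlike _ _]; have [q1 q2] := like_nat (ltn0Sn _) hlike.
rewrite -/(weight L) in q1 q2.
split=> //; first by rewrite weight_node eT1 /weight sJ; lia.
exists m.+1.
  have : n' <= 4 * 4 + 20; last by lia.
  have w1 : 0 < weight T1 by [].
  have w2 : 0 < weight L by [].
  clear -hn' q1 q2 eT1 w1 w2; move: q1 q2 hn'; rewrite eT1 (_ : 2 ^ 4 = 16) //.
  by move=> q1 q2; apply; lia.
rewrite weight_node !expnS.
have : 11 * (11 ^ m) <= 11 * (9 ^ m * weight (Node L' u' k' T')) by rewrite leq_mul2l hm orbT.
have : 9 ^ m * (11 * weight (Node L' u' k' T')) <=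
       9 ^ m * (9 * (weight L + weight (Node L' u' k' T'))).
  by rewrite leq_mul2l; apply/orP; right; lia.
lia.
Qed.

(** The sum of 40(4h + 3) for [splitLast], 4h + 20 for the join, and 1. *)
Lemma wb_join2_work Tl Tr h : wb alpha Tl -> wb alpha Tr ->
  weight Tl <= 2 ^ h -> weight Tr <= 2 ^ h ->
  (join2 (@wb_join R alpha K) Tl Tr).2 <= 164 * h + 141.
Proof.
case: Tl => [|L u k T] wl wr hl hr /=; first by lia.
have := wb_splitLast wl; case: splitLast => [[T' k'] n] [wT' eT' [m hn hm]].
have := wb_join_spec k' h wT' wr; case: wb_join => J n' /= [_ hn'].
have {}hn' : n' <= 4 * h + 20.
  have e1 : weight T' <= weight (Node L u k T) by rewrite eT'.
  apply: hn'.
    by apply: (leq_trans (leq_trans e1 hl)); rewrite leq_pmulr.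
  by apply: (leq_trans hr); rewrite leq_pmulr.
have : m <= 4 * (h + 0) + 3.
  apply: pow_bound; rewrite expn0 muln1; apply: leq_trans hm _.
  by rewrite leq_mul2l hl orbT.
lia.
Qed.

(** 305 = 164 + 141, from [join2] at positive height; a plain join costs less, even in a union,
    where the ratio is at most 2^(h + 4). *)
Lemma wb_call_join_work o Td L2 u (k2 : K) R2 :
  wb alpha Td -> wb alpha (Node L2 u k2 R2) -> 0 < height Td ->
  call_join_work (@wb_join R alpha K) o Td (Node L2 u k2 R2) <= 305 * height Td.
Proof.
move=> bTd b2 hTd; have [bL2 bR2] := wb_children b2; rewrite /call_join_work.
have := split_wb k2 bTd; have := size_split inorder_wb_join Td k2.
case: (split_tree _ _ _).1 => [[L b] T] sz [bL bT].
have wTd := weight_le_exp_height Td.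
have bl := setop_wb o bL bL2; have br := setop_wb o bT bR2.
have wL : weight L <= 2 ^ height Td.
  by apply: leq_trans wTd; rewrite ltnS sz -addnA leq_addr.
have wT : weight T <= 2 ^ height Td.
  by apply: leq_trans wTd; rewrite ltnS sz leq_addl.
have [eU|oU] : o = Union \/ o <> Union by case: (o); [left|right|right].
  rewrite eU in bl br *; rewrite /=.
  have [_ hw] := wb_join_spec k2 (height Td + 4) bl br.
  have sl := size_union inorder_wb_join L L2; have sr := size_union inorder_wb_join T R2.
  move: b2 => /and3P[hlike _ _]; have [q1 q2] := like_nat (ltn0Sn _) hlike.
  apply: (leq_trans (hw _ _)); last by clear -hTd; lia.
  - apply: (@union_ratio _ _ (weight L) _ (weight R2) (weight L2)) => //.
    + by clear -sl; rewrite /weight; lia.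
    + by clear -sr; rewrite /weight; lia.
  - apply: (@union_ratio _ _ (weight T) _ (weight L2) (weight R2)) => //.
    + by clear -sr; rewrite /weight; lia.
    + by clear -sl; rewrite /weight; lia.
have sl := size_setop_le inorder_wb_join L L2 oU.
have sr := size_setop_le inorder_wb_join T R2 oU.
have hl := leq_trans (sl : weight _ <= weight L) wL.
have hr := leq_trans (sr : weight _ <= weight T) wT.
have hj2 := wb_join2_work bl br hl hr.
have [_ hj] := wb_join_spec k2 (height Td) bl br.
have {}hj := hj (leq_trans hl (leq_pmulr _ (ltn0Sn _)))
  (leq_trans hr (leq_pmulr _ (ltn0Sn _))).
have {}hj : (wb_join alpha (setop (@wb_join R alpha K) o L L2) k2
    (setop (@wb_join R alpha K) o T R2)).2 <= 305 * height Td.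
  by apply: (leq_trans hj); clear -hTd; lia.
have {}hj2 : (join2 (@wb_join R alpha K) (setop (@wb_join R alpha K) o L L2)
    (setop (@wb_join R alpha K) o T R2)).2 <= 305 * height Td.
  by apply: (leq_trans hj2); clear -hTd; lia.
by clear sl sr hl hr bl br; case: o oU hj hj2 => //= _; case: b sz.
Qed.

Lemma wb_join_le_split_work T1 T2 o (x : K) : bst T1 -> wb alpha T1 -> wb alpha T2 ->
  join_work_at (@wb_join R alpha K) o T1 T2 x
    <= 305 * split_work_at (@wb_join R alpha K) T1 T2 x.
Proof.
apply: join_le_split_work.
- exact: inorder_wb_join.
- exact: split_wb.
- exact: wb_children.
- exact: wb_call_join_work.
Qed.

End WeightBalancedFacts.

(** * Treaps: deterministic bounds *)

Section TreapFacts.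
Variables (R : realFieldType) (d : Order.disp_t) (K : orderType d) (prio : K -> R).
Implicit Types T : tree unit K.
Local Notation tjoin := (treap_join prio).
Local Notation heap := (heap_ordered prio).

Lemma treap_joinE Tl k Tr : tjoin Tl k Tr =
  if prio_above prio k Tl && prio_above prio k Tr then (Node Tl tt k Tr, 1) else
  match Tl, Tr with
  | Leaf, Leaf => (Node Tl tt k Tr, 1)
  | Node l1 _ k1 r1, Leaf =>
    let: (T, n) := tjoin r1 k Tr in (Node l1 tt k1 T, n.+1)
  | Leaf, Node l2 _ k2 r2 =>
    let: (T, n) := tjoin Tl k l2 in (Node T tt k2 r2, n.+1)
  | Node l1 _ k1 r1, Node l2 _ k2 r2 =>
    if (prio k2 < prio k1)%R then
      let: (T, n) := tjoin r1 k Tr in (Node l1 tt k1 T, n.+1)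
    else
      let: (T, n) := tjoin Tl k l2 in (Node T tt k2 r2, n.+1)
  end.
Proof. by case: Tl; case: Tr. Qed.

Fixpoint rspine T : seq K := if T is Node _ _ k r then k :: rspine r else [::].
Fixpoint lspine T : seq K := if T is Node l _ k _ then k :: lspine l else [::].

(** Induction along the calls of [treap_join]: stop, descend the right spine of the left tree, or
    descend the left spine of the right tree. A leaf never beats a key, so the cases with leaves
    merge with the others. *)
Lemma treap_join_ind (P : tree unit K -> K -> tree unit K -> tree unit K * nat -> Prop) :
  (forall Tl k Tr, prio_above prio k Tl -> prio_above prio k Tr ->
     P Tl k Tr (Node Tl tt k Tr, 1)) ->
  (forall l1 u k1 r1 k Tr T n, (prio k < prio k1)%R -> prio_above prio k1 Tr ->
     P r1 k Tr (T, n) -> P (Node l1 u k1 r1) k Tr (Node l1 tt k1 T, n.+1)) ->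
  (forall Tl k l2 u k2 r2 T n, (prio k < prio k2)%R -> prio_above prio k2 Tl ->
     P Tl k l2 (T, n) -> P Tl k (Node l2 u k2 r2) (Node T tt k2 r2, n.+1)) ->
  forall Tl k Tr, P Tl k Tr (tjoin Tl k Tr).
Proof.
move=> P0 Pl Pr Tl k; elim: Tl => [|l1 _ u1 k1 r1 IHl] Tr.
  elim: Tr => [|l2 IHr u2 k2 r2 _]; rewrite treap_joinE; first exact: P0.
  case: ifP => [h|/negbT h]; first exact: P0.
  rewrite -ltNge in h; case: (tjoin Leaf k l2) IHr => T n IHr.
  exact: Pr.
elim: Tr => [|l2 IHr u2 k2 r2 _]; rewrite treap_joinE.
  case: ifP => [/andP[]|/negbT h]; first exact: P0.
  rewrite /prio_above andbT -ltNge in h.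
  by have := IHl Leaf; case: (tjoin r1 k Leaf) => T n; exact: Pl.
case: ifP => [/andP[]|/negbT h]; first exact: P0.
rewrite /prio_above negb_and -!ltNge in h; case: ltP => h12.
  have hk : (prio k < prio k1)%R by case/orP: h => // h; apply: lt_trans h h12.
  have := IHl (Node l2 u2 k2 r2); case: (tjoin r1 k _) => T n.
  by apply: Pl => //=; apply: ltW.
have hk : (prio k < prio k2)%R by case/orP: h => // h; apply: lt_le_trans h h12.
by case: (tjoin _ k l2) IHr => T n; exact: Pr.
Qed.

Lemma inorder_treap_join Tl k Tr :
  inorder (tjoin Tl k Tr).1 = inorder Tl ++ k :: inorder Tr.
Proof.
elim/treap_join_ind: (tjoin Tl k Tr) => //=.
  by move=> *; rewrite -catA cat_cons; congr (_ ++ _ :: _).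
by move=> {}Tl {}k l2 u k2 r2 T n _ _ ->; rewrite -catA.
Qed.

Lemma prio_above_trans k k' T : (prio k <= prio k')%R ->
  prio_above prio k T -> prio_above prio k' T.
Proof. by case: T => //= _ _ x _ h h'; exact: le_trans h' h. Qed.

Lemma heap_prio_all k T : heap T -> prio_above prio k T ->
  {in inorder T, forall y, (prio y <= prio k)%R}.
Proof.
elim: T k => //= L IHL u m T IHT k /and4P[a1 a2 hL hT] mk y.
rewrite mem_cat inE => /or3P[yL|/eqP ->//|yT].
- exact: (IHL _ hL (prio_above_trans mk a1)).
- exact: (IHT _ hT (prio_above_trans mk a2)).
Qed.

Lemma prio_above_all k T : {in inorder T, forall y, (prio y <= prio k)%R} ->
  prio_above prio k T.
Proof. by case: T => //= L u m T; apply; rewrite mem_cat mem_head orbT. Qed.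

Lemma heap_node L u k T : heap (Node L u k T) ->
  [/\ heap L, heap T, {in inorder L, forall y, (prio y <= prio k)%R} &
      {in inorder T, forall y, (prio y <= prio k)%R}].
Proof.
by move=> /= /and4P[h1 h2 h3 h4]; split=> //; exact: heap_prio_all.
Qed.

Lemma heap_join Tl k Tr : heap Tl -> heap Tr -> heap (tjoin Tl k Tr).1.
Proof.
(* To put an old root back on top, the induction must know that whatever dominates both trees and
   [k] dominates their join. *)
suff : heap Tl -> heap Tr -> heap (tjoin Tl k Tr).1 /\
    (forall y, prio_above prio y Tl -> prio_above prio y Tr -> (prio k <= prio y)%R ->
       prio_above prio y (tjoin Tl k Tr).1).
  by move=> h hl hr; case: (h hl hr).
elim/treap_join_ind: (tjoin Tl k Tr).
- by move=> {}Tl {}k {}Tr /= -> -> -> ->; split.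
- move=> l1 u k1 r1 {}k {}Tr T n hk1 h1 IH /= /and4P[q1 q2 q3 q4] hTr.
  have [h2 h3] := IH q4 hTr; rewrite /= in h2 h3 *.
  by rewrite q1 q3 h2 h3 // ltW.
- move=> {}Tl {}k l2 u k2 r2 T n hk1 h1 IH hTl /= /and4P[q1 q2 q3 q4].
  have [h2 h3] := IH hTl q3; rewrite /= in h2 h3 *.
  by rewrite q2 q4 h2 h3 // ltW.
Qed.

(** Every step before the last passes one spine node whose priority beats [k]. *)
Lemma treap_join_work Tl k Tr : (tjoin Tl k Tr).2 <=
  (count (fun y => prio k < prio y)%R (rspine Tl) +
   count (fun y => prio k < prio y)%R (lspine Tr)).+1.
Proof.
elim/treap_join_ind: (tjoin Tl k Tr) => //=.
- by move=> l1 u k1 r1 {}k {}Tr T n -> _; rewrite add1n !addSn.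
- by move=> {}Tl {}k l2 u k2 r2 T n -> _ h; rewrite add1n addnS.
Qed.

Lemma treap_join_top Tl k Tr : prio_above prio k Tl -> prio_above prio k Tr ->
  tjoin Tl k Tr = (Node Tl tt k Tr, 1).
Proof. by rewrite treap_joinE => -> ->. Qed.

(** The count is what the join following [splitLast] will pay on its left side. A level adds at most
    three to the sum: the invocation, a join that stops at once because [k] dominates both sides,
    and one spine key. *)
Lemma treap_splitLast L u k T : heap (Node L u k T) ->
  let: ((T', k'), n) := splitLast tjoin L k T in
  count (fun y => prio k' < prio y)%R (rspine T') + n <= 3 * (size (rspine T)).+1.
Proof.
elim: T L u k => [|L' _ u' k' T' IH] L u k hT.
  have [_ _ hL _] := heap_node hT; rewrite /= addn1 ltnS.
  rewrite (eq_in_count (a2 := pred0)) ?count_pred0 // => y yL /=.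
  apply/negbTE; rewrite -leNgt; apply: hL.
  elim: L {hT} yL => //= L1 _ v m L2 IHL.
  by rewrite mem_cat !inE => /orP[->|/IHL ->]; rewrite !orbT.
have [hL hR aL aR] := heap_node hT; rewrite /=.
have := inorder_splitLast inorder_treap_join L' k' T'.
have := IH _ _ _ hR; case: splitLast => [[T1 k1] n] /= h1 e1.
rewrite treap_join_top /=.
- by case: (_ < _)%R; lia.
- exact: prio_above_all.
- apply: prio_above_all => y yT1; apply: aR => /=.
  by rewrite e1 mem_rcons inE yT1 orbT.
Qed.

Lemma treap_join2_work Tl Tr : heap Tl ->
  (join2 tjoin Tl Tr).2 <= 3 * (size (rspine Tl) + size (lspine Tr) + 1).
Proof.
case: Tl => [|L u k T] hT /=; first by lia.
have := treap_splitLast hT; case: splitLast => [[T1 k1] n] h1.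
have := treap_join_work T1 k1 Tr; case: tjoin => J n' /= h2.
have := count_size (fun y => prio k1 < prio y)%R (lspine Tr); lia.
Qed.

Lemma rspine_sub T : {subset rspine T <= inorder T}.
Proof.
elim: T => //= L _ v m T IH y; rewrite mem_cat !inE => /orP[->|/IH ->]; rewrite ?orbT //.
Qed.

Lemma lspine_sub T : {subset lspine T <= inorder T}.
Proof.
elim: T => //= L IH v m T _ y; rewrite mem_cat !inE => /orP[->|/IH ->]; rewrite ?orbT //.
Qed.

Lemma uniq_rspine T : bst T -> uniq (rspine T).
Proof.
elim: T => //= L _ v m T IH; rewrite bst_node => /and4P[_ aT _ bT].
rewrite IH // andbT; apply/negP => /rspine_sub mT.
by have := allP aT _ mT; rewrite ltxx.
Qed.

Lemma uniq_lspine T : bst T -> uniq (lspine T).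
Proof.
elim: T => //= L IH v m T _; rewrite bst_node => /and4P[aL _ bL _].
rewrite IH // andbT; apply/negP => /lspine_sub mL.
by have := allP aL _ mL; rewrite ltxx.
Qed.

(** A node of the right spine is an ancestor of every larger key. *)
Lemma rspine_record T y : bst T -> heap T -> y \in rspine T ->
  {in inorder T, forall z, (y <= z)%O -> (prio z <= prio y)%R}.
Proof.
elim: T => // L _ v m T IH; rewrite bst_node => /and4P[aL aT bL bT] hT.
have [_ hT' h1 h2] := heap_node hT.
rewrite [rspine _]/= inE => /orP[/eqP ->|yT] z; rewrite [inorder _]/= mem_cat inE => /or3P[zL|/eqP ->|zT] //.
- by move=> _; exact: h1.
- by move=> _; exact: h2.
- have zm := allP aL _ zL; have my := allP aT _ (rspine_sub yT).
  by rewrite leNgt (lt_trans zm my).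
- by have my := allP aT _ (rspine_sub yT); rewrite leNgt my.
- exact: IH.
Qed.

Lemma lspine_record T y : bst T -> heap T -> y \in lspine T ->
  {in inorder T, forall z, (z <= y)%O -> (prio z <= prio y)%R}.
Proof.
elim: T => // L IH v m T _; rewrite bst_node => /and4P[aL aT bL bT] hT.
have [hL _ h1 h2] := heap_node hT.
rewrite [lspine _]/= inE => /orP[/eqP ->|yL] z; rewrite [inorder _]/= mem_cat inE => /or3P[zL|/eqP ->|zT] //.
- by move=> _; exact: h1.
- by move=> _; exact: h2.
- exact: IH.
- by have my := allP aL _ (lspine_sub yL); rewrite leNgt my.
- have zm := allP aT _ zT; have my := allP aL _ (lspine_sub yL).
  by rewrite leNgt (lt_trans my zm).
Qed.

Lemma heap_children L u (k : K) T : heap (Node L u k T) -> heap L /\ heap T.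
Proof. by case/and4P. Qed.

Definition heap_split := bal_split heap_children heap_join.
Definition heap_setop := bal_setop heap_children heap_join.

End TreapFacts.

(** * Key sets of split and of the set operations *)

Section SetSemantics.
Variables (A : Type) (d : Order.disp_t) (K : orderType d) (join : join_algo A K).
Implicit Types T : tree A K.
Hypothesis inorder_join : forall Tl k Tr,
  inorder (join Tl k Tr).1 = inorder Tl ++ k :: inorder Tr.

Lemma mem_split T k : bst T -> let: (L, b, R) := (split_tree join T k).1 in
  [/\ bst L, bst R, b = (k \in inorder T),
      forall z, z \in inorder L = (z \in inorder T) && (z < k)%O &
      forall z, z \in inorder R = (z \in inorder T) && (k < z)%O].
Proof.
elim: T => [|L IHL a m R IHR]; first by move=> _ /=; split=> // z; rewrite in_nil.
rewrite bst_node => /and4P[aL aR bL bR].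
have mL z : z \in inorder L -> (z < m)%O by move/(allP aL).
have mR z : z \in inorder R -> (m < z)%O by move/(allP aR).
rewrite /=; case: eqP => [->|/eqP km].
  split=> // [|z|z]; rewrite mem_cat inE ?eqxx ?orbT //.
    apply/idP/andP => [zL|[/or3P[//|/eqP->|/mR mz] zm]]; first by rewrite zL mL.
      by rewrite ltxx in zm.
    by have := lt_trans mz zm; rewrite ltxx.
  apply/idP/andP => [zR|[/or3P[/mL mz|/eqP->|//] zm]]; first by rewrite zR orbT orbT mR.
    by have := lt_trans mz zm; rewrite ltxx.
  by rewrite ltxx in zm.
case: ltP => [lkm|]; last rewrite le_eqVlt eq_sym (negbTE km) => /= lmk.
- move: (IHL bL); case: split_tree => [[[LL b] LR] n] /= [b1 b2 eb m1 m2].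
  have := inorder_join LR m R; case: join => J n' /= eJ; split=> //.
  + rewrite /bst eJ; rewrite -/(bst (Node LR a m R)) bst_node b2 bR aR !andbT.
    by apply/allP => z; rewrite m2 => /andP[/mL].
  + rewrite eb mem_cat inE (negbTE km) /=.
    by case kR : (k \in inorder R); rewrite ?orbF //; have := lt_trans lkm (mR _ kR); rewrite ltxx.
  + move=> z; rewrite m1 mem_cat inE; case zk : (z < k)%O; rewrite ?andbF ?andbT //.
    have zm := lt_trans zk lkm; rewrite (lt_eqF zm) /=.
    by case zR : (z \in inorder R); rewrite ?orbF //; have := lt_trans zm (mR _ zR); rewrite ltxx.
  + move=> z; rewrite eJ !mem_cat !inE m2; case: eqP => [->|_]; first by rewrite !orbT.
    rewrite /= ![(_ && _) || _]orbC; case zR : (z \in inorder R); rewrite ?orbT ?orbF //=.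
    by rewrite (lt_trans lkm (mR _ zR)).
- move: (IHR bR); case: split_tree => [[[LL b] LR] n] /= [b1 b2 eb m1 m2].
  have := inorder_join L m LL; case: join => J n' /= eJ; split=> //.
  + rewrite /bst eJ; rewrite -/(bst (Node L a m LL)) bst_node b1 bL aL !andbT /=.
    by apply/allP => z; rewrite m1 => /andP[/mR].
  + rewrite eb mem_cat inE (negbTE km) /=.
    by case kL : (k \in inorder L) => //; have := lt_trans lmk (mL _ kL); rewrite ltxx.
  + move=> z; rewrite eJ !mem_cat !inE m1; case: eqP => [->|_]; first by rewrite !orbT.
    rewrite /=; case zL : (z \in inorder L) => //=.
    by rewrite (lt_trans (mL _ zL) lmk).
  + move=> z; rewrite m2 mem_cat inE; case zk : (k < z)%O; rewrite ?andbF ?andbT //.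
    have zm := lt_trans lmk zk; rewrite (gt_eqF zm) /=.
    by case zL : (z \in inorder L) => //; have := lt_trans zm (mL _ zL); rewrite ltxx.
Qed.

Definition op_mem (o : set_op) (b1 b2 : bool) : bool :=
  match o with Union => b1 || b2 | Intersect => b1 && b2 | Difference => b1 && ~~ b2 end.

Lemma mem_setop o T1 T2 : bst T1 -> bst T2 ->
  bst (setop join o T1 T2) /\
  forall z, z \in inorder (setop join o T1 T2) =
    op_mem o (z \in inorder T1) (z \in inorder T2).
Proof.
elim: T2 T1 => [|L2 IHL a k2 R2 IHR] [|L1 a1 k1 R1].
- by move=> _ _; split=> [|z]; case: o.
- by move=> b1 _; split=> [|z]; case: o => //; rewrite /op_mem ?orbF ?andbF ?andbT.
- by move=> _ b2; clear IHL IHR; split=> [|z]; case: o.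
rewrite setop_node; move: (Node L1 a1 k1 R1) => T1 b1.
rewrite bst_node => /and4P[aL aR bL2 bR2].
have := mem_split k2 b1; case: (split_tree _ _ _).1 => [[L b] R] [bL bR eb mL mR].
have [bl ml] := IHL _ bL bL2; have [br mr] := IHR _ bR bR2.
have hl z : z \in inorder (setop join o L L2) -> (z < k2)%O.
  rewrite ml mL => h; suff : (z < k2)%O || (z \in inorder L2).
    by case/orP => // /(allP aL).
  by move: h; clear; case: o => /= [/orP[/andP[_ ->]|->]|/andP[/andP[_ ->]]|/andP[/andP[_ ->]]]; rewrite ?orbT.
have hr z : z \in inorder (setop join o R R2) -> (k2 < z)%O.
  rewrite mr mR => h; suff : (k2 < z)%O || (z \in inorder R2).
    by case/orP => // /(allP aR).
  by move: h; clear; case: o => /= [/orP[/andP[_ ->]|->]|/andP[/andP[_ ->]]|/andP[/andP[_ ->]]]; rewrite ?orbT.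
split.
  rewrite /bst (inorder_final_join inorder_join) !bst_cat.
  rewrite -[sorted _ (inorder (setop join o L L2))]/(bst _) bl.
  rewrite -[sorted _ (inorder (setop join o R R2))]/(bst _) br.
  rewrite /= !andbT; apply/and3P; split.
  - apply/allP => z /hl zk; apply/allP => y; rewrite mem_cat => /orP[|/hr].
      by move=> /nseqP[->].
    exact: lt_trans.
  - by apply/allP => z /nseqP[-> _]; apply/allP => y /hr.
  - by case: (o); case: (b).
move=> z; rewrite (inorder_final_join inorder_join) !mem_cat mem_nseq.
rewrite ml mr mL mR /= ?mem_cat inE.
have e1 : z \in inorder L2 -> (z < k2)%O by move/(allP aL).
have e2 : z \in inorder R2 -> (k2 < z)%O by move/(allP aR).
case: (ltgtP z k2) e1 e2 => [lt|gt|eq] e1 e2.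
- have -> : z \in inorder R2 = false by apply/negbTE/negP => /e2.
  by case: (o); case: (b); case: (z \in inorder L2); case: (z \in _).
- have -> : z \in inorder L2 = false by apply/negbTE/negP => /e1.
  by case: (o); case: (b); case: (z \in inorder R2); case: (z \in _).
- have -> : z \in inorder R2 = false by apply/negbTE/negP => /e2.
  have -> : z \in inorder L2 = false by apply/negbTE/negP => /e1.
  by rewrite eq eb; case: (o); case: (k2 \in _).
Qed.

End SetSemantics.

Lemma call_at_mem (A : Type) (d : Order.disp_t) (K : orderType d)
    (join : join_algo A K) T1 T2 x Td Tp :
  call_at join T1 T2 x = Some (Td, Tp) -> x \in inorder T2.
Proof.
elim: T2 T1 => [|L2 IHL a k2 R2 IHR] [|L1 a1 k1 R1] //.
rewrite call_at_node; case: eqP => [->|_]; first by rewrite /= mem_cat mem_head orbT.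
case: (split_tree join _ k2).1 => [[L b] R]; case: ifP => _ h; rewrite /= mem_cat inE.
- by rewrite (IHL _ h).
- by rewrite (IHR _ h) !orbT.
Qed.

(** * Which keys reach the call at a pivot key *)

Section Visible.
Variables (d : Order.disp_t) (K : orderType d) (x : K).

Definition between (z u : K) : bool := ((z <= u <= x) || (x <= u <= z))%O.

(* [hi] holds the pivot keys of priority higher than x; the keys that reach the
   call at x are those not separated from x by one of them. *)
Definition visible (hi : seq K) (z : K) : bool := all (fun u => ~~ between z u) hi.

Lemma visible_cat s1 s2 z : visible (s1 ++ s2) z = visible s1 z && visible s2 z.
Proof. exact: all_cat. Qed.

Lemma visible_lt (hi : seq K) (k z : K) :
  {in hi, forall u, (k < u)%O} -> (x < k)%O -> (z < k)%O -> visible hi z.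
Proof.
move=> h xk zk; apply/allP => u /h ku; rewrite /between negb_or !negb_and -!ltNge.
by rewrite (lt_trans xk ku) (lt_trans zk ku) !orbT.
Qed.

Lemma visible_gt (hi : seq K) (k z : K) :
  {in hi, forall u, (u < k)%O} -> (k < x)%O -> (k < z)%O -> visible hi z.
Proof.
move=> h xk zk; apply/allP => u /h ku; rewrite /between negb_or !negb_and -!ltNge.
by rewrite (lt_trans ku xk) (lt_trans ku zk).
Qed.

End Visible.

Section TreapCalls.
Variables (R : realFieldType) (d : Order.disp_t) (K : orderType d) (prio : K -> R).
Implicit Types T : tree unit K.
Local Notation tjoin := (treap_join prio).
Local Notation heap := (heap_ordered prio).
Let inorder_tjoin := inorder_treap_join prio.

Definition higher (x : K) (s : seq K) := [seq u <- s | (prio x < prio u)%R].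

(** The pivot root has the highest priority; it cuts off the keys on its other side, and the pivot
    keys over there separate nothing on the side of [x]. Hence Td depends on the set of pivot keys
    that beat [x], not on the order of their priorities. *)
Lemma call_at_treap T1 T2 x : bst T1 -> heap T1 -> bst T2 -> heap T2 ->
  {in inorder T2 &, injective prio} -> x \in inorder T2 ->
  let vis := visible x (higher x (inorder T2)) in
  match call_at tjoin T1 T2 x with
  | Some (Td, Tp) =>
    [/\ 0 < size_tree Td, bst Td, heap Td, bst Tp & heap Tp] /\
    [/\ exists L2 u R2, Tp = Node L2 u x R2,
        forall z, z \in inorder Td = (z \in inorder T1) && vis z &
        forall z, z \in inorder Tp = (z \in inorder T2) && vis z]
  | None => {in inorder T1, forall z, ~~ vis z}
  end.
Proof.
elim: T2 T1 => [|L2 IHL u k2 R2 IHR] T1 // b1 h1 b2 h2 inj xT2 vis.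
case: T1 b1 h1 => [|L1 u1 k1 R1] // b1 h1.
have T10 : 0 < size_tree (Node L1 u1 k1 R1) by [].
rewrite call_at_node; move: (Node L1 u1 k1 R1) b1 h1 T10 => T1 b1 h1 T10 {L1 u1 k1 R1}.
have [hL2 hR2 aL aR] := heap_node h2.
have := b2; rewrite bst_node => /and4P[lL lR bL2 bR2].
have k2T : k2 \in inorder (Node L2 u k2 R2) by rewrite /= mem_cat mem_head orbT.
have top y : y \in inorder (Node L2 u k2 R2) -> (prio y <= prio k2)%R.
  by rewrite /= mem_cat inE => /or3P[/aL|/eqP->|/aR].
case: eqP => [ex|/eqP ne].
  have v z : vis z.
    apply/allP => y; rewrite mem_filter => /andP[xy /top]; rewrite -ex => /(lt_le_trans xy).
    by rewrite ltxx.
  split=> //; split=> [|z|z]; rewrite ?v ?andbT //.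
  by exists L2, u, R2; rewrite ex.
have pk : (prio x < prio k2)%R.
  rewrite lt_neqAle top // andbT; apply: contra ne => /eqP e.
  by apply/eqP; apply: inj.
have := mem_split inorder_tjoin k2 b1; have := heap_split k2 h1.
case: (split_tree _ _ _).1 => [[L b] T] [hL hT] [bL bT _ mL mT].
have visE z : vis z = [&& visible x (higher x (inorder L2)) z, ~~ between x z k2 &
    visible x (higher x (inorder R2)) z].
  by rewrite /vis /higher /= filter_cat /= pk visible_cat.
case: ltP => xk.
- have xL2 : x \in inorder L2.
    move: xT2; rewrite /= mem_cat inE (negbTE ne) /= => /orP[//|/(allP lR) xk'].
    by have := lt_trans xk xk'; rewrite ltxx.
  have visL z : vis z = (z < k2)%O && visible x (higher x (inorder L2)) z.
    rewrite visE /between; case: (ltP z k2) => zk; last first.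
      by rewrite (ltW xk) orbT andbF.
    rewrite [(k2 <= x)%O]leNgt xk !andbF /=.
    rewrite (visible_lt (hi := higher x (inorder R2)) (k := k2)) ?andbT // => y.
    by rewrite mem_filter => /andP[_ /(allP lR)].
  have injL : {in inorder L2 &, injective prio}.
    by move=> y z yL zL; apply: inj; rewrite /= mem_cat ?yL ?zL.
  have := IHL L bL hL bL2 hL2 injL xL2.
  case: call_at => [[Td Tp] [q1 [q2 q3 q4]]|q].
    split=> //; split=> // z; rewrite ?q3 ?q4 visL; first by rewrite mL -andbA.
    rewrite /= mem_cat inE; case zL : (z \in inorder L2) => /=.
      by rewrite (allP lL _ zL).
    case: (ltP z k2) => zk; rewrite ?andbF //= (lt_eqF zk) /=.
    by case zR : (z \in inorder R2) => //; have := lt_trans zk (allP lR _ zR); rewrite ltxx.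
  move=> z zT; rewrite visL; case: ltP => //= zk; apply: q.
  by rewrite mL zT zk.
- have {}xk : (k2 < x)%O by rewrite lt_neqAle xk eq_sym ne.
  have xR2 : x \in inorder R2.
    move: xT2; rewrite /= mem_cat inE (negbTE ne) /= => /orP[/(allP lL) xk'|//].
    by have := lt_trans xk xk'; rewrite ltxx.
  have visR z : vis z = (k2 < z)%O && visible x (higher x (inorder R2)) z.
    rewrite visE /between; case: (ltP k2 z) => zk; last first.
      by rewrite (ltW xk) /= andbF.
    rewrite [(x <= k2)%O]leNgt xk /=.
    rewrite (visible_gt (hi := higher x (inorder L2)) (k := k2)) // => y.
    by rewrite mem_filter => /andP[_ /(allP lL)].
  have injR : {in inorder R2 &, injective prio}.
    by move=> y z yR zR; apply: inj; rewrite /= mem_cat inE ?yR ?zR !orbT.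
  have := IHR T bT hT bR2 hR2 injR xR2.
  case: call_at => [[Td Tp] [q1 [q2 q3 q4]]|q].
    split=> //; split=> // z; rewrite ?q3 ?q4 visR; first by rewrite mT -andbA.
    rewrite /= mem_cat inE orbC; case zR : (z \in inorder R2) => /=.
      by rewrite (allP lR _ zR) orbT.
    case: (ltP k2 z) => zk; rewrite ?andbF //= (gt_eqF zk) /=.
    by case zL : (z \in inorder L2) => //; have := lt_trans zk (allP lL _ zL); rewrite ltxx.
  move=> z zT; rewrite visR; case: ltP => //= zk; apply: q.
  by rewrite mT zT zk.
Qed.

(** Right-to-left maxima of the priorities in key order; [recordL] gives the left-to-right ones. *)
Definition recordR (M : seq K) (y : K) : bool :=
  all (fun z => (y < z)%O ==> (prio z < prio y)%R) M.
Definition recordL (M : seq K) (y : K) : bool :=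
  all (fun z => (z < y)%O ==> (prio z < prio y)%R) M.

(** A spine key is a record among all keys of the tree, a fortiori among those of [M]; [p] selects
    the spine keys that are charged. *)
Lemma rspine_count T (M : seq K) (p : pred K) : bst T -> heap T ->
  {subset M <= inorder T} -> {in rspine T, forall y, p y -> y \in M} ->
  {in M &, injective prio} -> count p (rspine T) <= count (recordR M) M.
Proof.
move=> bT hT MT pM inj; rewrite -!size_filter; apply: uniq_leq_size.
  by rewrite filter_uniq // uniq_rspine.
move=> y; rewrite !mem_filter => /andP[py yT]; have yM := pM _ yT py.
rewrite yM andbT; apply/allP => z zM; apply/implyP => yz.
rewrite lt_neqAle (rspine_record bT hT yT (MT _ zM) (ltW yz)) andbT.
by apply: contraTneq yz => /(inj _ _ zM yM) ->; rewrite ltxx.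
Qed.

Lemma lspine_count T (M : seq K) (p : pred K) : bst T -> heap T ->
  {subset M <= inorder T} -> {in lspine T, forall y, p y -> y \in M} ->
  {in M &, injective prio} -> count p (lspine T) <= count (recordL M) M.
Proof.
move=> bT hT MT pM inj; rewrite -!size_filter; apply: uniq_leq_size.
  by rewrite filter_uniq // uniq_lspine.
move=> y; rewrite !mem_filter => /andP[py yT]; have yM := pM _ yT py.
rewrite yM andbT; apply/allP => z zM; apply/implyP => yz.
rewrite lt_neqAle (lspine_record bT hT yT (MT _ zM) (ltW yz)) andbT.
by apply: contraTneq yz => /(inj _ _ zM yM) ->; rewrite ltxx.
Qed.

End TreapCalls.

Section TreapBound.
Variables (d : Order.disp_t) (K : orderType d).
Implicit Types (T : tree unit K) (s hi : seq K).

(** The keys of Td that can be charged to the final join. Intersect returns pivot keys only and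
    difference none. Union returns both kinds, but its join is charged only for keys that beat [x],
    and no pivot key reaching the call does. *)
Definition in_op (o : set_op) s2 (z : K) : bool :=
  if o is Intersect then z \in s2 else z \notin s2.

Definition lkeys o s1 s2 x hi :=
  [seq z <- s1 | [&& visible x hi z, (z < x)%O & in_op o s2 z]].
Definition rkeys o s1 s2 x hi :=
  [seq z <- s1 | [&& visible x hi z, (x < z)%O & in_op o s2 z]].

Variables (R : realFieldType) (prio : K -> R).
Local Notation tjoin := (treap_join prio).
Local Notation heap := (heap_ordered prio).
Let inorder_tjoin := inorder_treap_join prio.

Lemma final_join_work_le o b Tl (k : K) Tr : heap Tl ->
  (final_join tjoin o b Tl k Tr).2 <=
    3 * ((if o is Union then count (fun y => prio k < prio y)%R (rspine Tl)
          else size (rspine Tl)) +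
         (if o is Union then count (fun y => prio k < prio y)%R (lspine Tr)
          else size (lspine Tr)) + 1).
Proof.
move=> hTl; have h1 := treap_join_work prio Tl k Tr.
have h2 := treap_join2_work Tr hTl.
have h3 := count_size (fun y => prio k < prio y)%R (rspine Tl).
have h4 := count_size (fun y => prio k < prio y)%R (lspine Tr).
by case: o => /=; [lia | case: b; lia | lia].
Qed.

(** Record counts apart, the bounds depend on the priorities through [hi] alone, which prepares the
    conditioning. [n] is the size of Td, and [0 < n] charges the constant part only if the call
    takes place. *)
Lemma treap_call_bounds o T1 T2 x : bst T1 -> heap T1 -> bst T2 -> heap T2 ->
  {in inorder T1 ++ inorder T2 &, injective prio} -> x \in inorder T2 ->
  let hi := higher prio x (inorder T2) in
  let n := count (visible x hi) (inorder T1) in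
  let Ml := lkeys o (inorder T1) (inorder T2) x hi in
  let Mr := rkeys o (inorder T1) (inorder T2) x hi in
  join_work_at tjoin o T1 T2 x <=
    3 * (count (recordR prio Ml) Ml + count (recordL prio Mr) Mr + (0 < n)) /\
  trunc_log 2 n.+1 <= split_work_at tjoin T1 T2 x.
Proof.
move=> b1 h1 b2 h2 inj xT2 hi n Ml Mr; rewrite /join_work_at /split_work_at.
have inj2 : {in inorder T2 &, injective prio}.
  by move=> y z yT zT; apply: inj; rewrite mem_cat ?yT ?zT orbT.
have := call_at_treap b1 h1 b2 h2 inj2 xT2; rewrite -/hi.
case: call_at => [[Td Tp] [[Td0 bTd hTd bTp hTp] [[L2 [u [R2 eTp]]] mTd mTp]]|none]; last first.
  suff -> : n = 0 by [].
  by apply/eqP; rewrite -leqn0 leqNgt -has_count -all_predC; apply/allP.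
have nE : weight Td = n.+1.
  rewrite /weight -size_inorder; congr _.+1; rewrite /n -size_filter; apply/perm_size.
  apply: uniq_perm.
  - by apply: (sorted_uniq lt_trans lt_irreflexive).
  - by apply: filter_uniq; apply: (sorted_uniq lt_trans lt_irreflexive).
  - by move=> z; rewrite mTd mem_filter andbC.
split; last first.
  apply: leq_trans (height_le_split_work _ bTd).
  rewrite -[_ <= _](@leq_exp2l 2) //; apply: leq_trans (weight_le_exp_height Td).
  by rewrite nE trunc_logP.
have -> : 0 < n by move: nE Td0; rewrite /weight; lia.
rewrite eTp /call_join_work.
have := mem_split inorder_tjoin x bTd; have := heap_split x hTd.
case: (split_tree tjoin Td x).1 => [[L b] T] [hL hT] [bL bT _ mL mT].
rewrite eTp in bTp hTp mTp.
have [hL2 hR2 aL aR] := heap_node hTp.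
have := bTp; rewrite bst_node => /and4P[lL lR bL2 bR2].
have mL2 z : z \in inorder L2 = [&& z \in inorder T2, visible x hi z & (z < x)%O].
  rewrite andbA -mTp /= mem_cat inE; case zL : (z \in inorder L2); first by rewrite (allP lL _ zL).
  case: (ltgtP z x) => //= zx; rewrite ?andbF //= andbT.
  by case zR : (z \in inorder R2) => //; have := lt_trans zx (allP lR _ zR); rewrite ltxx.
have mR2 z : z \in inorder R2 = [&& z \in inorder T2, visible x hi z & (x < z)%O].
  rewrite andbA -mTp /= mem_cat inE orbC.
  case zR : (z \in inorder R2); first by rewrite (allP lR _ zR) orbT.
  case: (ltgtP z x) => //= zx; rewrite ?andbF //= andbT.
  by case zL : (z \in inorder L2) => //; have := lt_trans zx (allP lL _ zL); rewrite ltxx.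
have [bl ml] := mem_setop inorder_tjoin o bL bL2.
have [br mr] := mem_setop inorder_tjoin o bT bR2.
have hl := heap_setop o hL hL2; have hr := heap_setop o hT hR2.
apply: leq_trans (final_join_work_le _ _ _ _ hl) _.
rewrite leq_mul2l orFb leq_add2r.
(* A key of [hi] separates itself from [x], so it is not visible. *)
have vis_hi z : visible x hi z -> z \in inorder T2 -> (prio z <= prio x)%R.
  move=> vz zT2; rewrite leNgt; apply/negP => xz.
  have : z \in hi by rewrite mem_filter xz.
  move=> /(allP vz); rewrite /between lexx /=.
  by case: (leP z x) => //= /ltW ->.
have subl : {subset Ml <= inorder (setop tjoin o L L2)}.
  move=> z; rewrite mem_filter ml mL mTd mL2 => /andP[/and3P[-> -> oz] ->].
  by move: oz; case: (o) => /=; [|move=> ->|move=> /negbTE ->].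
have subr : {subset Mr <= inorder (setop tjoin o T R2)}.
  move=> z; rewrite mem_filter mr mT mTd mR2 => /andP[/and3P[-> -> oz] ->].
  by move: oz; case: (o) => /=; [|move=> ->|move=> /negbTE ->].
have injM (M : seq K) : {subset M <= inorder T1} -> {in M &, injective prio}.
  by move=> sM y z yM zM; apply: inj; rewrite mem_cat sM.
have injl : {in Ml &, injective prio} by apply: injM; exact: mem_subseq (filter_subseq _ _).
have injr : {in Mr &, injective prio} by apply: injM; exact: mem_subseq (filter_subseq _ _).
apply: leq_add.
- apply: (@leq_trans (count (if o is Union then fun y => (prio x < prio y)%R else predT)
    (rspine (setop tjoin o L L2)))); first by case: (o); rewrite ?count_predT.
  apply: rspine_count => // y /rspine_sub; rewrite ml mL mTd mL2 mem_filter.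
  case: (boolP (visible x hi y)) => [vy|_]; last by case: (o); rewrite !andbF.
  case: (ltP y x) => _; last by case: (o); rewrite !andbF.
  rewrite !andbT; case: (o) => /=; [|by rewrite andbC| by rewrite andbC].
  have := vis_hi y vy; case: (y \in inorder T2) => [/(_ isT)|_] /=; last by rewrite orbF => ->.
  by rewrite leNgt => /negbTE ->.
- apply: (@leq_trans (count (if o is Union then fun y => (prio x < prio y)%R else predT)
    (lspine (setop tjoin o T R2)))); first by case: (o); rewrite ?count_predT.
  apply: lspine_count => // y /lspine_sub; rewrite mr mT mTd mR2 mem_filter.
  case: (boolP (visible x hi y)) => [vy|_]; last by case: (o); rewrite !andbF.
  case: (ltP x y) => _; last by case: (o); rewrite !andbF.
  rewrite !andbT; case: (o) => /=; [|by rewrite andbC| by rewrite andbC].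
  have := vis_hi y vy; case: (y \in inorder T2) => [/(_ isT)|_] /=; last by rewrite orbF => ->.
  by rewrite leNgt => /negbTE ->.
Qed.

End TreapBound.

(** * Treaps: random priorities *)

Local Open Scope classical_set_scope.
Local Open Scope ring_scope.

Lemma In_cat (T : Type) (a : T) (s t : seq T) :
  List.In a (s ++ t) -> List.In a s \/ List.In a t.
Proof. by elim: s => [|b s IH] /=; [right | move=> [->|/IH[]]; tauto]. Qed.

Lemma In_map (S T : Type) (f : S -> T) (a : T) (s : seq S) :
  List.In a (map f s) -> exists y, f y = a.
Proof. by elim: s => //= b s IH [<-|/IH//]; exists b. Qed.

(** * Integrals of finite sums of weighted indicators *)

Section NonnegativeIntegrals.
Context (d : measure_display) (T : measurableType d) (R : realType).
Variable mu : {measure set T -> \bar R}.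
Local Open Scope ereal_scope.

Import HBNNSimple.

(* No measurability is needed: the integral of a nonnegative function is the
   supremum of the integrals of the simple functions below it. *)
Lemma ge0_le_integralT (f g : T -> \bar R) :
  (forall x, 0 <= f x) -> (forall x, f x <= g x) ->
  \int[mu]_x f x <= \int[mu]_x g x.
Proof.
move=> f0 fg; have g0 x : 0 <= g x by apply: le_trans (fg x).
rewrite !ge0_integralE //; apply: le_ereal_sup => _ [h /= hf <-].
exists h => // x; apply: le_trans (hf x) _.
by rewrite !patchE; case: ifP.
Qed.

(** The coefficients are extended reals so that a null set may carry the weight +oo. *)
Lemma integral_sum_indic (s : seq (\bar R * set T)) :
  (forall cA, List.In cA s -> 0 <= cA.1 /\ measurable cA.2) ->
  \int[mu]_x (\sum_(cA <- s) cA.1 * (\1_(cA.2) x)%:E) =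
  \sum_(cA <- s) cA.1 * mu cA.2.
Proof.
have mI A : measurable A -> measurable_fun [set: T] (EFin \o (\1_A : T -> R)).
  by move=> mA; apply/measurable_EFinP; exact: measurable_indic.
suff H : (forall cA, List.In cA s -> 0 <= cA.1 /\ measurable cA.2) ->
    measurable_fun [set: T] (fun x => \sum_(cA <- s) cA.1 * (\1_(cA.2) x)%:E) /\
    \int[mu]_x (\sum_(cA <- s) cA.1 * (\1_(cA.2) x)%:E) =
    \sum_(cA <- s) cA.1 * mu cA.2 by move=> /H[].
elim: s => [_|[c A] s IH hs].
  have e : (fun x => \sum_(cA <- [::]) cA.1 * (\1_(cA.2) x)%:E) = cst (0 : \bar R) :> (T -> \bar R).
    by apply/funext => x; rewrite big_nil.
  by rewrite e integral0 big_nil; split; first exact: measurable_cst.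
have [c0 mA] := hs (c, A) (or_introl erefl).
have {}IH := IH (fun cA h => hs cA (or_intror h)); case: IH => mS IH.
have mcA : measurable_fun [set: T] (fun x => c * (EFin \o (\1_A : T -> R)) x).
  by apply: emeasurable_funM; [exact: measurable_cst|exact: mI].
have e : (fun x => \sum_(cA <- (c, A) :: s) cA.1 * (\1_(cA.2) x)%:E) =
    (fun x => c * (EFin \o (\1_A : T -> R)) x +
              \sum_(cA <- s) cA.1 * (\1_(cA.2) x)%:E) :> (T -> \bar R).
  by apply/funext => x; rewrite big_cons.
rewrite e; split; first exact: emeasurable_funD.
rewrite ge0_integralD //=.
- rewrite IH big_cons (ge0_integralZl mu measurableT (mI _ mA)) //=.
  by rewrite integral_indic // setIT.
- by move=> x _; rewrite mule_ge0 // lee_fin.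
- move=> x _; have : forall cA, List.In cA s -> 0 <= cA.1 /\ measurable cA.2.
    by move=> cA h; exact: (hs cA (or_intror h)).
  elim: (s) => [_|[c' A'] s' IHs h]; first by rewrite big_nil.
  rewrite big_cons adde_ge0 // ?IHs //; last by move=> cA h'; exact: (h _ (or_intror h')).
  by have [c'0 _] := h _ (or_introl erefl); rewrite mule_ge0 // lee_fin.
Qed.

End NonnegativeIntegrals.

Section GeneratedSigmaAlgebra.
Variables (T : Type) (G : set (set T)).

Lemma g_sigmaC A : <<s G >> A -> <<s G >> (~` A).
Proof. by rewrite -setTD => sA; apply: sigma_algebraCD. Qed.

Lemma g_sigma0 : <<s G >> (set0 : set T).
Proof. by move=> M [[]]. Qed.

Lemma g_sigmaT : <<s G >> [set: T].
Proof. by have := g_sigmaC g_sigma0; rewrite setC0. Qed.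

Lemma g_sigmaI A B : <<s G >> A -> <<s G >> B -> <<s G >> (A `&` B).
Proof.
move=> sA sB; rewrite -[A `&` B]setCK setCI -bigcup2E.
refine (g_sigmaC (sigma_algebra_bigcup _)) => -[|[|n]] /=.
- exact: (g_sigmaC sA).
- exact: (g_sigmaC sB).
- exact g_sigma0.
Qed.

End GeneratedSigmaAlgebra.

(** * Exchangeability of independent uniform priorities *)

Section Exchangeability.
Context (R : realType) (dO : measure_display) (Omega : measurableType dO).
Context (P : probability Omega R) (d : Order.disp_t) (K : orderType d).
Variable prio : K -> {RV P >-> R}.
Hypothesis indep : mutually_independent prio.
Hypothesis unif : forall k, uniform01 (prio k).

(** The finite-dimensional measurable cylinders; they generate the product sigma-algebra on
    [K -> R]. *)
Definition rect : set (set (K -> R)) := 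
  [set F | exists (s : seq K) (B : K -> set R), (forall k, measurable (B k)) /\ F = [set f | forall k, k \in s -> B k (f k)]].

Lemma rect_setI : setI_closed rect.
Proof.
move=> _ _ [s [B [mB ->]]] [s' [B' [mB' ->]]].
(* Each constraint is relaxed to [setT] off its own list, so that a single family on the
   concatenated list describes the intersection. *)
exists (s ++ s'), (fun k => (if k \in s then B k else setT) `&`
                            (if k \in s' then B' k else setT)).
split; first by move=> k; apply: measurableI; case: ifP.
apply/seteqP; split=> f /=.
  move=> [h h'] k; rewrite mem_cat => _.
  by split; case: ifP => // ks; [exact: h | exact: h'].
move=> h; split=> k ks; have := h k; rewrite mem_cat ks ?orbT => /(_ isT)[];
  by rewrite ?ks.
Qed.

Definition swap (y z k : K) : K := if k == y then z else if k == z then y else k.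

Lemma swapK y z : involutive (swap y z).
Proof.
move=> k; rewrite /swap; have [->|ky] := eqVneq k y.
  by have [->|_] := eqVneq z y; rewrite ?eqxx.
by have [->|kz] := eqVneq k z; rewrite ?eqxx // (negbTE ky) (negbTE kz).
Qed.

Definition prios (w : Omega) : K -> R := fun k => prio k w.
Definition swapped y z (w : Omega) : K -> R := fun k => prio (swap y z k) w.

(** The product does not mention [t]: independence and equal laws make relabelling the priorities
    invisible on cylinders. *)
Lemma prob_rect (s : seq K) (B : K -> set R) (t : K -> K) : involutive t ->
  (forall k, measurable (B k)) ->
  measurable [set w | forall k, k \in s -> B k (prio (t k) w)] /\
  P [set w | forall k, k \in s -> B k (prio (t k) w)] =
  (\prod_(k <- undup s) uniform_prob (@ltr01 R) (B k))%E.
Proof.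
move=> tK mB.
have e : [set w | forall k, k \in s -> B k (prio (t k) w)] =
    \bigcap_(j in [set` map t (undup s)]) (prio j @^-1` B (t j)).
  apply/seteqP; split=> w /= h j.
    by move=> /= /mapP[k ks ->]; rewrite tK; apply: h; rewrite mem_undup in ks.
  move=> js; have := h (t j); rewrite /= mem_map; last exact: inv_inj.
  by rewrite mem_undup tK; exact.
rewrite e; split.
  by apply: fin_bigcap_measurable => // j _; exact: measurable_funPTI.
rewrite indep; last 2 first.
- by rewrite map_inj_uniq ?undup_uniq //; exact: inv_inj.
- by move=> j.
rewrite big_map; apply: eq_bigr => k _; rewrite tK.
by have := unif (t k) (mB k); rewrite /distribution /pushforward.
Qed.

(** Dynkin's pi-lambda argument: both laws agree on cylinders, which are stable under intersection.
    With [y] equal to [z] the lemma also serves to show that events about the priorities are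
    measurable. *)
Lemma exchange y z F : <<s rect >> F ->
  [/\ measurable (prios @^-1` F), measurable (swapped y z @^-1` F) &
      P (prios @^-1` F) = P (swapped y z @^-1` F)].
Proof.
pose H := [set F : set (K -> R) | [/\ measurable (prios @^-1` F),
  measurable (swapped y z @^-1` F) & P (prios @^-1` F) = P (swapped y z @^-1` F)]].
move: F; change (<<s rect >> `<=` H).
apply: lambda_system_subset; [exact: rect_setI| | |by []].
- apply/dynkin_lambda_system; split.
  + by rewrite /H /= !preimage_setT; split.
  + move=> A [m1 m2 e].
    suff : [/\ measurable (~` (prios @^-1` A)), measurable (~` (swapped y z @^-1` A)) &
        P (~` (prios @^-1` A)) = P (~` (swapped y z @^-1` A))] by [].
    split; [exact: measurableC|exact: measurableC|].
    by rewrite !probability_setC // e.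
  + move=> A tA hA; rewrite /H /= !preimage_bigcup; split.
    * by apply: bigcup_measurable => k _; have [] := hA k.
    * by apply: bigcup_measurable => k _; have [] := hA k.
    * have tP (g : Omega -> K -> R) : trivIset setT (fun n => g @^-1` A n).
        by move=> i j _ _ [w [wi wj]]; apply: (tA i j) => //; exists (g w).
      rewrite (measure_bigcup P setT (fun n => prios @^-1` A n)) //; last first.
        by move=> i _; have [] := hA i.
      rewrite (measure_bigcup P setT (fun n => swapped y z @^-1` A n)) //; last first.
        by move=> i _; have [] := hA i.
      by apply: eq_eseriesr => i _; have [] := hA i.
- move=> _ [s [B [mB ->]]]; rewrite /H /=.
  have [m1 e1] := prob_rect s (fun k => erefl : id (id k) = k) mB.
  have [m2 e2] := prob_rect s (@swapK y z) mB.
  by split=> //; rewrite [LHS]e1 [RHS]e2.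
Qed.

(** Some rational lies strictly between the two values; [unpickle] enumerates the rationals, giving
    a countable union. *)
Lemma sigma_lt (a b : K) : <<s rect >> [set f : K -> R | f a < f b].
Proof.
have -> : [set f : K -> R | f a < f b] = \bigcup_n
   (if unpickle n is Some q then [set f | f a < ratr q] `&` [set f : K -> R | ratr q < f b]
    else set0).
  apply/seteqP; split=> f /=.
    move=> /rat_in_itvoo[q]; rewrite in_itv /= => /andP[h1 h2].
    by exists (pickle q); [exact: I | rewrite pickleK; split].
  by move=> [n _]; case: unpickle => // q [/= h1 h2]; exact: lt_trans h1 h2.
refine (sigma_algebra_bigcup _) => n; case: unpickle => [q|]; last exact (@g_sigma0 _ _).
refine (g_sigmaI (sub_sigma_algebra _) (sub_sigma_algebra _)).
- exists [:: a], (fun=> [set r | r < ratr q]); split.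
    by move=> _; rewrite -set_itvE; exact: measurable_itv.
  by apply/seteqP; split=> f /= h; [move=> k; rewrite inE => /eqP -> | apply: h; rewrite mem_head].
- exists [:: b], (fun=> [set r | ratr q < r]); split.
    by move=> _; rewrite -set_itvE; exact: measurable_itv.
  by apply/seteqP; split=> f /= h; [move=> k; rewrite inE => /eqP -> | apply: h; rewrite mem_head].
Qed.

End Exchangeability.

(** * Harmonic numbers and logarithms *)

Section HarmonicBound.
Variable R : realType.

Definition harm (n : nat) : R := \sum_(i < n) i.+1%:R^-1.

Lemma harm_double n m : (m <= n.+1)%N -> harm (n + m) <= harm n + 1.
Proof.
move=> mn; rewrite /harm big_split_ord /= lerD2l.
apply: (@le_trans _ _ (\sum_(i < m) n.+1%:R^-1)).
  by apply: ler_sum => i _; rewrite lef_pV2 ?posrE ?ltr0n // ler_nat ltnS leq_addr.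
by rewrite sumr_const card_ord -[_^-1 *+ _]mulr_natl ler_pdivrMr ?ltr0n // mul1r ler_nat.
Qed.

Lemma harm_le_log n : (0 < n)%N -> harm n <= (trunc_log 2 n).+1%:R.
Proof.
elim/ltn_ind: n => -[//|[|n]] IH _; first by rewrite /harm big_ord1 invr1 trunc_log1.
rewrite trunc_log2S // -natr1.
have e : n.+2 = (n.+2./2 + (n.+2 - n.+2./2))%N by lia.
rewrite {1}e; apply: (le_trans (harm_double _)); first by lia.
by rewrite lerD2r; apply: IH; lia.
Qed.

(** The factor 2 absorbs the successor in [harm_le_log]: for positive m the logarithm of n + 1 is at
    least 1. *)
Lemma harm_le n m : (m <= n)%N -> harm m <= 2 * (trunc_log 2 n.+1)%:R.
Proof.
case: m => [|m] mn; first by rewrite /harm big_ord0 mulr_ge0.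
apply: le_trans (harm_le_log (ltn0Sn m)) _.
have h1 : (trunc_log 2 m.+1 <= trunc_log 2 n.+1)%N by apply: leq_trunc_log; lia.
have h2 : (1 <= trunc_log 2 n.+1)%N by rewrite (@leq_trunc_log 2 2 n.+1) //; lia.
by rewrite -natrM ler_nat; lia.
Qed.

End HarmonicBound.

(** * Expected number of records *)

Section Records.
Context (R : realType) (dO : measure_display) (Omega : measurableType dO).
Context (P : probability Omega R) (d : Order.disp_t) (K : orderType d).
Variable prio : K -> {RV P >-> R}.
Hypothesis indep : mutually_independent prio.
Hypothesis unif : forall k, uniform01 (prio k).
Local Notation rect := (@rect R d K).
Local Notation prios := (prios prio).

Lemma probE A : measurable A -> P A = (fine (P A))%:E.
Proof. by move=> mA; rewrite fineK // fin_num_measure. Qed.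

Lemma sum_disjoint_le (s : seq K) (A : K -> set Omega) B : uniq s ->
  (forall q, measurable (A q)) -> measurable B ->
  (forall q, q \in s -> A q `<=` B) ->
  (forall q q', q \in s -> q' \in s -> q != q' -> A q `&` A q' = set0) ->
  \sum_(q <- s) fine (P (A q)) <= fine (P B).
Proof.
move=> + mA; elim: s B => [|q s IH] B /=.
  by move=> _ _ _ _; rewrite big_nil fine_ge0.
move=> /andP[qs us] mB sB dA; rewrite big_cons.
have AB : A q `<=` B by apply: sB; rewrite mem_head.
rewrite (measureDI P mB (mA q)) setIidr // fineD ?fin_num_measure //; last exact: measurableD.
rewrite addrC lerD2r; apply: IH => //; first exact: measurableD; last first.
  by move=> q1 q2 h1 h2; apply: dA; rewrite inE ?h1 ?h2 orbT.
move=> q' q's w wA; split; first by apply: sB wA; rewrite inE q's orbT.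
move=> wq; have : (A q `&` A q') w by [].
by rewrite dA // ?mem_head // ?inE ?q's ?orbT //; apply: contraNneq qs => ->.
Qed.

Lemma sigma_all (g : K -> (K -> R) -> bool) (s : seq K) :
  (forall z, <<s rect >> [set f | g z f]) ->
  <<s rect >> [set f | all (g^~ f) s].
Proof.
move=> hg; elim: s => [|z s IH].
  by have -> : [set f : K -> R | all (g^~ f) [::]] = setT; [apply/seteqP; split | exact: g_sigmaT].
have -> : [set f | all (g^~ f) (z :: s)] = [set f | g z f] `&` [set f | all (g^~ f) s].
  by apply/seteqP; split=> f /= => [/andP[]|[-> ->]].
exact: g_sigmaI.
Qed.

Lemma sigma_imply (b : bool) (x y : K) :
  <<s rect >> [set f : K -> R | b ==> (f x < f y)].
Proof.
case: b; first exact: sigma_lt.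
have -> : [set f : K -> R | false ==> (f x < f y)] = setT by apply/seteqP; split.
exact: g_sigmaT.
Qed.

Lemma sigma_pattern (x : K) (s : seq K) (m : seq bool) :
  <<s rect >> [set f : K -> R | [seq f x < f u | u <- s] = m].
Proof.
elim: s m => [|u s IH] [|b m].
- have -> : [set f : K -> R | [seq f x < f u | u <- [::]] = [::]] = setT.
    by apply/seteqP; split.
  exact: g_sigmaT.
- have -> : [set f : K -> R | [seq f x < f u | u <- [::]] = b :: m] = set0.
    by apply/seteqP; split.
  exact: g_sigma0.
- have -> : [set f : K -> R | [seq f x < f u | u <- u :: s] = [::]] = set0.
    by apply/seteqP; split.
  exact: g_sigma0.
have -> : [set f : K -> R | [seq f x < f u | u <- u :: s] = b :: m] =
    [set f : K -> R | (f x < f u) = b] `&` [set f : K -> R | [seq f x < f u | u <- s] = m].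
  by apply/seteqP; split=> f /= [-> ->].
refine (g_sigmaI _ (IH m)); case: b; first exact: sigma_lt.
have -> : [set f : K -> R | (f x < f u) = false] = ~` [set f : K -> R | f x < f u].
  by apply/seteqP; split=> f /=; [move=> -> | move=> /negP/negbTE].
exact: (g_sigmaC (sigma_lt x u)).
Qed.

Definition strict_max (M : seq K) (q : K) (f : K -> R) : bool :=
  all (fun q' => (q' != q) ==> (f q' < f q)) M.

Local Notation pr F := (fine (P (prios @^-1` F))).

(** Within the swap-invariant event [E] every key of [M] is as likely as [y] to be the strict
    maximum, and these events are disjoint. Ties only make their sum smaller. *)
Lemma strict_max_prob (E : set (K -> R)) (M : seq K) (y : K) :
  uniq M -> y \in M -> <<s rect >> E ->
  (forall q f, q \in M -> E f -> E (f \o swap y q)) ->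
  (size M)%:R * pr (E `&` [set f | strict_max M y f]) <= pr E.
Proof.
move=> uM yM sE symE; pose Z q := E `&` [set f | strict_max M q f].
have sZ q : <<s rect >> (Z q).
  refine (g_sigmaI sE _).
  by apply: (@sigma_all (fun q' f => (q' != q) ==> (f q' < f q)) M) => z; exact: sigma_imply.
have mZ q : measurable (prios @^-1` Z q) by have [] := exchange indep unif y y (sZ q).
have mE : measurable (prios @^-1` E) by have [] := exchange indep unif y y sE.
have eZ q : q \in M -> pr (Z q) = pr (Z y).
  move=> qM; have [_ _ ->] := exchange indep unif y q (sZ y).
  congr (fine (P _)); apply/seteqP; split=> w /=.
    move=> [Ew /allP hw]; split; first exact: (symE q _ qM Ew).
    apply/allP => k kM; apply/implyP => ky.
    have sM : swap y q k \in M by rewrite /swap; case: ifP => // _; case: ifP.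
    have := hw _ sM; rewrite /swapped /swap eqxx => /implyP; apply.
    by rewrite (negbTE ky); case: (eqVneq k q) => [ek|//]; rewrite eq_sym -ek.
  move=> [Ew /allP hw]; split.
    have := symE q _ qM Ew; rewrite /comp => Ew'.
    have -> // : prios w = (fun k => swapped prio y q w (swap y q k)).
    by apply/funext => k; rewrite /swapped swapK.
  apply/allP => k kM; apply/implyP => kq.
  have sM : swap y q k \in M by rewrite /swap; case: ifP => // _; case: ifP.
  have := hw _ sM; rewrite /swapped swapK [swap y q y]/swap eqxx => /implyP; apply.
  rewrite /swap; case: (eqVneq k y) => [ek|ky]; first by rewrite -ek eq_sym.
  by rewrite (negbTE kq).
have := @sum_disjoint_le M (fun q => prios @^-1` Z q) (prios @^-1` E) uM mZ mE.
have -> : \sum_(q <- M) pr (Z q) = (size M)%:R * pr (Z y).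
  rewrite big_seq (eq_bigr (fun=> pr (Z y))); last by move=> q; exact: eZ.
  by rewrite -big_seq big_const_seq count_predT iter_addr_0 mulr_natl.
apply; first by move=> q _ w [].
move=> q q' qM q'M qq'; apply/seteqP; split=> // w [[_ /= h1] [_ /= h2]].
have := implyP (allP h1 _ q'M); rewrite eq_sym qq' => /(_ isT) lt1.
have := implyP (allP h2 _ qM); rewrite qq' => /(_ isT) lt2.
by have := lt_trans lt1 lt2; rewrite ltxx.
Qed.

(** The head of the list is compared with all other keys, so it is a record only as strict maximum,
    with a share of at most 1/|M| of [E]; the remaining keys are not compared with it. Summing the
    shares gives the harmonic number. *)
Lemma record_sum (r : rel K) (E : set (K -> R)) (M : seq K) :
  (forall y z, r y z -> ~~ r z y) -> pairwise r M -> uniq M -> <<s rect >> E ->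
  (forall y q f, y \in M -> q \in M -> E f -> E (f \o swap y q)) ->
  \sum_(y <- M) pr (E `&` [set f : K -> R | all (fun z => r y z ==> (f z < f y)) M])
    <= harm R (size M) * pr E.
Proof.
move=> asym; elim: M => [|y M IH]; first by rewrite big_nil /harm big_ord0 mul0r.
rewrite [pairwise _ _]/= [uniq _]/= => /andP[/allP ry pM] /andP[yM uM] sE symE.
rewrite big_cons [leLHS]addrC /harm big_ord_recr [size _]/= mulrDl.
have rel0 z : r z z = false by apply/negbTE/negP => h; have := asym _ _ h; rewrite h.
apply: lerD.
  rewrite big_seq.
  rewrite (eq_bigr (fun z => pr (E `&`
      [set f : K -> R | all (fun t => r z t ==> (f t < f z)) M]))); last first.
    move=> z zM; congr (fine (P (_ @^-1` (E `&` _)))); apply/seteqP; split=> f /=.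
      by move=> /andP[].
    by rewrite (negbTE (asym _ _ (ry _ zM))).
  rewrite -big_seq; apply: IH => // z q f zM qM; apply: symE; by rewrite inE ?zM ?qM orbT.
rewrite mulrC ler_pdivlMr ?ltr0n // mulrC.
have := @strict_max_prob E (y :: M) y; rewrite [uniq _]/= yM uM mem_head => /(_ isT isT sE).
have -> : [set f : K -> R | strict_max (y :: M) y f] =
    [set f : K -> R | (r y y ==> (f y < f y)) && all (fun z => r y z ==> (f z < f y)) M].
  rewrite /strict_max /= eqxx rel0 /=; apply/seteqP; split=> f /= /allP h; apply/allP => z zM.
    by apply/implyP => _; apply: (implyP (h _ zM)); apply: contraNneq yM => <-.
  by apply/implyP => _; apply: (implyP (h _ zM)); exact: ry.
by apply=> q f; apply: symE; rewrite mem_head.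
Qed.

End Records.

(** * Ties have probability zero *)

Section Ties.
Context (R : realType) (dO : measure_display) (Omega : measurableType dO).
Context (P : probability Omega R) (d : Order.disp_t) (K : orderType d).
Variable prio : K -> {RV P >-> R}.
Hypothesis indep : mutually_independent prio.
Hypothesis unif : forall k, uniform01 (prio k).

Lemma uniform_prob_le (A : set R) : measurable A ->
  (uniform_prob (@ltr01 R) A <= lebesgue_measure (A `&` `[0%R, 1%R]))%E.
Proof.
move=> mA; rewrite /uniform_prob integral_uniform_pdf.
have mI : measurable (A `&` `[0%R, 1%R]) by exact: measurableI.
rewrite -[leRHS]mul1e -(integral_cst lebesgue_measure mI 1%E).
apply: ge0_le_integral => //.
- by move=> x _; rewrite lee_fin uniform_pdf_ge0.
- apply/measurable_EFinP; apply: measurable_funTS; exact: measurable_uniform_pdf.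
- by move=> x [_ /=]; rewrite in_itv /= => x01; rewrite lee_fin /uniform_pdf x01 subr0 invr1.
Qed.

Definition cell (n i : nat) : set R := `[i%:R / n%:R, i.+1%:R / n%:R[.

Lemma uniform_cell n i : (0 < n)%N ->
  (uniform_prob (@ltr01 R) (cell n i) <= (n%:R^-1)%:E)%E.
Proof.
move=> n0; have np : 0 < n%:R :> R by rewrite ltr0n.
apply: (le_trans (uniform_prob_le _)); first exact: measurable_itv.
apply: (@le_trans _ _ (lebesgue_measure (cell n i))).
  by apply: le_measure; rewrite ?inE; [apply: measurableI|..|exact: subIsetl]; exact: measurable_itv.
rewrite /cell lebesgue_measure_itv /= lte_fin ltr_pM2r ?invr_gt0 // ltr_nat ltnSn.
by rewrite -EFinB lee_fin -mulrBl -natrB // subSnn mul1r.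
Qed.

Lemma measurable_tie (a b : K) : measurable [set w | prio a w = prio b w].
Proof.
have -> : [set w | prio a w = prio b w] =
    prios prio @^-1` (~` [set f | f a < f b] `&` ~` [set f | f b < f a]).
  apply/seteqP; split=> w /=; rewrite /prios; first by move=> ->; rewrite ltxx.
  by move=> [/negP + /negP]; rewrite -!leNgt => h1 h2; apply/eqP; rewrite eq_le h1 h2.
have [] // := exchange indep unif a a
  (g_sigmaI (g_sigmaC (sigma_lt a b)) (g_sigmaC (sigma_lt b a))).
Qed.

(** Equal priorities in [0, 1) fall into the same one of n cells of width 1/n; by independence this
    has probability at most n times 1/n^2, for every n. *)
Lemma tie_null (a b : K) : a != b -> P [set w | prio a w = prio b w] = 0%E.
Proof.
move=> ab; apply/eqP; rewrite eq_le measure_ge0 andbT; apply/lee_addgt0Pr => e e0.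
rewrite add0e; pose n := (Num.truncn e^-1).+1.
have np : 0 < n%:R :> R by rewrite ltr0n.
have ne : n%:R^-1 < e.
  by rewrite -[e]invrK ltf_pV2 ?posrE ?invr_gt0 //; exact: truncnS_gt.
(* The half-open cells miss the endpoint 1 and everything outside the unit interval; that null event
   is set apart. *)
pose out := prio a @^-1` (~` `[0%R, 1%R[).
pose C i := (prio a @^-1` cell n i) `&` (prio b @^-1` cell n i).
have mcell i : measurable (cell n i) by exact: measurable_itv.
have mC i : measurable (C i) by apply: measurableI; exact: measurable_funPTI.
have mo : measurable (~` `[0%R, 1%R[ : set R) by apply: measurableC; exact: measurable_itv.
have mout : measurable out by exact: measurable_funPTI.
have mU : measurable (\big[setU/set0]_(i < n) C i) by exact: bigsetU_measurable.
have sub : [set w | prio a w = prio b w] `<=` out `|` \big[setU/set0]_(i < n) C i.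
  move=> w /= eab; case: (pselect (out w)) => [|nout]; [by left|right].
  have : [set` `[0%R, 1%R[] (prio a w) by apply: contrapT.
  rewrite /= in_itv /= => /andP[w0 w1]; rewrite -bigcup_mkord.
  have t0 : 0 <= prio a w * n%:R by rewrite mulr_ge0 // ltW.
  have /andP[t1 t2] := truncn_itv t0.
  exists (Num.truncn (prio a w * n%:R)).
    by rewrite /= truncn_lt_nat // -[ltRHS]mul1r ltr_pM2r.
  by rewrite /C /= -eab; split; rewrite /cell /= in_itv /= ler_pdivrMr // ltr_pdivlMr // t1 t2.
have Pout : P out = 0%E.
  have := unif a mo; rewrite /distribution /pushforward => ->.
  apply/eqP; rewrite eq_le measure_ge0 andbT.
  apply: (le_trans (uniform_prob_le mo)).
  have -> : ~` `[0%R, 1%R[ `&` `[0%R, 1%R] = [set 1%R : R].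
    apply/seteqP; split=> t /=; rewrite !in_itv /=.
      by move=> [h /andP[t0 t1]]; apply/eqP; rewrite eq_le t1 /= leNgt; apply/negP => ?; apply: h; rewrite t0.
    by move=> ->; rewrite ltxx andbF lexx ler01.
  by rewrite lebesgue_measure_set1.
have PC i : (P (C i) <= (n%:R^-1 * n%:R^-1)%:E)%E.
  have -> : C i = \bigcap_(k in [set` [:: a; b]]) (prio k @^-1` cell n i).
    apply/seteqP; split=> w /=.
      by move=> [h1 h2] k /=; rewrite !inE => /orP[] /eqP ->.
    by move=> h; split; apply: h => /=; rewrite !inE eqxx ?orbT.
  rewrite (indep (B := fun=> cell n i)) //=; last by rewrite inE ab.
  rewrite !big_cons big_nil mule1 EFinM.
  have u k : P (prio k @^-1` cell n i) = uniform_prob (@ltr01 R) (cell n i).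
    by have := unif k (mcell i); rewrite /distribution /pushforward.
  by rewrite !u; apply: lee_pmul; rewrite ?measure_ge0 ?uniform_cell.
apply: (@le_trans _ _ (P (out `|` \big[setU/set0]_(i < n) C i))).
  by apply: le_measure; rewrite ?inE //; [exact: measurable_tie|exact: measurableU].
apply: (@le_trans _ _ (P out + P (\big[setU/set0]_(i < n) C i))%E).
  exact: measureU2.
rewrite Pout add0e; apply: (@le_trans _ _ (\sum_(i < n) P (C i))%E).
  exact: Boole_inequality.
apply: (@le_trans _ _ (\sum_(i < n) (n%:R^-1 * n%:R^-1)%:E)%E); first exact: lee_sum.
rewrite sumEFin lee_fin sumr_const card_ord -[_ *+ n]mulr_natl mulrA mulfV ?gt_eqF // mul1r.
exact: ltW.
Qed.

Lemma null_exists (s : seq K) (A : K -> set Omega) :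
  (forall k, measurable (A k) /\ P (A k) = 0%E) ->
  measurable [set w | exists2 k, k \in s & A k w] /\
  P [set w | exists2 k, k \in s & A k w] = 0%E.
Proof.
move=> hA; elim: s => [|k s [mS PS]].
  have -> : [set w | exists2 k, k \in [::] & A k w] = set0.
    by apply/seteqP; split=> w // -[].
  by rewrite measure0.
have [mk Pk] := hA k.
have -> : [set w | exists2 j, j \in k :: s & A j w] =
    A k `|` [set w | exists2 j, j \in s & A j w].
  apply/seteqP; split=> w /=.
    by move=> [j]; rewrite inE => /orP[/eqP -> ?|js ?]; [left|right; exists j].
  by move=> [?|[j js ?]]; [exists k; rewrite ?mem_head|exists j; rewrite ?inE ?js ?orbT].
split; first exact: measurableU.
apply/eqP; rewrite eq_le measure_ge0 andbT; apply: (@le_trans _ _ (P (A k) + P [set w | exists2 j, j \in s & A j w])%E).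
  exact: measureU2.
by rewrite Pk PS adde0.
Qed.

Lemma ties_null (s : seq K) : exists N : set Omega, [/\ measurable N, P N = 0%E &
  forall w, ~ N w -> {in s &, injective (fun k => prio k w)}].
Proof.
pose A a := [set w | exists2 b, b \in s & (a != b) && (prio a w == prio b w)].
have hA a : measurable (A a) /\ P (A a) = 0%E.
  apply: (null_exists s (A := fun b => [set w | (a != b) && (prio a w == prio b w)])) => b.
  have [eab|ab] := eqVneq a b.
    have -> : [set w | false && (prio a w == prio b w)] = set0 by apply/seteqP; split.
    by rewrite measure0.
  have -> : [set w | true && (prio a w == prio b w)] = [set w | prio a w = prio b w].
    by apply/seteqP; split=> w /= /eqP.
  by split; [exact: measurable_tie | exact: tie_null].
have [mN PN] := null_exists s hA.
exists [set w | exists2 a, a \in s & A a w]; split=> // w nN a b sa sb /= eab.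
apply/eqP; apply: contrapT => /negP ab; apply: nN; exists a => //; exists b => //.
by rewrite ab eab eqxx.
Qed.

End Ties.

(** * Expected join and split work of treaps *)

Section TreapExpectation.
Context (R : realType) (dO : measure_display) (Omega : measurableType dO).
Context (P : probability Omega R) (d : Order.disp_t) (K : orderType d).
Variable prio : K -> {RV P >-> R}.
Hypothesis indep : mutually_independent prio.
Hypothesis unif : forall k, uniform01 (prio k).
Variables (s1 s2 : seq K) (o : set_op) (x : K).
Hypothesis sorted1 : sorted (fun y z : K => (y < z)%O) s1.
Hypothesis sorted2 : sorted (fun y z : K => (y < z)%O) s2.
Local Notation prios := (prios prio).
Local Notation pattern := ((size s2).-tuple bool).
Local Notation pr F := (fine (P (prios @^-1` F))).

(** The events conditioned on: patterns partition the space, and each fixes [higher], hence the key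
    set of Td and the sets [lkeys] and [rkeys]. *)
Definition pattern_set (m : pattern) : set (K -> R) :=
  [set f | [seq f x < f u | u <- s2] = m].

Lemma higher_pattern (m : pattern) f : pattern_set m f -> higher f x s2 = mask m s2.
Proof. by move=> /= e; rewrite /higher filter_mask e. Qed.

Lemma measurable_pattern_set m : measurable (prios @^-1` pattern_set m).
Proof. by have [] := exchange indep unif x x (@sigma_pattern R _ _ x s2 m). Qed.

Lemma visible_notin (hi : seq K) (z : K) : visible x hi z -> z \notin hi.
Proof.
move=> vz; apply/negP => /(allP vz); rewrite /between lexx /=.
by case: (leP z x) => //= /ltW ->.
Qed.

(* Within a pattern, the keys of M are interchangeable: either none of them is
   a pivot key, or all of them are pivot keys of lower priority than x. *)
Lemma pattern_swap (m : pattern) (M : seq K) y q f :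
  {in M, forall k, [&& visible x (mask m s2) k, k != x & in_op o s2 k]} ->
  y \in M -> q \in M -> pattern_set m f -> pattern_set m (f \o swap y q).
Proof.
move=> hM yM qM fm; rewrite /pattern_set /= -[RHS]fm; apply/eq_in_map => u us2 /=.
have /and3P[vy yx oy] := hM _ yM; have /and3P[vq qx oq] := hM _ qM.
have -> : swap y q x = x by rewrite /swap ![x == _]eq_sym (negbTE yx) (negbTE qx).
have low k : k \in s2 -> visible x (mask m s2) k -> (f x < f k) = false.
  move=> ks2 /visible_notin; rewrite -(higher_pattern fm) mem_filter ks2 andbT.
  by move/negbTE.
rewrite /swap; have [euy|uy] := eqVneq u y.
  rewrite euy in us2 *; move: oy oq; rewrite /in_op us2.
  by case: (o) => // _ qs2; rewrite !low.
have [euq|//] := eqVneq u q.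
rewrite euq in us2 *; move: oy oq; rewrite /in_op us2.
by case: (o) => // ys2 _; rewrite !low.
Qed.

Lemma sum_recordR (m : pattern) (M := lkeys o s1 s2 x (mask m s2)) :
  \sum_(y <- M) pr (pattern_set m `&` [set f | recordR f M y])
    <= harm R (size M) * pr (pattern_set m).
Proof.
have sM : sorted (fun y z : K => (y < z)%O) M by apply: sorted_filter => //; exact: lt_trans.
apply: (record_sum indep unif (r := fun y z => (y < z)%O)).
- by move=> y z yz; rewrite -leNgt ltW.
- by rewrite -(sorted_pairwise lt_trans).
- exact: (sorted_uniq lt_trans lt_irreflexive sM).
- exact: sigma_pattern.
- move=> y q f yM qM; apply: (pattern_swap (M := M)) => // k.
  by rewrite mem_filter => /andP[/and3P[-> kx ->] _]; rewrite lt_eqF.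
Qed.

Lemma sum_recordL (m : pattern) (M := rkeys o s1 s2 x (mask m s2)) :
  \sum_(y <- M) pr (pattern_set m `&` [set f | recordL f M y])
    <= harm R (size M) * pr (pattern_set m).
Proof.
have sM : sorted (fun y z : K => (y < z)%O) M by apply: sorted_filter => //; exact: lt_trans.
(* Left-to-right records are the right-to-left records of the reversed list for the converse
   order. *)
have := @record_sum R dO Omega P d K prio indep unif (fun y z => (z < y)%O)
  (pattern_set m) (rev M).
rewrite size_rev (perm_big M) /=; last by rewrite perm_rev.
under eq_bigr do under eq_set do rewrite all_rev.
apply.
- by move=> y z yz; rewrite -leNgt ltW.
- rewrite -(sorted_pairwise (fun a b c (h : (a < b)%O) h' => lt_trans h' h)).
  by rewrite rev_sorted.
- by rewrite rev_uniq (sorted_uniq lt_trans lt_irreflexive sM).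
- exact: sigma_pattern.
- move=> y q f; rewrite !mem_rev => yM qM; apply: (pattern_swap (M := M)) => // k.
  by rewrite mem_filter => /andP[/and3P[-> kx ->] _]; rewrite gt_eqF.
Qed.

Definition reach (m : pattern) : nat := count (visible x (mask m s2)) s1.

Lemma size_lkeys (m : pattern) : (size (lkeys o s1 s2 x (mask m s2)) <= reach m)%N.
Proof. by rewrite size_filter; apply: sub_count => z /and3P[]. Qed.

Lemma size_rkeys (m : pattern) : (size (rkeys o s1 s2 x (mask m s2)) <= reach m)%N.
Proof. by rewrite size_filter; apply: sub_count => z /and3P[]. Qed.

(** The join bound of [treap_call_bounds] integrated over the event of pattern [m]. *)
Let cost (m : pattern) : R :=
  3 * (\sum_(y <- lkeys o s1 s2 x (mask m s2))
         pr (pattern_set m `&` [set f | recordR f (lkeys o s1 s2 x (mask m s2)) y]) +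
       \sum_(y <- rkeys o s1 s2 x (mask m s2))
         pr (pattern_set m `&` [set f | recordL f (rkeys o s1 s2 x (mask m s2)) y]) +
       (0 < reach m)%N%:R * pr (pattern_set m)).

(** 15 = 3(2 + 2 + 1): a harmonic number for each spine, each at most twice the logarithm, and the
    constant part, at most once the logarithm. *)
Lemma cost_le m : cost m <= 15 * ((trunc_log 2 (reach m).+1)%:R * pr (pattern_set m)).
Proof.
have p0 : 0 <= pr (pattern_set m) by rewrite fine_ge0.
have hl := le_trans (sum_recordR m) (ler_wpM2r p0 (harm_le R (size_lkeys m))).
have hr := le_trans (sum_recordL m) (ler_wpM2r p0 (harm_le R (size_rkeys m))).
have h0 : (0 < reach m)%N%:R * pr (pattern_set m)
    <= (trunc_log 2 (reach m).+1)%:R * pr (pattern_set m).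
  apply: ler_wpM2r => //; rewrite ler_nat; have [//|r0] := posnP (reach m).
  by rewrite (@leq_trunc_log 2 2 (reach m).+1).
rewrite /cost; move: hl hr h0; rewrite -!mulrA; lra.
Qed.

Section Works.
Variables (N : set Omega) (J S : Omega -> nat).
Hypothesis mN : measurable N.
Hypothesis PN : P N = 0%E.
Hypothesis J_le : forall w m, ~ N w -> pattern_set m (prios w) ->
  (J w <= 3 * (count (recordR (prios w) (lkeys o s1 s2 x (mask m s2)))
                     (lkeys o s1 s2 x (mask m s2)) +
               count (recordL (prios w) (rkeys o s1 s2 x (mask m s2)))
                     (rkeys o s1 s2 x (mask m s2)) + (0 < reach m)))%N.
Hypothesis S_ge : forall w m, ~ N w -> pattern_set m (prios w) ->
  (trunc_log 2 (reach m).+1 <= S w)%N.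

Let terms (m : pattern) : seq (\bar R * set Omega) :=
  [seq (3%:E, prios @^-1` (pattern_set m `&`
      [set f | recordR f (lkeys o s1 s2 x (mask m s2)) y]))
    | y <- lkeys o s1 s2 x (mask m s2)] ++
  [seq (3%:E, prios @^-1` (pattern_set m `&`
      [set f | recordL f (rkeys o s1 s2 x (mask m s2)) y]))
    | y <- rkeys o s1 s2 x (mask m s2)] ++
  [:: ((3 * (0 < reach m)%N%:R)%:E, prios @^-1` pattern_set m)].

Let sigma_recordR m M y : <<s @rect R d K >> (pattern_set m `&` [set f | recordR f M y]).
Proof.
refine (g_sigmaI (sigma_pattern _ _ _) _).
by apply: (@sigma_all _ _ _ (fun z f => (y < z)%O ==> (f z < f y))) => z; exact: sigma_imply.
Qed.

Let sigma_recordL m M y : <<s @rect R d K >> (pattern_set m `&` [set f | recordL f M y]).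
Proof.
refine (g_sigmaI (sigma_pattern _ _ _) _).
by apply: (@sigma_all _ _ _ (fun z f => (z < y)%O ==> (f z < f y))) => z; exact: sigma_imply.
Qed.

Let measurable_recordR m M y :
  measurable (prios @^-1` (pattern_set m `&` [set f | recordR f M y])).
Proof. by have [] := exchange indep unif x x (@sigma_recordR m M y). Qed.

Let measurable_recordL m M y :
  measurable (prios @^-1` (pattern_set m `&` [set f | recordL f M y])).
Proof. by have [] := exchange indep unif x x (@sigma_recordL m M y). Qed.

Let terms_ok m cA : List.In cA (terms m) -> (0 <= cA.1)%E /\ measurable cA.2.
Proof.
rewrite /terms => h; case: (In_cat h) => {}h; first have [y e] := In_map h.
  by rewrite -e; split; rewrite ?lee_fin //; exact: measurable_recordR.
case: (In_cat h) => {}h; first have [y e] := In_map h.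
  by rewrite -e; split; rewrite ?lee_fin //; exact: measurable_recordL.
case: h => // <-; split; last exact: measurable_pattern_set.
by rewrite lee_fin mulr_ge0.
Qed.

(** The weight +oo on [N] makes the sum dominate [J] at every sample point, at no cost: [N] is null,
    so that term integrates to 0. *)
Let all_terms := (+oo%E, N) :: flatten [seq terms m | m <- enum {: pattern}].

Let all_terms_ok cA : List.In cA all_terms -> (0 <= cA.1)%E /\ measurable cA.2.
Proof.
move=> /= [<-|]; first by split; [exact: leey | exact: mN].
elim: (enum _) => //= m ms IH h; case: (In_cat h) => //; exact: terms_ok.
Qed.

Lemma expectation_J_le :
  (\int[P]_w (J w)%:R%:E <= \sum_m (cost m)%:E)%E.
Proof.
apply: (@le_trans _ _ (\int[P]_w (\sum_(cA <- all_terms) cA.1 * (\1_(cA.2) w)%:E))%E).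
  apply: ge0_le_integralT => [w|w]; first by rewrite lee_fin.
  rewrite /all_terms big_cons /= big_flatten /= big_map big_enum /=.
  have nn m : (0 <= \sum_(cA <- terms m) cA.1 * (\1_(cA.2) w)%:E)%E.
    elim: (terms m) (@terms_ok m) => [_|cA l IH h]; first by rewrite big_nil.
    rewrite big_cons adde_ge0 ?IH //; last by move=> c hc; apply: h; right.
    by rewrite mule_ge0 ?lee_fin //; have [] := h cA (or_introl erefl).
  case: (pselect (N w)) => Nw.
    rewrite indicE mem_set // mule1 addye ?leey // gt_eqF // (lt_le_trans (ltNyr 0)) //.
    exact: sume_ge0.
  rewrite indicE memNset // mule0 add0e.
  (* The pattern realised at [w]: its terms alone dominate [J w], and the other terms are
     nonnegative. *)
  pose m0 : pattern := [tuple of map_tuple (fun u => prio x w < prio u w) (in_tuple s2)].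
  have wm0 : pattern_set m0 (prios w) by [].
  rewrite (bigD1 m0) //=.
  apply: (@le_trans _ _ (\sum_(cA <- terms m0) cA.1 * (\1_(cA.2) w)%:E)%E); last first.
    by apply: leeDl; apply: sume_ge0 => m _; exact: nn.
  rewrite /terms !big_cat /= !big_map big_seq1 /=.
  have ind (A : set (K -> R)) (b : bool) : A (prios w) = b ->
      (\1_(prios @^-1` (pattern_set m0 `&` A)) w : R) = b%:R.
    move=> e; rewrite indicE; congr (_%:R); congr nat_of_bool; apply/idP/idP.
      by rewrite inE => -[_]; rewrite e.
    by move=> hb; rewrite inE; split=> //; rewrite e.
  have cnt (p : pred K) (s : seq K) :
      (\sum_(y <- s) 3%:E * (p y)%:R%:E)%E = (3 * (count p s)%:R)%:E :> \bar R.
    elim: s => [|y s IH]; first by rewrite big_nil mulr0.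
    by rewrite big_cons IH /= natrD mulrDr EFinD EFinM.
  rewrite (eq_bigr (fun y => 3%:E *
    (recordR (prios w) (lkeys o s1 s2 x (mask m0 s2)) y)%:R%:E)%E); last first.
    by move=> y _; rewrite (@ind _ (recordR (prios w) (lkeys o s1 s2 x (mask m0 s2)) y)).
  rewrite [X in (_ <= _ + (X + _))%E](eq_bigr (fun y => 3%:E *
    (recordL (prios w) (rkeys o s1 s2 x (mask m0 s2)) y)%:R%:E)%E); last first.
    by move=> y _; rewrite (@ind _ (recordL (prios w) (rkeys o s1 s2 x (mask m0 s2)) y)).
  rewrite !cnt indicE mem_set // mule1 -!EFinD lee_fin -!mulrDr addrA -!natrD -natrM ler_nat.
  exact: J_le.
rewrite integral_sum_indic; last exact: all_terms_ok.
rewrite /all_terms big_cons /= PN mule0 add0e big_flatten /= big_map big_enum /=.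
apply: lee_sum => m _; rewrite /terms !big_cat /= !big_map big_seq1 /=.
rewrite /cost (probE P (measurable_pattern_set m)).
rewrite (eq_bigr (fun y => (3 * pr (pattern_set m `&`
   [set f | recordR f (lkeys o s1 s2 x (mask m s2)) y]))%:E)); last first.
  by move=> y _; rewrite EFinM -(probE P (measurable_recordR _ _ _)).
rewrite [X in (_ + (X + _) <= _)%E](eq_bigr (fun y => (3 * pr (pattern_set m `&`
   [set f | recordL f (rkeys o s1 s2 x (mask m s2)) y]))%:E)); last first.
  by move=> y _; rewrite EFinM -(probE P (measurable_recordL _ _ _)).
by rewrite !sumEFin -!EFinM -!EFinD lee_fin -!mulr_sumr; lra.
Qed.

(** Dual to the upper bound: the simple function below [S] is set to 0 on [N], which does not change
    its integral. *)
Lemma expectation_S_ge :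
  (\sum_m ((trunc_log 2 (reach m).+1)%:R * pr (pattern_set m))%:E
     <= \int[P]_w (S w)%:R%:E)%E.
Proof.
pose lows := [seq ((trunc_log 2 (reach m).+1)%:R%:E : \bar R,
  prios @^-1` pattern_set m `\` N) | m <- enum {: pattern}].
have lows_ok cA : List.In cA lows -> (0 <= cA.1)%E /\ measurable cA.2.
  move=> h; have [m e] := In_map h; rewrite -e; split; rewrite ?lee_fin //=.
  by apply: measurableD => //; exact: measurable_pattern_set.
have -> : (\sum_m ((trunc_log 2 (reach m).+1)%:R * pr (pattern_set m))%:E =
    \int[P]_w (\sum_(cA <- lows) cA.1 * (\1_(cA.2) w)%:E))%E.
  rewrite integral_sum_indic // big_map big_enum /=; apply: eq_bigr => m _.
  rewrite EFinM -(probE P (measurable_pattern_set m)).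
  congr (_ * _)%E; rewrite (measureDI P (measurable_pattern_set m) mN).
  rewrite [X in (_ + X)%E](_ : _ = 0%E) ?adde0 //.
  have mI : measurable (prios @^-1` pattern_set m `&` N).
    by apply: measurableI => //; exact: measurable_pattern_set.
  by apply: (subset_measure0 mI mN _ PN); exact: subIsetr.
apply: ge0_le_integralT => w; rewrite big_map big_enum /=.
  by apply: sume_ge0 => m _; rewrite mule_ge0 ?lee_fin.
case: (pselect (N w)) => Nw.
  rewrite big1 ?lee_fin // => m _; rewrite indicE memNset ?mule0 //.
  by move=> [_]; exact.
pose m0 : pattern := [tuple of map_tuple (fun u => prio x w < prio u w) (in_tuple s2)].
have wm0 : pattern_set m0 (prios w) by [].
rewrite (bigD1 m0) //= big1 ?adde0.
  by rewrite indicE mem_set // mule1 lee_fin ler_nat; exact: S_ge.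
move=> m mm0; rewrite indicE memNset ?mule0 // => -[/= e _].
by move: mm0; rewrite -val_eqE /= -e eqxx.
Qed.

Lemma expectation_J_le_S :
  (\int[P]_w (J w)%:R%:E <= 15%:R%:E * \int[P]_w (S w)%:R%:E)%E.
Proof.
apply: (le_trans expectation_J_le).
apply: (@le_trans _ _ (15%:R%:E *
    \sum_m ((trunc_log 2 (reach m).+1)%:R * pr (pattern_set m))%:E)%E).
  rewrite !sumEFin -EFinM lee_fin mulr_sumr; apply: ler_sum => m _; exact: cost_le.
by apply: lee_pmul => //; [rewrite sumEFin lee_fin sumr_ge0 // => m _; rewrite mulr_ge0 ?fine_ge0
  | exact: expectation_S_ge].
Qed.

End Works.

Variables T1 T2 : Omega -> tree unit K.
Hypothesis treap1 : random_treap prio s1 T1.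
Hypothesis treap2 : random_treap prio s2 T2.

Lemma treap_join_le_split_expectation :
  ('E_P[fun w => (join_work_at (treap_join (fun k => prio k w)) o (T1 w) (T2 w) x)%:R]
     <= 15%:R%:E *
        'E_P[fun w => (split_work_at (treap_join (fun k => prio k w))
                         (T1 w) (T2 w) x)%:R])%E.
Proof.
rewrite unlock; case: (boolP (x \in s2)) => xs2; last first.
  have none w : call_at (treap_join (fun k => prio k w)) (T1 w) (T2 w) x = None.
    case e : call_at => [[Td Tp]|//]; have := call_at_mem e.
    by have [_ h] := treap2; have [-> _] := h w; rewrite (negbTE xs2).
  rewrite (eq_integral (cst 0%E)); last first.
    by move=> w _; rewrite /join_work_at none.
  rewrite integral0 mule_ge0 ?lee_fin //; apply: integral_ge0 => w _.
  by rewrite lee_fin.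
have [N [mN PN injN]] := ties_null indep unif (s1 ++ s2).
have [_ h1] := treap1; have [_ h2] := treap2.
have bounds w m : ~ N w -> pattern_set m (prios w) ->
    (join_work_at (treap_join (fun k => prio k w)) o (T1 w) (T2 w) x <=
      3 * (count (recordR (prios w) (lkeys o s1 s2 x (mask m s2)))
                     (lkeys o s1 s2 x (mask m s2)) +
               count (recordL (prios w) (rkeys o s1 s2 x (mask m s2)))
                     (rkeys o s1 s2 x (mask m s2)) + (0 < reach m)))%N /\
    (trunc_log 2 (reach m).+1 <=
      split_work_at (treap_join (fun k => prio k w)) (T1 w) (T2 w) x)%N.
  move=> Nw wm; have [e1 hp1] := h1 w; have [e2 hp2] := h2 w.
  have := @treap_call_bounds d K R (prios w) o (T1 w) (T2 w) x.
  rewrite /bst e1 e2 (higher_pattern wm); apply=> //; exact: injN.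
apply: (expectation_J_le_S mN PN) => w m Nw wm; by have [] := bounds w m Nw wm.
Qed.

End TreapExpectation.

Theorem theorem5 (R : realType) :
  [/\
    (* AVL trees *)
    exists C : nat, forall (d : Order.disp_t) (K : orderType d)
        (T1 T2 : tree unit K) (o : set_op) (x : K),
      bst T1 -> avl T1 -> bst T2 -> avl T2 ->
      (join_work_at (@avl_join K) o T1 T2 x
         <= C * split_work_at (@avl_join K) T1 T2 x)%N,
    (* red-black trees *)
    exists C : nat, forall (d : Order.disp_t) (K : orderType d)
        (T1 T2 : tree color K) (o : set_op) (x : K),
      bst T1 -> rb T1 -> bst T2 -> rb T2 ->
      (join_work_at (@rb_join K) o T1 T2 x
         <= C * split_work_at (@rb_join K) T1 T2 x)%N,
    (* weight-balanced trees *)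
    forall alpha : R, 2 / 11 < alpha -> alpha <= 1 - 1 / Num.sqrt 2 ->
    exists C : nat, forall (d : Order.disp_t) (K : orderType d)
        (T1 T2 : tree unit K) (o : set_op) (x : K),
      bst T1 -> wb alpha T1 -> bst T2 -> wb alpha T2 ->
      (join_work_at (@wb_join R alpha K) o T1 T2 x
         <= C * split_work_at (@wb_join R alpha K) T1 T2 x)%N
    & (* treaps *)
    exists C : nat, forall (d : Order.disp_t) (K : orderType d)
        (dO : measure_display) (Omega : measurableType dO)
        (P : probability Omega R) (prio : K -> {RV P >-> R})
        (s1 s2 : seq K) (T1 T2 : Omega -> tree unit K) (o : set_op) (x : K),
      mutually_independent prio -> (forall k : K, uniform01 (prio k)) ->
      sorted (fun y z : K => (y < z)%O) s1 ->
      sorted (fun y z : K => (y < z)%O) s2 ->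
      random_treap prio s1 T1 -> random_treap prio s2 T2 ->
      ('E_P[fun w => (join_work_at (treap_join (fun k => prio k w))
                        o (T1 w) (T2 w) x)%:R]
         <= C%:R%:E *
            'E_P[fun w => (split_work_at (treap_join (fun k => prio k w))
                             (T1 w) (T2 w) x)%:R])%E ].
Proof.
split.
(* 57 and 157 are 50c + 7 for c = 1 and c = 3, the factors in the work bounds of the AVL and
   red-black joins. *)
- by exists 57%N => d K T1 T2 o x b1 a1 _ a2; exact: avl_join_le_split_work.
- by exists 157%N => d K T1 T2 o x b1 a1 _ a2; exact: rb_join_le_split_work.
- move=> alpha a_gt a_le.
  have s0 : 0 < Num.sqrt 2 :> R by rewrite sqrtr_gt0.
  have i0 : 0 < (Num.sqrt 2)^-1 :> R by rewrite invr_gt0.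
  have i2 : (Num.sqrt 2)^-1 ^+ 2 = 2^-1 :> R by rewrite exprVn sqr_sqrtr.
  have a_le' : (Num.sqrt 2)^-1 <= 1 - alpha by rewrite div1r in a_le; lra.
  have a_sq : 1 <= 2 * (1 - alpha) ^+ 2.
    have : (Num.sqrt 2)^-1 ^+ 2 <= (1 - alpha) ^+ 2.
      by rewrite lerXn2r // nnegrE; lra.
    by rewrite i2; lra.
  have a_lt1 : alpha < 1 by lra.
  exists 305%N => d K T1 T2 o x b1 w1 _ w2.
  exact: wb_join_le_split_work.
- exists 15%N => d K dO Omega P prio s1 s2 T1 T2 o x indep unif st1 st2 t1 t2.
  exact: (treap_join_le_split_expectation indep unif o x st1 st2 t1 t2).
Qed.
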